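(* Let $N\ge1$ be an integer, $H=(H_1,\dots,H_N)\in(0,1)^N$, $Q=\sum_{j=1}^N H_j^{-1}$, and $\rho(s,t)=\sum_{j=1}^N|s_j-t_j|^{H_j}$ for $s,t\in\mathbb{R}^N$. Let $\{X_0(t),t\in\mathbb{R}^N\}$ be a real-valued centered Gaussian random field with stationary increments, $X_0(0)=0$, continuous covariance function, and spectral measure $F$ (with no linear term, i.e. $\mathbb{E}[X_0(s)X_0(t)]=\int_{\mathbb{R}^N}(e^{i\langle s,\lambda\rangle}-1)(e^{-i\langle t,\lambda\rangle}-1)F(d\lambda)$). Suppose that for some constant $h>0$, $$0<\liminf_{\|\lambda\|\to\infty}\rho(0,\lambda)^{Q+2}F(C(\lambda,h))\le\limsup_{\|\lambda\|\to\infty}\rho(0,\lambda)^{Q+2}F(C(\lambda,h))<\infty.$$ Then for any $T>0$ such that $ThN<\log 2$, the following two conditions hold on $C(0,T)$: (C1) there is a constant $c_1\ge1$ such that $c_1^{-1}\rho(s,t)^2\le\mathbb{E}\big[(X_0(s)-X_0(t))^2\big]\le c_1\rho(s,t)^2$ for all $s,t\in C(0,T)$; (C2) there is a constant $c_2>0$ such that for all integers $n\ge1$ and all $u,t^1,\dots,t^n\in C(0,T)$, $\mathrm{Var}\big(X_0(u)\mid X_0(t^1),\dots,X_0(t^n)\big)\ge c_2\min_{0\le k\le n}\rho(u,t^k)^2$, where $t^0=0$.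
   Context: For $\lambda\in\mathbb{R}^N$ and $h>0$, $C(\lambda,h)=\{x\in\mathbb{R}^N:|x_j-\lambda_j|\le h,\ j=1,\dots,N\}$. $\langle\cdot,\cdot\rangle$ and $\|\cdot\|$ are the Euclidean inner product and norm. Spectral measure: a centered Gaussian field $X_0$ with stationary increments, $X_0(0)=0$ and continuous covariance has (Yaglom) a covariance of the form $\int_{\mathbb{R}^N}(e^{i\langle s,\lambda\rangle}-1)(e^{-i\langle t,\lambda\rangle}-1)F(d\lambda)+\langle s,Mt\rangle$, where $M$ is a non-negative definite matrix and $F$, the spectral measure, is a nonnegative symmetric measure on $\mathbb{R}^N\setminus\{0\}$ with $\int_{\mathbb{R}^N}\frac{\|\lambda\|^2}{1+\|\lambda\|^2}F(d\lambda)<\infty$. It is assumed that $M=0$. $F$ is arbitrary otherwise (it may have absolutely continuous, discrete or other parts). *)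

(* Defs.v *)
From HB Require Import structures.
From mathcomp Require Import all_boot all_order all_algebra.
From mathcomp Require Import complex.
From mathcomp Require Import all_classical all_reals all_analysis.

Set Implicit Arguments.
Unset Strict Implicit.
Unset Printing Implicit Defensive.

Import Order.TTheory GRing.Theory Num.Theory.
Import numFieldNormedType.Exports.

Local Open Scope classical_set_scope.
Local Open Scope ring_scope.

Section euclidean_space.
Context {R : realType} {N : nat}.
Implicit Types x y s t l : 'rV[R]_N.

Definition edot x y : R := \sum_(j < N) x 0 j * y 0 j.

(* The norm `|x| that the library puts on 'rV[R]_N is the sup norm. *)
Definition enorm x : R := Num.sqrt (edot x x).

Definition cube l (h : R) : set 'rV[R]_N :=
  [set x | forall j : 'I_N, `|x 0 j - l 0 j| <= h].

Definition rho (H : 'I_N -> R) s t : R :=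
  \sum_(j < N) `|s 0 j - t 0 j| `^ H j.

Definition homdim (H : 'I_N -> R) : R := \sum_(j < N) (H j)^-1.

(* The filter "||l|| tends to infinity". *)
Definition enorm_infty : set_system 'rV[R]_N :=
  filter_from [set: R] (fun M => [set l | M < enorm l]).

End euclidean_space.

(* R^N with its Borel sigma-algebra. *)
Definition borelRV (R : realType) (N : nat) :=
  g_sigma_algebraType (@open 'rV[R]_N).

Section complex_integral.
Context {R : realType}.
Local Open Scope complex_scope.

Definition expi (x : R) : R[i] := cos x +i* sin x.

Definition cintegral d (T : measurableType d)
    (mu : {measure set T -> \bar R}) (f : T -> R[i]) : R[i] :=
  (\int[mu]_x complex.Re (f x)) +i* (\int[mu]_x complex.Im (f x)).

End complex_integral.

Section conditioning.
Context {d : measure_display} {Omega : measurableType d} {R : realType}.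
Variable P : probability Omega R.

(* Z is a version of E[Y | G], for G a sub-sigma-algebra. *)
Definition is_cond_expectation (G : set (set Omega)) (Y Z : Omega -> R) :=
  [/\ forall B : set R, measurable B -> G (Z @^-1` B),
      P.-integrable [set: Omega] (EFin \o Z) &
      forall A, G A ->
        (\int[P]_(w in A) (Z w)%:E = \int[P]_(w in A) (Y w)%:E)%E].

(* An arbitrary version, chosen by epsilon; two versions agree almost surely. *)
Definition cond_expectation (G : set (set Omega)) (Y : Omega -> R) :
    Omega -> R :=
  get (is_cond_expectation G Y).

Definition cond_variance (G : set (set Omega)) (Y : Omega -> R) : Omega -> R :=
  cond_expectation G (fun w => (Y w - cond_expectation G Y w) ^+ 2).

End conditioning.

Section random_fields.
Context {d : measure_display} {Omega : measurableType d} {R : realType}.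
Variable P : probability Omega R.
Context {N : nat}.
Variable X : 'rV[R]_N -> {RV P >-> R}.

(* The library's normal_prob m 0 is a uniform law; the degenerate normal law of
   variance 0 is the Dirac mass at m. *)
Definition gaussian_law (m s : R) : set R -> \bar R :=
  if s == 0 then \d_m else normal_prob m s.

Definition is_gaussian (Y : Omega -> R) :=
  exists m s : R, 0 <= s /\
    forall B : set R, measurable B -> P (Y @^-1` B) = gaussian_law m s B.

Definition gaussian_field :=
  forall (n : nat) (t : 'I_n -> 'rV[R]_N) (a : 'I_n -> R),
    is_gaussian (fun w => \sum_(i < n) a i * X (t i) w).

Definition centered_field := forall t, ('E_P[X t] = 0)%E.

(* For every shift v, the fields (X(t + v) - X(v))_t and (X(t) - X(0))_t have
   the same finite-dimensional distributions. *)
Definition stationary_increments :=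
  forall (v : 'rV[R]_N) (n : nat) (t : 'I_n -> 'rV[R]_N)
         (B : set (n.-tuple R)), measurable B ->
    P [set w | B [tuple X (t i + v) w - X v w | i < n]] =
    P [set w | B [tuple X (t i) w - X 0 w | i < n]].

(* E[X(s)X(t)], which is finite for a Gaussian field. *)
Definition covariance_function (s t : 'rV[R]_N) : R :=
  fine ('E_P[fun w => (X s w * X t w)%R])%E.

Definition continuous_covariance :=
  continuous (fun st : 'rV[R]_N * 'rV[R]_N => covariance_function st.1 st.2).

Local Open Scope complex_scope.

(* F is carried by R^N \ {0}, encoded by giving no mass to the origin. *)
Definition spectral_measure (F : {measure set (borelRV R N) -> \bar R}) :=
  [/\ F [set 0] = 0%E,
      forall A : set (borelRV R N), measurable A ->
        F [set l : 'rV[R]_N | A (- l)] = F A,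
      (\int[F]_l (enorm l ^+ 2 / (1 + enorm l ^+ 2))%R%:E < +oo)%E &
      forall s t : 'rV[R]_N,
        (covariance_function s t)%:C =
        cintegral F (fun l => (expi (edot s l) - 1) * (expi (- edot t l) - 1))].

Definition cond_variance_given (u : 'rV[R]_N) (n : nat)
    (t : 'I_n -> 'rV[R]_N) : Omega -> R :=
  cond_variance P (g_sigma_preimage (fun k : 'I_n => X (t k) : Omega -> R))
    (X u).

End random_fields.

(* Main.v *)
Require Import Defs.
From mathcomp Require Import all_boot all_order all_algebra.
From mathcomp Require Import complex ring lra zify.
From mathcomp Require Import all_classical all_reals all_analysis measurable_realfun.

Set Implicit Arguments.
Unset Strict Implicit.
Unset Printing Implicit Defensive.

Import Order.TTheory GRing.Theory Num.Theory.
Import numFieldNormedType.Exports.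

Local Open Scope classical_set_scope.
Local Open Scope ring_scope.

(** A combination of values of [X0] with coefficient 1 at u, coefficients -a_k at points t_k and
    total coefficient zero has variance equal to the integral of |g|^2 against [F], where g(l) =
    e^{i<u,l>} - sum_k a_k e^{i<t_k,l>}. Both conditions reduce to bounds on such integrals.

    Lower bound ([qform_lower_bound]): if every t_k is at [rho]-distance at least r from u, the
    integral is at least c r^2, whatever the number and the coefficients of the points. By
    continuity of the covariance the points may be taken on a fine grid. Frequency space contains
    disjoint cubes of half-side h centred on a lattice dual to that grid. Replacing |g|^2 by its
    minimum on each cube, and the [F]-mass of the cube by its lower bound of order rho^{-(Q+2)},
    leaves a weighted sum of |g(y_b)|^2 over nodes y_b whose place in the cubes is uncontrolled
    ([spectral_grid_bound]). To bound this sum below, g is multiplied by powers of Dirichlet kernels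
    of [rho]-resolution proportional to r, and by finitely many binomials that vanish at the
    low-frequency lattice points, where nothing is known about [F]. At lattice points, Parseval
    gives the l^2 norm of the coefficients of the product; moving the nodes by at most h costs the
    factor (2 - e^{N h T'})^2 with T' slightly above T ([perturbed_sampling]), and here T h N < log
    2 enters. The kernel is too narrow to bring the t_k near u, so the coefficients near u sum to 1
    and Cauchy-Schwarz bounds the l^2 norm below. Counting frequencies gives r^Q, the kernel decay
    gives r^{Q+2}, and the quotient is r^2 ([grid_lower_bound]).

    Upper bound ([qform_upper_bound]): covering [rho]-shells by cubes gives F(rho > S) <= C S^{-2}
    ([tail_measure_bound]). For an increment tau, 2 (1 - cos <tau,l>) is at most a constant times
    min(1, (rho(tau) rho(l))^{2e}) with 1 < e <= 1/H_j. Dyadic layers turn its integral into a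
    convergent series of tails of total order rho(tau)^2. Bounded frequencies are handled by the
    integrability of |l|^2 / (1 + |l|^2).

    Probability ([cond_variance_given_ae]): the residual W of the linear projection of X(u) on the
    X(t_k) has, jointly with them, a characteristic function that factorises. Bounded limits carry
    this from cosines to the generated sigma-algebra, so the conditional variance is almost surely
    the constant Var W. As X0(0) = 0 almost surely, the origin can be added with the coefficient
    that makes the total zero; this is how t^0 = 0 enters the minimum in (C2). The lower half of
    (C1) is the case of one point t. *)

(** * Squared moduli and the function e^{ix} *)

Section squared_modulus.
Context {R : realType}.
Implicit Types (z w : R[i]) (x y : R).

Definition sqn z : R := complex.Re z ^+ 2 + complex.Im z ^+ 2.

Lemma sqn_ge0 z : 0 <= sqn z.
Proof. by rewrite addr_ge0 ?sqr_ge0. Qed.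

Lemma sqnM z w : sqn (z * w) = sqn z * sqn w.
Proof. by case: z => a b; case: w => c d; rewrite /sqn /=; ring. Qed.

Lemma sqn0 : sqn 0 = 0.
Proof. by rewrite /sqn /=; ring. Qed.

Lemma sqn1 : sqn 1 = 1.
Proof. by rewrite /sqn /=; ring. Qed.

Lemma sqnX z k : sqn (z ^+ k) = sqn z ^+ k.
Proof. by elim: k => [|k IH]; rewrite ?expr0 ?sqn1// !exprS sqnM IH. Qed.

Lemma sqnN z : sqn (- z) = sqn z.
Proof. by case: z => a b; rewrite /sqn /=; ring. Qed.

Lemma sqn_eq0 z : (sqn z == 0) = (z == 0).
Proof.
case: z => a b; rewrite /sqn paddr_eq0 ?sqr_ge0//= !sqrf_eq0.
by rewrite eq_complex.
Qed.

Lemma sqn_real x : sqn x%:C%C = x ^+ 2.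
Proof. by rewrite /sqn /=; ring. Qed.

Lemma sqnE z : (sqn z)%:C%C = z * conjc z.
Proof. by case: z => a b; rewrite /sqn; apply/eqP; rewrite eq_complex /=; apply/andP; split; apply/eqP; ring. Qed.

Lemma Re_sum (I : Type) (r : seq I) (P : pred I) (f : I -> R[i]) :
  complex.Re (\sum_(i <- r | P i) f i) = \sum_(i <- r | P i) complex.Re (f i).
Proof. by apply: (big_morph (@complex.Re R)) => // -[a b] [c d]. Qed.

Lemma Im_sum (I : Type) (r : seq I) (P : pred I) (f : I -> R[i]) :
  complex.Im (\sum_(i <- r | P i) f i) = \sum_(i <- r | P i) complex.Im (f i).
Proof. by apply: (big_morph (@complex.Im R)) => // -[a b] [c d]. Qed.

Lemma sqnD_le z w (t : R) : 0 < t ->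
  sqn (z + w) <= (1 + t) * sqn z + (1 + t^-1) * sqn w.
Proof.
case: z => a b; case: w => c d t0; rewrite /sqn /=.
have h u v : (u + v) ^+ 2 <= (1 + t) * u ^+ 2 + (1 + t^-1) * v ^+ 2.
  rewrite -subr_ge0.
  have -> : (1 + t) * u ^+ 2 + (1 + t^-1) * v ^+ 2 - (u + v) ^+ 2 =
    t^-1 * (t * u - v) ^+ 2 by field; rewrite gt_eqF.
  by rewrite mulr_ge0 ?sqr_ge0// invr_ge0 ltW.
by have := h a c; have := h b d; lra.
Qed.

(** The l^2 triangle inequality in squared form: summing [sqnD_le] with weight t = B / A gives
    exactly (A + B)^2, and A = 0 or B = 0 forces the corresponding family to vanish. *)
Lemma minkowski_sqn (I : finType) (f g : I -> R[i]) (A B : R) :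
  0 <= A -> 0 <= B -> \sum_i sqn (f i) <= A ^+ 2 -> \sum_i sqn (g i) <= B ^+ 2 ->
  \sum_i sqn (f i + g i) <= (A + B) ^+ 2.
Proof.
have aux (u v : I -> R[i]) (D : R) : \sum_i sqn (u i) <= 0 ->
    \sum_i sqn (v i) <= D -> \sum_i sqn (u i + v i) <= D.
  move=> u0; suff ue i : u i = 0 by under [X in _ -> X <= _]eq_bigr do rewrite ue add0r.
  apply/eqP; rewrite -sqn_eq0.
  have /eqP : \sum_i sqn (u i) = 0.
    by apply/le_anti; rewrite u0 sumr_ge0// => ? _; exact: sqn_ge0.
  rewrite psumr_eq0 => [/allP/(_ i (mem_index_enum i))/implyP/(_ isT)//|? _]; exact: sqn_ge0.
move=> A0 B0 fA gB; have [A00|Apos] := eqVneq A 0.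
  by rewrite A00 add0r; apply: aux => //; move: fA; rewrite A00 expr0n.
have [B00|Bpos] := eqVneq B 0.
  under eq_bigr do rewrite addrC.
  by rewrite B00 addr0; apply: aux => //; move: gB; rewrite B00 expr0n.
have {}Apos : 0 < A by rewrite lt_neqAle eq_sym Apos.
have {}Bpos : 0 < B by rewrite lt_neqAle eq_sym Bpos.
have t0 : 0 < B / A by rewrite divr_gt0.
apply: (le_trans (ler_sum _ (fun i _ => sqnD_le (f i) (g i) t0))).
rewrite big_split /= -!mulr_sumr.
apply: le_trans (_ : (1 + B / A) * A ^+ 2 + (1 + (B / A)^-1) * B ^+ 2 <= _).
  by apply: lerD; apply: ler_wpM2l => //; rewrite addr_ge0// ?invr_ge0 ltW.
rewrite le_eqVlt; apply/orP; left; apply/eqP; field.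
by rewrite !gt_eqF.
Qed.

Lemma expiD x y : expi (x + y) = expi x * expi y.
Proof.
by rewrite /expi cosD sinD; apply/eqP; rewrite eq_complex /=; apply/andP; split;
  apply/eqP; ring.
Qed.

Lemma expi0 : expi (0 : R) = 1.
Proof. by rewrite /expi cos0 sin0. Qed.

Lemma expiN x : expi (- x) = conjc (expi x).
Proof. by rewrite /expi cosN sinN. Qed.

Lemma sqn_expi x : sqn (expi x) = 1.
Proof. by rewrite /sqn /= cos2Dsin2. Qed.

Lemma expi_sum (I : Type) (r : seq I) (P : pred I) (f : I -> R) :
  expi (\sum_(i <- r | P i) f i) = \prod_(i <- r | P i) expi (f i).
Proof. by apply: (big_morph _ expiD expi0). Qed.

Lemma expiMn x k : expi (x *+ k) = expi x ^+ k.
Proof. by elim: k => [|k IH]; rewrite ?mulr0n ?expi0// mulrS exprS expiD IH. Qed.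

Lemma sqn_1Bexpi x : sqn (1 - expi x) = 2 * (1 - cos x).
Proof. by have := cos2Dsin2 x; rewrite /sqn /=; nra. Qed.

Lemma expi_taylor_cvg x :
  (complex.Re (\sum_(0 <= k < m) ('i%C * x%:C%C) ^+ k / (k`!%:R)) @[m --> \oo] --> cos x) /\
  (complex.Im (\sum_(0 <= k < m) ('i%C * x%:C%C) ^+ k / (k`!%:R)) @[m --> \oo] --> sin x).
Proof.
have i2 : ('i%C * x%:C%C) ^+ 2 = (- x ^+ 2)%:C%C.
  by apply/eqP; rewrite eq_complex /=; apply/andP; split; apply/eqP; ring.
have key k : ('i%C * x%:C%C) ^+ k / (k`!%:R) =
    (cos_coeff x k +i* sin_coeff x k)%C.
  rewrite cos_coeffE sin_coeffE /=.
  have -> : (k`!%:R : R[i])^-1 = (k`!%:R^-1)%:C%C by rewrite fmorphV rmorph_nat.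
  have pe m : ('i%C * x%:C%C) ^+ m.*2 = ((-1) ^+ m * x ^+ m.*2)%:C%C.
    by rewrite -mul2n [x ^+ _]exprM exprM i2 -exprNn rmorphXn.
  rewrite -(odd_double_half k); case: (odd k); move: (k./2) => m /=.
    rewrite add1n /= odd_double /= doubleK exprS pe [x ^+ m.*2.+1]exprS.
    by apply/eqP; rewrite eq_complex /=; apply/andP; split; apply/eqP; ring.
  rewrite add0n odd_double /= doubleK pe.
  by apply/eqP; rewrite eq_complex /=; apply/andP; split; apply/eqP; ring.
split.
- rewrite cos.unlock.
  have -> : (fun m => complex.Re (\sum_(0 <= k < m) ('i%C * x%:C%C) ^+ k / k`!%:R)) =
     series (cos_coeff x).
    by apply/funext => m; rewrite Re_sum; apply: eq_bigr => k _; rewrite key.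
  exact: is_cvg_series_cos_coeff.
- rewrite sin.unlock.
  have -> : (fun m => complex.Im (\sum_(0 <= k < m) ('i%C * x%:C%C) ^+ k / k`!%:R)) =
     series (sin_coeff x).
    by apply/funext => m; rewrite Im_sum; apply: eq_bigr => k _; rewrite key.
  exact: is_cvg_series_sin_coeff.
Qed.

End squared_modulus.

(** * Stability of a Parseval system of exponentials under displacement of the nodes *)

Section perturbation.
Context {R : realType} {I J : finType} (e : I -> J -> R[i]) (K : R).
Hypothesis K_ge0 : 0 <= K.
Hypothesis parseval : forall c : J -> R[i],
  \sum_n sqn (\sum_b c b * e n b) = K * \sum_b sqn (c b).

(** Parseval makes the matrix [e] equal to sqrt K times an isometry. [symop a] is its entrywise
    (Schur) product with the symbol [a], and [symbd a k] bounds the norm of that product by k sqrt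
    K. *)
Definition symop (a : I -> J -> R[i]) (c : J -> R[i]) (n : I) : R[i] :=
  \sum_b c b * a n b * e n b.

Definition symbd (a : I -> J -> R[i]) (k : R) := forall c : J -> R[i],
  \sum_(n : I) sqn (symop a c n) <= k ^+ 2 * (K * \sum_b sqn (c b)).

Let S_ge0 (c : J -> R[i]) : 0 <= K * \sum_b sqn (c b).
Proof. by rewrite mulr_ge0// sumr_ge0// => b _; exact: sqn_ge0. Qed.

Lemma symbd1 : symbd (fun _ _ => 1) 1.
Proof.
move=> c; rewrite expr1n mul1r -parseval; apply: ler_sum => n _.
by rewrite /symop; under eq_bigr do rewrite mulr1.
Qed.

Lemma symbd0 : symbd (fun _ _ => 0) 0.
Proof.
move=> c; rewrite expr0n mul0r big1// => n _.
by rewrite /symop big1 ?sqn0// => b _; rewrite mulr0 mul0r.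
Qed.

Lemma symbdD a a' k k' : 0 <= k -> 0 <= k' -> symbd a k -> symbd a' k' ->
  symbd (fun n b => a n b + a' n b) (k + k').
Proof.
move=> k0 k'0 ha ha' c; set S := K * _.
have SE : S = Num.sqrt S ^+ 2 by rewrite sqr_sqrtr// S_ge0.
rewrite SE -exprMn mulrDl.
have -> : \sum_(n : I) sqn (symop (fun n b => a n b + a' n b) c n) =
    \sum_(n : I) sqn (symop a c n + symop a' c n).
  apply: eq_bigr => n _; congr sqn; rewrite /symop -big_split /=.
  by apply: eq_bigr => b _; rewrite mulrDr mulrDl.
by apply: minkowski_sqn; rewrite ?mulr_ge0 ?sqrtr_ge0// exprMn -SE; [exact: ha|exact: ha'].
Qed.

Lemma symbd_sum (T : Type) (r : seq T) (a : T -> I -> J -> R[i]) (k : T -> R) :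
  (forall t, 0 <= k t) -> (forall t, symbd (a t) (k t)) ->
  symbd (fun n b => \sum_(t <- r) a t n b) (\sum_(t <- r) k t).
Proof.
move=> k0 ha; elim: r => [|t r IH].
  have -> : (fun n b => \sum_(t <- [::]) a t n b) = (fun _ _ => 0 : R[i]).
    by apply/funext => n; apply/funext => b; rewrite big_nil.
  by rewrite big_nil; exact: symbd0.
have -> : (fun n b => \sum_(t <- t :: r) a t n b) =
    (fun n b => a t n b + \sum_(t <- r) a t n b).
  by apply/funext => n; apply/funext => b; rewrite big_cons.
by rewrite big_cons; apply: symbdD => //; apply: sumr_ge0.
Qed.

(** A separated symbol y_n s_b amounts to diagonal matrices on the two sides, so the norms
    multiply. *)
Lemma symbdM a k (y : I -> R[i]) (s : J -> R[i]) (Y S : R) :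
  0 <= Y -> 0 <= S -> 
  (forall n, sqn (y n) <= Y ^+ 2) -> (forall b, sqn (s b) <= S ^+ 2) ->
  symbd a k -> symbd (fun n b => a n b * (y n * s b)) (Y * S * k).
Proof.
move=> Y0 S0 hy hs ha c.
have E n : sqn (symop (fun n b => a n b * (y n * s b)) c n) =
    sqn (y n) * sqn (symop a (fun b => c b * s b) n).
  rewrite -sqnM; congr sqn; rewrite /symop mulr_sumr; apply: eq_bigr => b _.
  by ring.
under eq_bigr do rewrite E.
apply: le_trans (_ : Y ^+ 2 * \sum_(n : I) sqn (symop a (fun b => c b * s b) n) <= _).
  by rewrite mulr_sumr; apply: ler_sum => n _; rewrite ler_wpM2r ?sqn_ge0.
apply: le_trans (_ : Y ^+ 2 * (k ^+ 2 * (K * \sum_b sqn (c b * s b))) <= _).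
  by rewrite ler_wpM2l ?sqr_ge0//; exact: ha.
have : \sum_b sqn (c b * s b) <= S ^+ 2 * \sum_b sqn (c b).
  rewrite mulr_sumr; apply: ler_sum => b _; rewrite sqnM mulrC.
  by rewrite ler_wpM2r ?sqn_ge0.
move=> hS; rewrite (_ : (Y * S * k) ^+ 2 * _ =
  Y ^+ 2 * (k ^+ 2 * (K * (S ^+ 2 * \sum_b sqn (c b))))); last by ring.
by do 3 (apply: ler_wpM2l; rewrite ?sqr_ge0//).
Qed.

Lemma symbd_limit (a_ : nat -> I -> J -> R[i]) a k :
  (forall n b, complex.Re (a_ m n b) @[m --> \oo] --> complex.Re (a n b)) ->
  (forall n b, complex.Im (a_ m n b) @[m --> \oo] --> complex.Im (a n b)) ->
  (forall m, symbd (a_ m) k) -> symbd a k.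
Proof.
move=> hr hi ha c.
have cr n b : complex.Re (c b * a_ m n b * e n b) @[m --> \oo] -->
    complex.Re (c b * a n b * e n b).
  have E (z : R[i]) : complex.Re (c b * z * e n b) =
     complex.Re (c b * e n b) * complex.Re z - complex.Im (c b * e n b) * complex.Im z.
    by case: (c b) (e n b) z => ? ? [? ?] [? ?] /=; ring.
  rewrite E; under eq_fun do rewrite E.
  by apply: cvgB; apply: cvgM => //; exact: cvg_cst.
have ci n b : complex.Im (c b * a_ m n b * e n b) @[m --> \oo] -->
    complex.Im (c b * a n b * e n b).
  have E (z : R[i]) : complex.Im (c b * z * e n b) =
     complex.Re (c b * e n b) * complex.Im z + complex.Im (c b * e n b) * complex.Re z.
    by case: (c b) (e n b) z => ? ? [? ?] [? ?] /=; ring.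
  rewrite E; under eq_fun do rewrite E.
  by apply: cvgD; apply: cvgM => //; exact: cvg_cst.
have cs : \sum_(n : I) sqn (symop (a_ m) c n) @[m --> \oo] --> \sum_(n : I) sqn (symop a c n).
  apply: cvg_big; first exact: add_continuous.
  move=> n _; rewrite /sqn /symop !Re_sum !Im_sum.
  under eq_fun do rewrite Re_sum Im_sum !expr2.
  rewrite !expr2.
  have h1 : \sum_b complex.Re (c b * a_ m n b * e n b) @[m --> \oo] -->
     \sum_b complex.Re (c b * a n b * e n b).
    by apply: cvg_big; [exact: add_continuous|move=> b _; exact: cr].
  have h2 : \sum_b complex.Im (c b * a_ m n b * e n b) @[m --> \oo] -->
     \sum_b complex.Im (c b * a n b * e n b).
    by apply: cvg_big; [exact: add_continuous|move=> b _; exact: ci].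
  by apply: cvgD; apply: cvgM.
rewrite -(cvg_lim _ cs)//; apply: limr_le; first by apply/cvg_ex; eexists; exact: cs.
by apply: nearW => m; exact: ha.
Qed.

Lemma symbd_le a k k' : 0 <= k -> k <= k' -> symbd a k -> symbd a k'.
Proof.
move=> k0 kk' ha c; apply: (le_trans (ha c)).
by rewrite ler_wpM2r// lerXn2r ?nnegrE// (le_trans k0).
Qed.

Section exponential.
Variables (N : nat) (x : I -> 'I_N -> R) (s : J -> 'I_N -> R) (h T : R).
Hypothesis h_ge0 : 0 <= h.
Hypothesis T_ge0 : 0 <= T.
Hypothesis xh : forall n j, `|x n j| <= h.
Hypothesis sT : forall b j, `|s b j| <= T.

Let v n b : R := \sum_j x n j * s b j.
Let kap : R := N%:R * h * T.

Let kap_ge0 : 0 <= kap. Proof. by rewrite !mulr_ge0. Qed.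

(** Since v = sum_j x_j s_j, going from order k to k + 1 multiplies the symbol by a sum of N
    separated symbols of size h T / (k + 1). This produces (N h T)^k / k!. *)
Let symbd_taylor_term k :
  symbd (fun n b => ('i%C * (v n b)%:C%C) ^+ k / k`!%:R) (exp_coeff kap k).
Proof.
elim: k => [|k IH].
  have -> : (fun n b => ('i%C * (v n b)%:C%C) ^+ 0 / 0`!%:R) = (fun _ _ => 1).
    by apply/funext => n; apply/funext => b; rewrite expr0 fact0 divr1.
  by rewrite exp_coeffE /= expr0 fact0 invr1 mulr1; exact: symbd1.
have -> : (fun n b => ('i%C * (v n b)%:C%C) ^+ k.+1 / k.+1`!%:R) =
   (fun n b => \sum_(j < N) (('i%C * (v n b)%:C%C) ^+ k / k`!%:R) *
      (('i%C * (x n j / k.+1%:R)%:C%C) * (s b j)%:C%C)).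
  apply/funext => n; apply/funext => b; rewrite -mulr_sumr.
  rewrite (_ : \sum_i _ = 'i%C * (v n b)%:C%C / k.+1%:R).
    by rewrite exprSr factS natrM invfM; ring.
  rewrite /v raddf_sum mulr_sumr mulr_suml; apply: eq_bigr => j _.
  by rewrite !rmorphM fmorphV rmorph_nat; ring.
rewrite (_ : exp_coeff kap k.+1 = \sum_(j < N) h / k.+1%:R * T * exp_coeff kap k); last first.
  rewrite -mulr_suml sumr_const card_ord exp_coeffE /= exprS factS natrM invfM.
  by rewrite -[_ *+ N]mulr_natl /kap; ring.
apply: symbd_sum => j; first by apply: mulr_ge0; [rewrite !mulr_ge0 ?invr_ge0//|exact: exp_coeff_ge0].
apply: symbdM => // [|n|b].
- by rewrite mulr_ge0 ?invr_ge0.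
- rewrite sqnM sqn_real (_ : sqn 'i%C = 1); last by rewrite /sqn /=; ring.
  by rewrite mul1r -real_normK ?num_real// lerXn2r ?nnegrE ?mulr_ge0 ?invr_ge0//
     normrM [`|_^-1|]ger0_norm ?invr_ge0// ler_wpM2r ?invr_ge0.
- by rewrite sqn_real -real_normK ?num_real// lerXn2r ?nnegrE.
Qed.

(** The Taylor terms of order at least 1 are summed; every partial sum has norm at most e^kap - 1,
    and the bound survives the limit. *)
Lemma symbd_expi : symbd (fun n b => expi (v n b) - 1) (expR kap - 1).
Proof.
pose a_ m n b : R[i] := \sum_(1 <= k < m.+1) ('i%C * (v n b)%:C%C) ^+ k / k`!%:R.
have aE m n b : a_ m n b =
    \sum_(0 <= k < m.+1) ('i%C * (v n b)%:C%C) ^+ k / k`!%:R - 1.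
  by rewrite big_nat_recl// expr0 fact0 divr1 addrC addKr /a_ big_add1.
apply: (@symbd_limit a_) => [n b|n b|m].
- rewrite (_ : complex.Re (expi (v n b) - 1) = cos (v n b) - 1)//.
  rewrite (_ : (fun m => _) = (fun m => complex.Re
     (\sum_(0 <= k < m.+1) ('i%C * (v n b)%:C%C) ^+ k / k`!%:R) - 1)); last first.
    by apply/funext => m; rewrite aE; case: (\sum_(_ <= _ < _) _).
  apply: cvgB; last exact: cvg_cst.
  have := (expi_taylor_cvg (v n b)).1; rewrite -cvg_shiftS; exact.
- rewrite (_ : complex.Im (expi (v n b) - 1) = sin (v n b)); last first.
    by rewrite /= oppr0 addr0.
  rewrite (_ : (fun m => _) = (fun m => complex.Im
     (\sum_(0 <= k < m.+1) ('i%C * (v n b)%:C%C) ^+ k / k`!%:R))); last first.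
    by apply/funext => m; rewrite aE; case: (\sum_(_ <= _ < _) _) => ? ? /=;
      rewrite oppr0 addr0.
  have := (expi_taylor_cvg (v n b)).2; rewrite -cvg_shiftS; exact.
- apply: (@symbd_le _ (\sum_(1 <= k < m.+1) exp_coeff kap k)).
  + by rewrite sumr_ge0// => k _; exact: exp_coeff_ge0.
  + rewrite lerBrDl -[X in X + _](_ : exp_coeff kap 0 = 1); last first.
      by rewrite exp_coeffE /= expr0 fact0 invr1 mulr1.
    rewrite big_add1 -(@big_nat_recl _ _ _ m 0 (exp_coeff kap))//.
    have := nondecreasing_cvgn_le _ (is_cvg_series_exp_coeff kap) m.+1.
    by apply; apply: nondecreasing_series => k _ _; exact: exp_coeff_ge0.
  + by apply: symbd_sum => k; [exact: exp_coeff_ge0|exact: symbd_taylor_term].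
Qed.

(** The Duffin-Eachus argument: displaced and undisplaced samples differ by an operator of relative
    norm e^kap - 1, at most 1 when kap <= log 2, so the triangle inequality leaves the factor 2 -
    e^kap. *)
Lemma perturbed_sampling (c : J -> R[i]) : expR kap <= 2 ->
  (2 - expR kap) ^+ 2 * \sum_(n : I) sqn (\sum_b c b * e n b) <=
  \sum_(n : I) sqn (\sum_b c b * (expi (v n b) * e n b)).
Proof.
move=> k2; set S := \sum_n _; set S' := \sum_(n : I) sqn (\sum_b c b * (_ * _)).
have S0 : 0 <= S by apply: sumr_ge0 => n _; exact: sqn_ge0.
have S'0 : 0 <= S' by apply: sumr_ge0 => n _; exact: sqn_ge0.
have SE : S = Num.sqrt S ^+ 2 by rewrite sqr_sqrtr.
have S'E : S' = Num.sqrt S' ^+ 2 by rewrite sqr_sqrtr.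
have k1 : 0 <= expR kap - 1 by rewrite subr_ge0 -expR0 ler_expR.
have le : S <= (Num.sqrt S' + (expR kap - 1) * Num.sqrt S) ^+ 2.
  rewrite {1}/S (_ : \sum_n _ = \sum_(n : I) sqn
    (\sum_b c b * (expi (v n b) * e n b) +
     - symop (fun n b => expi (v n b) - 1) c n)); last first.
    apply: eq_bigr => n _; congr sqn; rewrite /symop -sumrB.
    by apply: eq_bigr => b _; ring.
  apply: minkowski_sqn; rewrite ?mulr_ge0 ?sqrtr_ge0//.
    by rewrite -S'E.
  under eq_bigr do rewrite sqnN.
  by rewrite exprMn -SE /S parseval; exact: symbd_expi.
have : Num.sqrt S <= Num.sqrt S' + (expR kap - 1) * Num.sqrt S.
  move: le; rewrite {1}SE ler_sqr ?nnegrE ?sqrtr_ge0//.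
  by rewrite addr_ge0 ?mulr_ge0 ?sqrtr_ge0.
move=> le2; rewrite SE S'E -exprMn ler_sqr ?nnegrE ?mulr_ge0 ?sqrtr_ge0 ?subr_ge0//.
by lra.
Qed.

End exponential.
End perturbation.

(** * Exponential polynomials with integer frequencies; Parseval on a box *)

Section finite_parseval.
Context {R : realType}.

Lemma expi_neq1 (x : R) : 0 < `|x| -> `|x| < pi *+ 2 -> expi x != 1.
Proof.
move=> x0 x2; apply/eqP => /(congr1 (@complex.Re R)) /= cx.
have : 0 < sin (`|x| / 2) by apply: sin_gt0_pi; lra.
have : cos `|x| = 1 by case: (ger0P x) => _; rewrite ?cosN.
rewrite {1}(_ : `|x| = (`|x| / 2) *+ 2); last by rewrite -mulr_natr divfK.
by rewrite cos_mulr2n; have := cos2Dsin2 (`|x| / 2); nra.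
Qed.

Lemma expi_2pi : expi (pi *+ 2 : R) = 1.
Proof. by rewrite /expi cos2pi sin2pi. Qed.

Lemma sum_expi_orthogonal (L M b b' : nat) : (b < L)%N -> (b' < L)%N ->
  \sum_(n < L) expi (pi *+ 2 / L%:R * (b%:R - b'%:R) * (n%:R - M%:R) : R) =
  (L * (b == b'))%:R.
Proof.
move=> bL b'L; have [->|bb'] := eqVneq b b'.
  under eq_bigr do rewrite subrr mulr0 mul0r expi0.
  by rewrite sumr_const card_ord muln1.
have L0 : (0 < L)%N by rewrite (leq_trans _ bL).
set w : R := pi *+ 2 / L%:R * (b%:R - b'%:R).
rewrite muln0.
have e1 k : expi (pi *+ 2 * k%:R : R) = 1 by rewrite mulr_natr expiMn expi_2pi expr1n.
have zL : expi w ^+ L = 1.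
  rewrite -expiMn -mulr_natr /w mulrAC divfK ?pnatr_eq0 ?gtn_eqF// mulrBr.
  by rewrite expiD expiN !e1 -[conjc 1]/(conjc (1 : R[i])) conjc1 mulr1.
have p2 : 0 < (pi *+ 2 : R) by apply: mulrn_wgt0 => //; exact: pi_gt0.
have z1 : expi w != 1.
  apply: expi_neq1.
    rewrite normr_gt0 !mulf_neq0 ?invr_eq0 ?pnatr_eq0 ?gtn_eqF// ?subr_eq0 ?eqr_nat//.
    by rewrite gt_eqF.
  rewrite normrM [`|_ / _|]ger0_norm; last by rewrite divr_ge0// ltW.
  rewrite mulrAC ltr_pdivrMr ?ltr0n// ltr_pM2l//.
  rewrite ltr_norml; have := ltr_nat R b L; have := ltr_nat R b' L.
  rewrite bL b'L; have := ler0n R b; have := ler0n R b'; lra.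
under eq_bigr do rewrite mulrBr expiD mulr_natr expiMn.
rewrite -mulr_suml.
have /eqP := subrX1 (expi w) L; rewrite zL subrr eq_sym mulf_eq0 subr_eq0 (negbTE z1) /=.
by move=> /eqP ->; rewrite mul0r.
Qed.

End finite_parseval.

Section exponential_polynomials.
Context {R : realType} {N : nat}.
Implicit Types (k u v : 'rV[int]_N) (l : 'rV[R]_N) (f g : seq (R[i] * 'rV[int]_N)).

Definition ipair k l : R := \sum_(j < N) (k 0 j)%:~R * l 0 j.

Lemma ipairD k k' l : ipair (k + k') l = ipair k l + ipair k' l.
Proof.
by rewrite /ipair -big_split /=; apply: eq_bigr => j _; rewrite mxE rmorphD mulrDl.
Qed.

Lemma ipair0l l : ipair 0 l = 0.
Proof. by rewrite /ipair big1// => j _; rewrite mxE mul0r. Qed.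

Lemma ipairDr k l l' : ipair k (l + l') = ipair k l + ipair k l'.
Proof.
by rewrite /ipair -big_split /=; apply: eq_bigr => j _; rewrite mxE mulrDr.
Qed.

Lemma ipair_delta j (i : int) l : ipair (i *: delta_mx 0 j) l = i%:~R * l 0 j.
Proof.
rewrite /ipair (bigD1 j)//= !mxE !eqxx mulr1 big1 ?addr0// => m /negbTE mj.
by rewrite !mxE mj andbF mulr0 mul0r.
Qed.

(** An exponential polynomial is a list of pairs (coefficient, frequency), repetitions allowed: a
    product is then the plain list of pairwise products, and [coef] merges equal frequencies only
    when l^2 norms are taken. *)
Definition ft (theta : R) f l : R[i] :=
  \sum_(x <- f) x.1 * expi (theta * ipair x.2 l).

Definition coef f k : R[i] := \sum_(x <- f | x.2 == k) x.1.

Definition mass f : R[i] := \sum_(x <- f) x.1.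

Definition emul f g := [seq (x.1 * y.1, x.2 + y.2) | x <- f, y <- g].

Definition eone : seq (R[i] * 'rV[int]_N) := [:: (1, 0)].

Lemma ft_emul theta f g l : ft theta (emul f g) l = ft theta f l * ft theta g l.
Proof.
rewrite /ft /emul big_allpairs_dep mulr_suml; apply: eq_bigr => x _.
rewrite mulr_sumr; apply: eq_bigr => y _ /=.
by rewrite ipairD mulrDr expiD; ring.
Qed.

Lemma mass_emul f g : mass (emul f g) = mass f * mass g.
Proof.
rewrite /mass /emul big_allpairs_dep mulr_suml; apply: eq_bigr => x _.
by rewrite mulr_sumr.
Qed.

Lemma ft_eone theta l : ft theta eone l = 1.
Proof. by rewrite /ft big_seq1 ipair0l mulr0 expi0 mulr1. Qed.

Definition efactor (z : R[i]) v : seq (R[i] * 'rV[int]_N) := [:: (1, 0); (- z, v)].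

Lemma ft_efactor theta z v l :
  ft theta (efactor z v) l = 1 - z * expi (theta * ipair v l).
Proof. by rewrite /ft big_cons big_seq1 /= ipair0l mulr0 expi0 mulr1 mulNr. Qed.

Lemma coef_efactor z v f k :
  coef (emul (efactor z v) f) k = coef f k - z * coef f (k - v).
Proof.
rewrite /coef /emul /efactor /= cats0 big_cat /= !big_map /=.
congr (_ + _).
  by apply: eq_big => [x|x _]; rewrite ?add0r ?mul1r.
rewrite mulr_sumr -sumrN; apply: eq_big => [x|x _]; last by rewrite mulNr.
by rewrite -subr_eq0 -[RHS]subr_eq0 opprB addrA [v + _]addrC.
Qed.

Lemma sqn_sum_le (I : Type) (r : seq I) (f : I -> R[i]) :
  sqn (\sum_(i <- r) f i) <= (size r)%:R * \sum_(i <- r) sqn (f i).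
Proof.
elim: r => [|i r IH]; first by rewrite !big_nil sqn0 mul0r.
case: r IH => [|i' r] IH; first by rewrite !big_seq1 mul1r.
rewrite big_cons [X in _ * X]big_cons.
set m := size (i' :: r) in IH *.
have m0 : 0 < m%:R :> R by rewrite ltr0n.
apply: (le_trans (sqnD_le _ _ m0)).
rewrite -[X in _ <= X * _]/(m.+1%:R) -[m.+1%:R]natr1 [m%:R + 1]addrC.
rewrite [leRHS]mulrDr lerD//; apply: le_trans (ler_wpM2l _ IH) _.
  by rewrite addr_ge0// invr_ge0 ltW.
by rewrite mulrA mulrDl mulVf ?gt_eqF// mul1r addrC.
Qed.

Section box.
Variable M : nat.
Let L := M.*2.+1.
Notation B := {ffun 'I_N -> 'I_L}.

Definition ctr (b : B) : 'rV[int]_N := \row_j ((b j : nat)%:Z - M%:Z).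

Definition inbox k := [forall j, `|k 0 j| <= M%:Z].

Definition boxidx k : B := [ffun j => inord (absz (k 0 j + M%:Z))].

Lemma ctr_inj : injective ctr.
Proof.
move=> b b' bb'; apply/ffunP => j; apply/ord_inj.
by have := congr1 (fun k : 'rV_N => k 0 j) bb'; rewrite !mxE => /addIr [].
Qed.

Lemma ctr_inbox b : inbox (ctr b).
Proof. by apply/forallP => j; rewrite mxE; have := ltn_ord (b j); rewrite /L; lia. Qed.

Lemma boxidxK k : inbox k -> ctr (boxidx k) = k.
Proof.
move=> /forallP kM; apply/rowP => j; rewrite !mxE ffunE.
by have := kM j; move: (k 0 j) => z zM; rewrite ?inordK /L -?addnn; lia.
Qed.

Lemma coef_notinbox f k : all (inbox \o snd) f -> ~~ inbox k -> coef f k = 0.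
Proof.
move=> /allP fM kM; rewrite /coef big_seq_cond big1// => x /andP[xf /eqP xk].
by move: (fM _ xf); rewrite /= xk (negbTE kM).
Qed.

Lemma ctr_sum (F : 'rV[int]_N -> R[i]) f (Q : pred 'rV[int]_N) :
  all (inbox \o snd) f ->
  \sum_(b : B | Q (ctr b)) coef f (ctr b) * F (ctr b) =
  \sum_(x <- f | Q x.2) x.1 * F x.2.
Proof.
move=> /allP fM; under eq_bigr do rewrite /coef mulr_suml.
rewrite (exchange_big_dep (fun x => Q x.2)) /=; last first.
  by move=> b x Qb /eqP ->.
rewrite big_seq_cond [RHS]big_seq_cond; apply: eq_bigr => x /andP[xf Qx].
rewrite (big_pred1 (boxidx x.2)); first by rewrite boxidxK//; exact: fM.
move=> b; apply/andP/eqP => [[_ /eqP->]|->].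
  by apply: ctr_inj; rewrite boxidxK// ctr_inbox.
by rewrite boxidxK ?Qx//; exact: fM.
Qed.

Lemma ft_coef theta f l : all (inbox \o snd) f ->
  ft theta f l = \sum_(b : B) coef f (ctr b) * expi (theta * ipair (ctr b) l).
Proof. by move=> fM; rewrite (ctr_sum (fun k => expi (theta * ipair k l)) predT fM). Qed.

(** Coefficients vanish off the box, so only the part of the box that is shifted into the box
    counts, and the shift is injective there. *)
Lemma coef_shift_le f v : all (inbox \o snd) f ->
  \sum_(b : B) sqn (coef f (ctr b - v)) <= \sum_(b : B) sqn (coef f (ctr b)).
Proof.
move=> fM; pose A := [set b : B | inbox (ctr b - v)]%SET.
rewrite (bigID [in A]) /= [X in _ + X]big1 ?addr0; last first.
  by move=> b; rewrite inE => nb; rewrite (coef_notinbox fM nb) sqn0.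
pose phi b := boxidx (ctr b - v).
rewrite (eq_bigr (fun b => sqn (coef f (ctr (phi b))))); last first.
  by move=> b; rewrite inE => bv; rewrite boxidxK.
have phi_inj : {in A &, injective phi}.
  move=> b b'; rewrite !inE => hb hb' /(congr1 ctr).
  by rewrite /phi !boxidxK// => /addIr /ctr_inj.
rewrite -(big_imset (fun b => sqn (coef f (ctr b))) phi_inj) /=.
rewrite [leRHS](bigID [in phi @: A]) /= lerDl sumr_ge0// => b _.
exact: sqn_ge0.
Qed.

(* Inverting a difference operator: on the box, the shift of [f] by
   [v *+ J.+1] vanishes, so the geometric series stops. *)
Lemma efactor_lower_bound f z v J :
  all (inbox \o snd) f -> all (inbox \o snd) (emul (efactor z v) f) ->
  sqn z = 1 -> (forall b : B, ~~ inbox (ctr b - v *+ J.+1)) ->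
  \sum_(b : B) sqn (coef f (ctr b)) <=
  J.+1%:R ^+ 2 * \sum_(b : B) sqn (coef (emul (efactor z v) f) (ctr b)).
Proof.
move=> fM gM z1 hJ; set g := emul _ _.
have telescope k m : coef f k = \sum_(0 <= j < m) z ^+ j * coef g (k - v *+ j) +
    z ^+ m * coef f (k - v *+ m).
  elim: m => [|m IH]; first by rewrite big_geq// add0r expr0 mul1r mulr0n subr0.
  rewrite big_nat_recr//= IH -addrA; congr (_ + _).
  rewrite /g coef_efactor mulrS opprD [- v - _]addrC addrA exprSr; ring.
have fE (b : B) : coef f (ctr b) = \sum_(0 <= j < J.+1) z ^+ j * coef g (ctr b - v *+ j).
  by rewrite {1}(telescope (ctr b) J.+1) (coef_notinbox fM (hJ b)) mulr0 addr0.
(* Cauchy-Schwarz on the J + 1 terms, and then [coef_shift_le] for each shift, give the factor (J +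
   1)^2. *)
apply: le_trans (_ : \sum_(b : B) J.+1%:R *
    \sum_(0 <= j < J.+1) sqn (coef g (ctr b - v *+ j)) <= _).
  apply: ler_sum => b _; rewrite fE; apply: (le_trans (sqn_sum_le _ _)).
  rewrite size_iota subn0 ler_wpM2l// ler_sum// => j _.
  by rewrite sqnM sqnX z1 expr1n mul1r.
rewrite -mulr_sumr expr2 -mulrA ler_wpM2l// exchange_big /=.
rewrite mulr_natl -[X in _ *+ X](subn0 J.+1) -sumr_const_nat.
by apply: ler_sum => j _; exact: coef_shift_le.
Qed.

(** The relation theta eta = 2 pi / L makes sampling on the lattice of step eta a discrete Fourier
    transform over (Z/L)^N, and orthogonality factorises over the coordinates. *)
Lemma box_parseval (theta eta : R) (c : B -> R[i]) : theta * eta = pi *+ 2 / L%:R ->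
  \sum_(n : B) sqn (\sum_(b : B) c b *
     expi (theta * ipair (ctr b) (\row_j (eta * (ctr n 0 j)%:~R)))) =
  L%:R ^+ N * \sum_(b : B) sqn (c b).
Proof.
move=> te; set e := fun n b : B => expi (theta * ipair (ctr b) (\row_j (eta * (ctr n 0 j)%:~R))).
have orth (b b' : B) : \sum_(n : B) e n b * conjc (e n b') =
    if b == b' then L%:R ^+ N else 0.
  have E n : e n b * conjc (e n b') = \prod_(j < N)
      expi (pi *+ 2 / L%:R * ((b j)%:R - (b' j)%:R) * ((n j)%:R - M%:R) : R).
    rewrite /e -expiN -expiD -expi_sum; congr expi.
    rewrite /ipair !mulr_sumr -sumrN -big_split /=; apply: eq_bigr => j _.
    rewrite !mxE -te !rmorphB /=; ring.
  under eq_bigr do rewrite E.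
  rewrite -(bigA_distr_bigA (fun j (m : 'I_L) => expi (pi *+ 2 / L%:R *
     ((b j)%:R - (b' j)%:R) * (m%:R - M%:R) : R))) /=.
  rewrite (eq_bigr (fun j : 'I_N => (L * (b j == b' j))%:R)); last first.
    by move=> j _; rewrite (sum_expi_orthogonal M (ltn_ord (b j)) (ltn_ord (b' j))).
  have [->|bb'] := eqVneq b b'.
    by under eq_bigr do rewrite eqxx muln1; rewrite prodr_const card_ord.
  have [j bj] : exists j, b j != b' j.
    apply/existsP; apply: contraR bb'; rewrite negb_exists => /forallP h.
    by apply/eqP/ffunP => j; have := h j; rewrite negbK => /eqP.
  by rewrite (bigD1 j)//= (negbTE bj) muln0 mul0r.
suff /(congr1 (@complex.Re R)) : (\sum_(n : B) sqn (\sum_(b : B) c b * e n b))%:C%C =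
  (L%:R ^+ N * \sum_(b : B) sqn (c b))%:C%C by [].
rewrite rmorphM rmorphXn rmorph_nat !rmorph_sum /=.
under eq_bigr do rewrite sqnE rmorph_sum mulr_suml /=.
under eq_bigr do under eq_bigr do rewrite mulr_sumr.
rewrite exchange_big /= mulr_sumr; apply: eq_bigr => b _.
rewrite exchange_big /= (bigD1 b)//= [X in _ + X]big1 ?addr0.
  under eq_bigr do rewrite rmorphM mulrACA.
  by rewrite -mulr_sumr orth eqxx sqnE mulrC.
move=> b' bb'; under eq_bigr do rewrite rmorphM mulrACA.
by rewrite -mulr_sumr orth eq_sym (negbTE bb') mulr0.
Qed.

End box.
End exponential_polynomials.

(** * The test polynomial and the discrete lower bound *)

Section test_polynomials.
Context {R : realType} {N : nat}.
Implicit Types (u v : 'rV[int]_N) (l : 'rV[R]_N) (f g : seq (R[i] * 'rV[int]_N)).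


(** The Dirichlet kernel, normalised to 1 at the origin and with nonnegative frequencies only, so
    that supports are measured by natural numbers. *)
Definition dirker (q : nat) (x : R) : R[i] :=
  \sum_(0 <= i < q) q%:R^-1 * expi (x *+ i).

Definition edir (j : 'I_N) (q : nat) : seq (R[i] * 'rV[int]_N) :=
  [seq (q%:R^-1, i%:Z *: delta_mx 0 j) | i <- iota 0 q].

Definition epow f p := iter p (emul f) eone.

Definition ekernel (q : 'I_N -> nat) p := foldr (fun j => emul (epow (edir j (q j)) p)) eone (enum 'I_N).

Definition efactors (zs : seq R[i]) v f := foldr (fun z => emul (efactor z v)) f zs.

Definition esampled (n : nat) u (t : 'I_n -> 'rV[int]_N) (a : 'I_n -> R) :=
  (1, u) :: [seq (- (a k)%:C%C, t k) | k <- enum 'I_n].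

Lemma ft_edir theta j q l : ft theta (edir j q) l = dirker q (theta * l 0 j).
Proof.
rewrite /ft /edir big_map /dirker /index_iota subn0; apply: eq_bigr => i _ /=.
by rewrite ipair_delta -[_ *+ i]mulr_natr -[i%:Z%:~R]/(i%:R); congr (_ * expi _); ring.
Qed.

Lemma ft_epow theta f p l : ft theta (epow f p) l = ft theta f l ^+ p.
Proof. by elim: p => [|p IH]; rewrite ?ft_eone//= ft_emul IH exprS. Qed.

Lemma ft_ekernel theta q p l :
  ft theta (ekernel q p) l = \prod_j dirker (q j) (theta * l 0 j) ^+ p.
Proof.
rewrite -[in RHS]big_enum /= /ekernel; elim: (enum 'I_N) => [|j s IH] /=.
  by rewrite ft_eone big_nil.
by rewrite ft_emul IH big_cons ft_epow ft_edir.
Qed.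

Lemma ft_efactors theta zs v f l :
  ft theta (efactors zs v f) l =
  \prod_(z <- zs) (1 - z * expi (theta * ipair v l)) * ft theta f l.
Proof.
elim: zs => [|z zs IH] /=; first by rewrite big_nil mul1r.
by rewrite ft_emul IH big_cons ft_efactor mulrA.
Qed.

Lemma ft_esampled theta n u (t : 'I_n -> 'rV[int]_N) (a : 'I_n -> R) l :
  ft theta (esampled u t a) l =
  expi (theta * ipair u l) - \sum_k (a k)%:C%C * expi (theta * ipair (t k) l).
Proof.
rewrite /ft big_cons mul1r /= big_map big_enum /= -sumrN.
by congr (_ + _); apply: eq_bigr => k _; rewrite mulNr.
Qed.

Lemma mass_ekernel q p : (forall j, 0 < q j)%N -> mass (ekernel q p) = 1.
Proof.
move=> q0; rewrite /ekernel; elim: (enum 'I_N) => [|j s IH] /=.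
  by rewrite /mass big_seq1.
rewrite mass_emul IH mulr1 {IH}; elim: p => [|p IH] /=; first by rewrite /mass big_seq1.
rewrite mass_emul IH mulr1 /mass /edir big_map big_const_seq count_predT size_iota.
by rewrite iter_addr addr0 -[_ *+ _]mulr_natr mulVf// pnatr_eq0 gtn_eqF.
Qed.

Definition esupp (w : 'I_N -> nat) f :=
  forall x, x \in f -> forall j, 0 <= x.2 0 j <= (w j)%:Z.

Lemma esupp_emul w w' f g : esupp w f -> esupp w' g ->
  esupp (fun j => w j + w' j)%N (emul f g).
Proof.
move=> hf hg _ /allpairsP[[x y] /= [xf yg ->]] j /=; rewrite mxE.
have := hf _ xf j; have := hg _ yg j.
by move: (x.2 0 j) (y.2 0 j) (w j) (w' j) => *; lia.
Qed.

Lemma esupp_ekernel q p : esupp (fun j => p * q j)%N (ekernel q p).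
Proof.
have dir j : esupp (fun j' => if j' == j then q j else 0%N) (edir j (q j)).
  move=> _ /mapP[i + ->] j' /=; rewrite mem_iota => /andP[_ iq]; rewrite !mxE.
  by case: eqVneq => _ /=; rewrite ?mulr1 ?mulr0; lia.
have pow j : esupp (fun j' => p * if j' == j then q j else 0)%N (epow (edir j (q j)) p).
  elim: p => [|m IH] /=; first by move=> x; rewrite inE => /eqP-> j'; rewrite mxE.
  by under eq_fun do rewrite mulSn; exact: esupp_emul.
have : esupp (fun j' => \sum_(j <- enum 'I_N) p * if j' == j then q j else 0)%N (ekernel q p).
  rewrite /ekernel; elim: (enum 'I_N) => [|j s IH] /=.
    by move=> x; rewrite inE => /eqP-> j'; rewrite mxE big_nil.
  by under eq_fun do rewrite big_cons; exact: esupp_emul.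
congr esupp; apply/funext => j'; rewrite big_enum /= -big_distrr /=; congr (_ * _)%N.
by rewrite -big_mkcond /= (big_pred1 j')// => j; rewrite eq_sym.
Qed.

Section lower_bound.
Variables (M n p : nat) (q : 'I_N -> nat) (u : 'rV[int]_N).
Variables (t : 'I_n -> 'rV[int]_N) (a : 'I_n -> R) (j0 : 'I_N) (kap J : nat) (zs : seq R[i]).
Let L := M.*2.+1.
Notation B := {ffun 'I_N -> 'I_L}.
Hypothesis p_gt0 : (0 < p)%N.
Hypothesis q_gt0 : forall j, (0 < q j)%N.
(** [uM] and [tM] leave room in the box for the kernel and all the factors; [sep] makes the kernel
    boxes attached to u and to t_k disjoint; [kapJ] ensures that J + 1 shifts by [kap] leave the
    box. *)
Hypothesis uM : forall j, `|u 0 j| + (p * q j + size zs * kap)%:Z <= M%:Z.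
Hypothesis tM : forall k j, `|t k 0 j| + (p * q j + size zs * kap)%:Z <= M%:Z.
Hypothesis sep : forall k, exists j, (p * q j)%:Z < `|t k 0 j - u 0 j|.
Hypothesis zs1 : forall z, z \in zs -> sqn z = 1.
Hypothesis kapJ : (L <= kap * J.+1)%N.

Let v : 'rV[int]_N := kap%:Z *: delta_mx 0 j0.
Let f0 := emul (esampled u t a) (ekernel q p).
Let G := efactors zs v f0.

Let f0_supp x : x \in f0 -> forall j, `|x.2 0 j| + (size zs * kap)%:Z <= M%:Z.
Proof.
move=> /allpairsP[[y z] /= [yf zg ->]] j /=; rewrite mxE.
have zs0 := esupp_ekernel zg j.
suff : `|y.2 0 j| + (p * q j + size zs * kap)%:Z <= M%:Z.
  have key (a1 a2 : int) (a3 a4 m : nat) : 0 <= a2 <= a3%:Z ->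
    `|a1| + (a3 + a4)%:Z <= m%:Z -> `|a1 + a2| + a4%:Z <= m%:Z by lia.
  exact: key zs0.
move: yf; rewrite inE => /predU1P[->|/mapP[k _ ->]] //=; exact: uM.
Qed.

Let efactors_inbox zs' : (size zs' <= size zs)%N ->
  all (inbox M \o snd) (efactors zs' v f0).
Proof.
move=> szs; apply/allP => x xf /=; apply/forallP => j.
(* Strengthened for the induction: a margin is kept for the factors still to come, each of which
   uses up [kap]. *)
suff : `|x.2 0 j| + ((size zs - size zs') * kap)%:Z <= M%:Z.
  by apply: le_trans; rewrite lerDl.
elim: zs' szs x xf => [_ x /f0_supp/(_ j)|z zs' IH szs x] /=; first by rewrite subn0.
move=> /allpairsP[[y w] /= [yf wg ->]] /=; rewrite mxE.
have {}IH := IH (ltnW szs) _ wg.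
have yk : 0 <= y.2 0 j <= kap%:Z.
  move: yf; rewrite !inE => /orP[|] /eqP -> /=; rewrite !mxE//.
  by case: (j == j0) => /=; rewrite ?mulr1 ?mulr0; lia.
have : ((size zs - size zs') * kap = (size zs - (size zs').+1) * kap + kap)%N.
  by rewrite -mulSnr subnSK.
have key (a1 a2 : int) (a3 a4 a5 m : nat) : `|a2| + a3%:Z <= m%:Z ->
    0 <= a1 <= a4%:Z -> (a3 = a5 + a4)%N -> `|a1 + a2| + a5%:Z <= m%:Z by lia.
exact: key IH yk.
Qed.

Lemma efactors_lower_bound :
  \sum_(b : B) sqn (coef f0 (ctr b)) <=
  (J.+1%:R ^+ 2) ^+ size zs * \sum_(b : B) sqn (coef G (ctr b)).
Proof.
suff H zs' : {subset zs' <= zs} -> (size zs' <= size zs)%N ->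
    \sum_(b : B) sqn (coef f0 (ctr b)) <= (J.+1%:R ^+ 2) ^+ size zs' *
      \sum_(b : B) sqn (coef (efactors zs' v f0) (ctr b)) by exact: H.
elim: zs' => [_ _|z zs' IH sub szs] /=; first by rewrite expr0 mul1r.
apply: le_trans (IH _ (ltnW szs)) _.
  by move=> y yz; apply: sub; rewrite inE yz orbT.
rewrite [_ ^+ (size zs').+1]exprSr -mulrA ler_wpM2l ?exprn_ge0 ?sqr_ge0//.
apply: efactor_lower_bound.
- exact: efactors_inbox (ltnW szs).
- exact: efactors_inbox szs.
- by apply: zs1; apply: sub; rewrite inE eqxx.
- move=> b; apply/negP => /forallP/(_ j0); rewrite mxE [X in _ + X]mxE mulmxnE [v _ _]mxE [X in _ * X]mxE.
  have /forallP/(_ j0) aM := ctr_inbox b.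
  rewrite !eqxx /= mulr1.
  have key (a1 : int) (a2 m : nat) : `|a1| <= m%:Z -> (m.*2.+1 <= a2)%N ->
    ~ `|a1 - a2%:Z| <= m%:Z by lia.
  by rewrite -[_ *+ J.+1]mulr_natr natz -PoszM => /(key _ _ _ aM kapJ).
Qed.

(** The frequencies coming from the t_k miss the box u + [0, p q], over which the coefficients
    therefore sum to the mass 1 of the kernel. Cauchy-Schwarz over the at most prod_j (p q_j + 1)
    points of that box concludes. *)
Lemma kernel_lower_bound :
  1 <= (\prod_j (p * q j).+1)%:R * \sum_(b : B) sqn (coef f0 (ctr b)).
Proof.
pose Q (k : 'rV[int]_N) := [forall j, u 0 j <= k 0 j <= u 0 j + (p * q j)%:Z].
have f0M : all (inbox M \o snd) f0 by have := @efactors_inbox [::]; exact.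
have massQ : \sum_(b : B | Q (ctr b)) coef f0 (ctr b) = 1.
  under eq_bigr do rewrite -[coef _ _]mulr1.
  rewrite (ctr_sum (fun=> 1) Q f0M); under eq_bigr do rewrite mulr1.
  rewrite /f0 /emul big_mkcond big_allpairs_dep /= big_cons big_map.
  rewrite [X in _ + X]big1 ?addr0; last first.
    move=> k _; rewrite big_seq big1// => y yk; rewrite ifN//.
    apply/negP => /forallP Qk; have [j] := sep k.
    have := Qk j; rewrite mxE; have := esupp_ekernel yk j.
    have key (a1 a2 a3 : int) (m : nat) : 0 <= a1 <= m%:Z ->
      a3 <= a2 + a1 <= a3 + m%:Z -> ~ m%:Z < `|a2 - a3| by lia.
    exact: key.
  rewrite big_seq -[RHS](mass_ekernel p q_gt0) /mass [RHS]big_seq.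
  apply: eq_bigr => y yk; rewrite mul1r ifT//.
  apply/forallP => j; rewrite mxE; have := esupp_ekernel yk j.
  have key (a1 a2 : int) (m : nat) : 0 <= a1 <= m%:Z ->
    a2 <= a2 + a1 <= a2 + m%:Z by lia.
  exact: key.
have := sqn_sum_le (enum [set b : B | Q (ctr b)]%SET) (fun b => coef f0 (ctr b)).
rewrite -cardE !big_enum /=.
under eq_bigl do rewrite inE.
rewrite massQ sqn1 => /le_trans; apply.
apply: ler_pM => //; [by apply: sumr_ge0 => b _; exact: sqn_ge0| |]; last first.
  rewrite [leRHS](bigID (fun b => Q (ctr b))) /=.
  under eq_bigl do rewrite inE.
  by rewrite lerDl sumr_ge0// => b _; exact: sqn_ge0.
rewrite ler_nat.
pose F j := [pred i : 'I_L | u 0 j <= i%:Z - M%:Z <= u 0 j + (p * q j)%:Z].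
have -> : #|[set b : B | Q (ctr b)]%SET| = #|family F|.
  apply: eq_card => b; rewrite inE; apply/forallP/familyP => hb j; have := hb j;
    by rewrite inE ?mxE.
rewrite card_family.
have cF j : (#|F j| <= (p * q j).+1)%N.
  have [c cE] : exists c : nat, c%:Z = u 0 j + M%:Z.
    exists (absz (u 0 j + M%:Z)); have := uM j; move: (u 0 j) => ?; lia.
  rewrite -(size_iota c (p * q j).+1) cardE -(size_map val).
  apply: uniq_leq_size; first by rewrite map_inj_uniq ?enum_uniq//; exact: val_inj.
  move=> _ /mapP[i + ->]; rewrite mem_enum inE mem_iota.
  by move: cE; move: (u 0 j) => ? ? /=; lia.
by rewrite foldrE big_image /=; apply: leq_prod => j _; exact: cF.
Qed.

(** Perturbed sampling compares the samples of G with its coefficients, inverting the factors leads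
    back to [f0], and [kernel_lower_bound] bounds [f0] below. The displacement [x] is arbitrary up
    to size h in each coordinate. *)
Lemma discrete_lower_bound (theta eta h : R) (x : B -> 'rV[R]_N) :
  theta * eta = pi *+ 2 / L%:R -> 0 <= h -> 0 <= theta ->
  (forall b j, `|x b 0 j| <= h) -> expR (N%:R * h * (theta * M%:R)) <= 2 ->
  (2 - expR (N%:R * h * (theta * M%:R))) ^+ 2 * L%:R ^+ N <=
  (J.+1%:R ^+ 2) ^+ size zs * (\prod_j (p * q j).+1)%:R *
  \sum_(b : B) sqn (ft theta G (\row_j (eta * (ctr b 0 j)%:~R) + x b)).
Proof.
move=> te h0 th0 xh E2; set E := expR _ in E2 *.
have GM : all (inbox M \o snd) G by exact: efactors_inbox.
pose lam (b : B) : 'rV[R]_N := \row_j (eta * (ctr b 0 j)%:~R).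
pose e (b b' : B) := expi (theta * ipair (ctr b') (lam b)).
pose s (b : B) j : R := theta * (ctr b 0 j)%:~R.
have sM b j : `|s b j| <= theta * M%:R.
  rewrite /s normrM ger0_norm// ler_wpM2l// -intr_norm.
  by have /forallP/(_ j) := ctr_inbox b; rewrite -(ler_int R).
have := @perturbed_sampling R B B e (L%:R ^+ N) (exprn_ge0 _ (ler0n _ _))
  (fun c => box_parseval c te) N (fun b j => x b 0 j) s h (theta * M%:R) h0
  (mulr_ge0 th0 (ler0n _ _)) xh sM (fun b => coef G (ctr b)) E2.
rewrite (box_parseval (fun b => coef G (ctr b)) te).
rewrite (_ : \sum_n sqn (\sum_b _ * (_ * e n b)) =
  \sum_(b : B) sqn (ft theta G (lam b + x b))); last first.
  apply: eq_bigr => b _; rewrite (ft_coef _ _ GM); congr sqn.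
  apply: eq_bigr => b' _; rewrite /e -expiD; congr (_ * expi _).
  rewrite ipairDr mulrDr addrC; congr (_ + _).
  by rewrite /ipair mulr_sumr; apply: eq_bigr => j _; rewrite /s; ring.
set S := \sum_b sqn (coef G _); set S' := \sum_b sqn (ft _ _ _) => samp.
have h1 := kernel_lower_bound.
have h2 := efactors_lower_bound.
set S0 := \sum_b sqn (coef f0 _) in h1 h2; set A := (_ ^+ size zs) in h2 *.
set W := (\prod_j _)%:R in h1 *.
have W0 : 0 <= W by exact: ler0n.
have A0 : 0 <= A by rewrite exprn_ge0 ?sqr_ge0.
apply: le_trans (_ : A * W * ((2 - E) ^+ 2 * (L%:R ^+ N * S)) <= _); last first.
  by apply: ler_wpM2l samp; exact: mulr_ge0.
rewrite [leRHS](_ : _ = (2 - E) ^+ 2 * L%:R ^+ N * (W * (A * S))); last by ring.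
rewrite ler_peMr//; first by apply: mulr_ge0; [exact: sqr_ge0|exact: exprn_ge0].
by apply: (le_trans h1); exact: ler_wpM2l.
Qed.

End lower_bound.
End test_polynomials.

(** * Numerical bounds and decay of the Dirichlet kernel *)

Section real_estimates.
Context {R : realType}.
Implicit Types x y : R.

Lemma sin_MVT x : 0 < x -> exists2 c, 0 < c < x & sin x = cos c * x.
Proof.
move=> x0; have [|c + E] := @MVT R sin cos 0 x x0 (fun y _ => is_derive_sin y).
  by apply: continuous_subspaceT => y; exact: continuous_sin.
by rewrite in_itv /= => cx; exists c => //; move: E; rewrite sin0 !subr0.
Qed.

Lemma sin_sqr_le x : sin x ^+ 2 <= x ^+ 2.
Proof.
wlog x0 : x / 0 < x => [hw|].
  have [x0|x0|->] := ltgtP x 0; last by rewrite sin0.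
    by have := hw (- x); rewrite sinN !sqrrN oppr_gt0; exact.
  exact: hw.
have [c _ ->] := sin_MVT x0; rewrite exprMn ler_piMl ?sqr_ge0//.
Qed.

Lemma one_minus_cos x : 1 - cos x = 2 * sin (x / 2) ^+ 2.
Proof.
rewrite {1}(_ : x = (x / 2) *+ 2); last by rewrite -mulr_natr divfK.
by rewrite cos_mulr2n; have := cos2Dsin2 (x / 2); lra.
Qed.

Lemma one_minus_cos_le x : 1 - cos x <= x ^+ 2 / 2.
Proof. by rewrite one_minus_cos; have := sin_sqr_le (x / 2); lra. Qed.

(** From 1 <= (pi/2)^2 / 2, that is pi^2 >= 8. Together with [ln2_lt] it yields 3 log 2 < pi, on
    which the spacing of the sampling lattice rests. *)
Lemma pi_gt14_5 : 14 / 5 < pi :> R.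
Proof.
rewrite ltNge; apply/negP => pile.
have := one_minus_cos_le (pi / 2 : R); rewrite cos_pihalf subr0.
have := @pi_gt0 R; nra.
Qed.

Lemma ln2_lt : ln 2 < 9 / 10 :> R.
Proof.
rewrite -ltr_expR lnK ?posrE//.
have h : 1 + 9 / 20 <= expR (9 / 20 : R) by exact: expR_ge1Dx.
rewrite (_ : 9 / 10 = 9 / 20 + 9 / 20 :> R); last by lra.
by rewrite expRD; nra.
Qed.

(** With y = x / 4 one has sin (x/2) = 2 sin y cos y and sin y = y cos c for some 0 < c < y. Both
    angles are at most pi / 4, so both cosines have square at least 1/2. *)
Lemma sqn_1Bexpi_ge x : `|x| <= pi -> x ^+ 2 / 4 <= sqn (1 - expi x).
Proof.
wlog x0 : x / 0 <= x => [hw|].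
  have [x0|/ltW x0] := leP 0 x; first exact: hw.
  have := hw (- x); rewrite oppr_ge0 normrN sqrrN => /(_ x0) h /h.
  by rewrite !sqn_1Bexpi cosN.
rewrite ger0_norm// sqn_1Bexpi one_minus_cos => xpi.
have [->|xn0] := eqVneq x 0; first by rewrite mul0r sin0; lra.
have xpos : 0 < x by rewrite lt_neqAle eq_sym xn0.
set y := x / 4.
have y0 : 0 < y by rewrite /y; lra.
have -> : x / 2 = y *+ 2 by rewrite /y -mulr_natr; lra.
rewrite sin_mulr2n.
have [c cy E] := sin_MVT y0.
have cosc : 1 / 2 <= cos c ^+ 2.
  have := cos_mulr2n c; have : 0 <= cos (c *+ 2).
    by apply: cos_ge0_pihalf; rewrite -mulr_natr; move: cy; rewrite /y; lra.
  by rewrite mulr2n [_ *+ 2]mulr2n; lra.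
have cosy : 1 / 2 <= cos y ^+ 2.
  have := cos_mulr2n y; have : 0 <= cos (y *+ 2).
    by apply: cos_ge0_pihalf; rewrite -mulr_natr; rewrite /y; lra.
  by rewrite mulr2n [_ *+ 2]mulr2n; lra.
rewrite E [leRHS](_ : _ = 16 * (cos c ^+ 2 * cos y ^+ 2 * y ^+ 2)); last by rewrite -[_ * _ *+ 2]mulr_natr; ring.
have -> : x ^+ 2 / 4 = 4 * y ^+ 2 by rewrite /y; lra.
have : 1 / 4 <= cos c ^+ 2 * cos y ^+ 2 by nra.
by have := sqr_ge0 y; nra.
Qed.

Lemma sqn_1Bexpi_le4 x : sqn (1 - expi x) <= 4.
Proof. by rewrite sqn_1Bexpi; have := cos_geN1 x; lra. Qed.

Lemma sqn_dirker_le1 q x : sqn (dirker q x) <= 1.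
Proof.
case: q => [|q]; first by rewrite /dirker big_geq// sqn0.
apply: (le_trans (sqn_sum_le _ _)); rewrite size_iota subn0.
under eq_bigr do rewrite sqnM sqn_expi mulr1.
rewrite sumr_const_nat subn0.
have -> : sqn (q.+1%:R^-1 : R[i]) = (q.+1%:R^-1) ^+ 2.
  by rewrite -sqn_real fmorphV rmorph_nat.
rewrite -[_ ^+ 2 *+ _]mulr_natl exprVn mulrA -expr2 divff//. 
Qed.

Lemma dirker_mul q x : (0 < q)%N ->
  dirker q x * (1 - expi x) = q%:R^-1 * (1 - expi (x *+ q)).
Proof.
move=> q0; rewrite /dirker -mulr_sumr -mulrA; congr (_ * _).
under eq_bigr do rewrite expiMn.
rewrite expiMn mulrC -[X in _ = X]opprB subrX1 big_mkord; ring.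
Qed.

Lemma sqn_dirker_le q x : (0 < q)%N -> `|x| <= pi ->
  (q%:R * x) ^+ 2 * sqn (dirker q x) <= 16.
Proof.
move=> q0 xpi; have q0R : 0 < q%:R :> R by rewrite ltr0n.
have := congr1 (@sqn R) (dirker_mul x q0); rewrite !sqnM.
have -> : sqn (q%:R^-1 : R[i]) = (q%:R ^+ 2)^-1.
  by rewrite -exprVn -sqn_real fmorphV rmorph_nat.
move=> E; have := sqn_1Bexpi_le4 (x *+ q); have := sqn_1Bexpi_ge xpi.
have := sqn_ge0 (dirker q x); set D := sqn (dirker q x) in E *.
move=> D0 h1 h2.
have : q%:R ^+ 2 * (D * sqn (1 - expi x)) <= 4.
  by rewrite E mulrA mulfV ?mul1r// gt_eqF// exprn_gt0.
have q2 : 0 < q%:R ^+ 2 :> R by rewrite exprn_gt0.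
have h3 : D * (x ^+ 2 / 4) <= D * sqn (1 - expi x) by exact: ler_wpM2l.
have : q%:R ^+ 2 * (D * (x ^+ 2 / 4)) <= q%:R ^+ 2 * (D * sqn (1 - expi x)).
  by rewrite ler_pM2l.
by rewrite exprMn; nra.
Qed.

End real_estimates.

Section kernel_decay.
Context {R : realType}.

Lemma le_powR (x y r : R) : 0 <= r -> 0 <= x -> x <= y -> x `^ r <= y `^ r.
Proof. by move=> r0 x0 xy; apply: ge0_ler_powR => //; rewrite nnegrE// (le_trans x0). Qed.

Lemma pow1R (r : R) : 1 `^ r = 1.
Proof. by rewrite powR1. Qed.

Lemma powR_le_expn (x r : R) (n : nat) : 1 <= x -> r <= n%:R -> x `^ r <= x ^+ n.
Proof. by move=> x1 rn; rewrite -powR_mulrn ?(le_trans ler01)//; exact: ler_powR. Qed.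

(* The kernel is of size [(q theta |y|)^-2p]; here [b] is its resolution in the
   coordinate with exponent [H], and [b `^ H] the resolution for [rho]. *)
Lemma dirker_decay (H b h theta y l Qp : R) (p q : nat) :
  0 < H <= 1 -> 0 < b <= 1 -> 0 <= h -> 0 < theta -> (0 < p)%N -> (0 < q)%N ->
  0 <= Qp <= (2 * p)%:R -> b <= (2 * p)%:R * (q%:R * theta) ->
  theta * `|y| <= pi -> `|l| <= `|y| + h ->
  (b `^ H * `|l| `^ H) `^ Qp * sqn (dirker q (theta * y)) ^+ p <=
  (1 + 2 * h) `^ Qp + 2 `^ Qp * (64 * p%:R ^+ 2) ^+ p.
Proof.
move=> /andP[H0 H1] /andP[b0 b1] h0 th0 p0 q0 /andP[Q0 Qp2] bq thy ly.
set D := sqn _; have D1 : D <= 1 by exact: sqn_dirker_le1.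
have D0 : 0 <= D by exact: sqn_ge0.
have bH : b `^ H <= 1 by rewrite -[leRHS](pow1R H); apply: le_powR => //; exact: ltW.
have bH0 : 0 <= b `^ H by exact: powR_ge0.
have p1 : 1 <= p%:R :> R by rewrite ler1n.
have P0 : 0 <= 2 `^ Qp * (64 * p%:R ^+ 2) ^+ p :> R.
  by rewrite mulr_ge0 ?powR_ge0// exprn_ge0// mulr_ge0// sqr_ge0.
(* If |l| <= 2 h the trivial bound 1 on the kernel suffices; otherwise |y| >= |l| - h > |l| / 2 and
   y can replace l. *)
have [lh|hl] := leP `|l| (2 * h).
  apply: le_trans (_ : (1 + 2 * h) `^ Qp <= _); last by rewrite lerDl.
  apply: le_trans (_ : (1 + 2 * h) `^ Qp * 1 <= _); last by rewrite mulr1.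
  apply: ler_pM; rewrite ?powR_ge0 ?exprn_ge0 ?exprn_ile1//.
  apply: le_powR; rewrite ?mulr_ge0 ?powR_ge0//.
  apply: le_trans (_ : 1 * (1 + 2 * h) `^ H <= _).
    apply: ler_pM => //.
    by apply: le_powR => //; [exact: ltW|lra].
  rewrite mul1r -[leRHS]powRr1; last by lra.
  by apply: ler_powR => //; lra.
have ly2 : `|l| <= 2 * `|y| by lra.
have y0 : 0 < `|y| by lra.
set X := b * `|y|; have X0 : 0 < X by rewrite mulr_gt0.
have XE : b `^ H * `|l| `^ H <= 2 * X `^ H.
  rewrite /X powRM// ?(ltW b0)// [leRHS]mulrCA ler_wpM2l//.
  apply: le_trans (le_powR _ _ ly2) _ => //; first exact: ltW.
  rewrite powRM// ler_wpM2r ?powR_ge0// -[leRHS]powRr1//.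
  by apply: ler_powR => //; lra.
apply: le_trans (_ : 2 `^ Qp * (64 * p%:R ^+ 2) ^+ p <= _); last first.
  by rewrite lerDr powR_ge0.
apply: le_trans (_ : 2 `^ Qp * ((X `^ H) `^ Qp * D ^+ p) <= _).
  rewrite [leRHS]mulrA -[2 `^ Qp * _]powRM ?powR_ge0// ler_wpM2r ?exprn_ge0//.
  by apply: le_powR => //; rewrite mulr_ge0 ?powR_ge0.
rewrite ler_wpM2l ?powR_ge0//.
(* For X <= 1 the left side is at most 1. For X > 1 it grows at most like X^(2p), which the p-th
   power of the quadratic decay of [D] absorbs. *)
have [X1|X1] := leP X 1.
  apply: le_trans (_ : 1 * 1 <= _); last first.
    rewrite mulr1 exprn_ege1//; have : 1 <= p%:R ^+ 2 :> R by rewrite exprn_ege1.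
    by lra.
  apply: ler_pM; rewrite ?powR_ge0 ?exprn_ge0 ?exprn_ile1//.
  rewrite -[leRHS](pow1R Qp); apply: le_powR; rewrite ?powR_ge0//.
  by rewrite -[leRHS](pow1R H); apply: le_powR => //; exact: ltW.
apply: le_trans (_ : (X ^+ 2) ^+ p * D ^+ p <= _).
  rewrite ler_wpM2r ?exprn_ge0// -exprM -powRrM powR_le_expn ?(ltW X1)//.
  by apply: le_trans (_ : 1 * Qp <= _); [exact: ler_wpM2r|rewrite mul1r].
rewrite -[leLHS]exprMn; apply: lerXn2r; rewrite ?nnegrE; first by rewrite mulr_ge0 ?sqr_ge0.
  by rewrite mulr_ge0 ?sqr_ge0.
have := @sqn_dirker_le R q (theta * y) q0; rewrite normrM (gtr0_norm th0) => /(_ thy).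
rewrite -/D => hD.
have XX : X ^+ 2 <= 4 * p%:R ^+ 2 * (q%:R * (theta * y)) ^+ 2.
  rewrite -[leRHS](_ : ((2 * p)%:R * (q%:R * theta) * `|y|) ^+ 2 = _).
    apply: lerXn2r; rewrite ?nnegrE; first exact: ltW.
      by apply: mulr_ge0 => //; apply: mulr_ge0 => //; apply: mulr_ge0 => //; exact: ltW.
    by rewrite /X ler_wpM2r.
  by rewrite exprMn real_normK ?num_real// natrM; ring.
apply: (le_trans (ler_wpM2r D0 XX)).
by have := sqr_ge0 (p%:R : R); nra.
Qed.

End kernel_decay.

Section kernel_decay_multivariate.
Context {R : realType} {N : nat}.
Variables (H : 'I_N -> R) (b : 'I_N -> R) (q : 'I_N -> nat).
Variables (r h theta Qp : R) (p : nat).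
Hypothesis N_gt0 : (0 < N)%N.
Hypothesis H01 : forall j, 0 < H j <= 1.
Hypothesis b01 : forall j, 0 < b j <= 1.
Hypothesis bH : forall j, b j `^ H j = r.
Hypothesis h_ge0 : 0 <= h.
Hypothesis theta_gt0 : 0 < theta.
Hypothesis p_gt0 : (0 < p)%N.
Hypothesis q_gt0 : forall j, (0 < q j)%N.
Hypothesis Qp2p : 0 <= Qp <= (2 * p)%:R.
Hypothesis bq : forall j, b j <= (2 * p)%:R * ((q j)%:R * theta).

Definition decay_const : R :=
  N%:R `^ Qp * ((1 + 2 * h) `^ Qp + 2 `^ Qp * (64 * p%:R ^+ 2) ^+ p).

(** The coordinate that maximises |l_j|^(H_j) carries [rho] up to the factor N. The decay of its own
    kernel suffices, the other kernels being bounded by 1. *)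
Lemma ekernel_decay (l y : 'rV[R]_N) :
  (forall j, theta * `|y 0 j| <= pi) -> (forall j, `|l 0 j| <= `|y 0 j| + h) ->
  (r * rho H 0 l) `^ Qp * sqn (\prod_j dirker (q j) (theta * y 0 j) ^+ p) <=
  decay_const.
Proof.
move=> thy ly; pose F j := `|l 0 j| `^ H j.
have [j _ jmax] := @arg_maxP _ _ _ (Ordinal N_gt0) xpredT F isT.
have r0 : 0 <= r by rewrite -(bH j) powR_ge0.
have rhoN : rho H 0 l <= N%:R * F j.
  rewrite /rho -[N in N%:R]card_ord -sumr_const mulr_suml; apply: ler_sum => i _.
  by rewrite mxE sub0r normrN mul1r; exact: jmax.
have -> : sqn (\prod_j dirker (q j) (theta * y 0 j) ^+ p) =
    \prod_j sqn (dirker (q j) (theta * y 0 j)) ^+ p.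
  by rewrite (big_morph (@sqn R) (@sqnM R) (@sqn1 R)); apply: eq_bigr => i _; rewrite sqnX.
apply: le_trans (_ : (N%:R * (r * F j)) `^ Qp * sqn (dirker (q j) (theta * y 0 j)) ^+ p <= _).
  apply: ler_pM; rewrite ?powR_ge0//.
  - by apply: prodr_ge0 => i _; rewrite exprn_ge0// sqn_ge0.
  - apply: le_powR; first by case/andP: Qp2p.
      by rewrite mulr_ge0// sumr_ge0// => i _; exact: powR_ge0.
    by rewrite mulrCA ler_wpM2l.
  - rewrite (bigD1 j)//= ler_piMr ?exprn_ge0 ?sqn_ge0//.
    rewrite prodr_ile1// => i _; rewrite exprn_ge0 ?sqn_ge0//=.
    by rewrite exprn_ile1 ?sqn_ge0 ?sqn_dirker_le1.
rewrite powRM ?mulr_ge0 ?powR_ge0// -mulrA ler_wpM2l ?powR_ge0// -(bH j).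
by apply: dirker_decay.
Qed.

End kernel_decay_multivariate.

(** * The weighted lower bound for samples near a lattice *)

Section grid.
Context {R : realType} {N : nat}.

Definition gridpt (theta : R) (k : 'rV[int]_N) : 'rV[R]_N :=
  \row_j (theta * (k 0 j)%:~R).

Lemma edot_gridpt theta k l : edot (gridpt theta k) l = theta * ipair k l.
Proof.
by rewrite /edot /ipair mulr_sumr; apply: eq_bigr => j _; rewrite mxE mulrA.
Qed.

(** The Fourier symbol of X(u) - sum_k a_k X(t_k), up to the constant terms, which cancel when the
    a_k sum to 1. *)
Definition gval (n : nat) (u : 'rV[R]_N) (t : 'I_n -> 'rV[R]_N) (a : 'I_n -> R) l :=
  expi (edot u l) - \sum_k (a k)%:C%C * expi (edot (t k) l).

Lemma enorm_ge (l : 'rV[R]_N) j : `|l 0 j| <= enorm l.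
Proof.
rewrite /enorm -sqrtr_sqr ler_wsqrtr// /edot (bigD1 j)//= expr2 lerDl.
by rewrite sumr_ge0// => i _; rewrite -expr2 sqr_ge0.
Qed.

Lemma trunc_half (x : R) : 1 <= x -> x <= 2 * (Num.trunc x)%:R.
Proof.
move=> x1; have := truncnS_gt x; rewrite -natr1.
have : 1 <= (Num.trunc x)%:R :> R by rewrite ler1n truncn_gt0.
lra.
Qed.

Lemma trunc_le (x : R) : 0 <= x -> (Num.trunc x)%:R <= x.
Proof. by rewrite truncn_le. Qed.

Lemma powR_le_self (x s : R) : 0 < x <= 1 -> 1 <= s -> x `^ s <= x.
Proof.
by move=> x01 s1; have := ge1r_powRZ x01 ler01 s1; rewrite mulr1 pow1R mulr1.
Qed.

Lemma prod_powR (I : Type) (s : seq I) (x : R) (e : I -> R) : 0 < x ->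
  \prod_(i <- s) x `^ e i = x `^ (\sum_(i <- s) e i).
Proof.
move=> x0; elim: s => [|i s IH]; first by rewrite !big_nil powRr0.
by rewrite !big_cons IH powRD// (gt_eqF x0) implybT.
Qed.

Lemma shifted_index (k : int) (m : nat) : (absz k <= m)%N ->
  (absz (k + m%:Z)%R < m.*2.+1)%N /\ k = (absz (k + m%:Z))%:Z - m%:Z.
Proof. by lia. Qed.

Section grid_lower_bound.
Variables (H : 'I_N -> R) (h T T' MF : R).
Hypothesis N_gt0 : (0 < N)%N.
Hypothesis H01 : forall j, 0 < H j < 1.
Hypothesis h_gt0 : 0 < h.
Hypothesis T_gt0 : 0 < T.
Hypothesis TT' : T < T'.
Hypothesis T'h : 3 * (T' * h) < pi.
Hypothesis T'hN : expR (N%:R * h * T') < 2.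

(** None of these constants depends on r or on the grid. [p] makes 2p >= Qp. The margin [delta] is
    shared by the kernel and the factors. [c0] is so small that r0 = c0 r satisfies r0 <= delta' and
    N r0 < r. Lattice points of norm at most [MF] have first index at most [m0] in absolute value,
    so [m1] factors kill them, and [J] shifts serve to invert each one. [K] is the loss in bounding
    the test polynomial above, [A] the loss in inverting the factors. *)
Let Qp := homdim H + 2.
Let p := (Num.trunc Qp).+1.
Let delta := T' - T.
Let delta' := Num.min 1 (delta / 2).
Let Rmax := N%:R * (1 + 2 * T).
Let c0 := delta' / (2 * N%:R * Rmax).
Let m0 := Num.trunc (`|MF| * T').
Let m1 := m0.*2.+1.
Let J := Num.trunc (12 * T' * m1%:R / delta).
Let K := 4 ^+ m1 * @decay_const R N h Qp p.
Let A := (J.+1%:R ^+ 2) ^+ m1 : R.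

Let c := c0 ^+ 2 * ((2 - expR (N%:R * h * T')) ^+ 2 * T' ^+ N) / (A * K).

Let T'_gt0 : 0 < T'. Proof. exact: lt_trans TT'. Qed.
Let delta_gt0 : 0 < delta. Proof. by rewrite subr_gt0. Qed.
Let delta'_gt0 : 0 < delta'. Proof. by rewrite lt_min ltr01 divr_gt0. Qed.
Let N1 : 1 <= N%:R :> R. Proof. by rewrite ler1n. Qed.
Let Rmax1 : 1 <= Rmax. Proof. by apply: mulr_ege1 => //; rewrite lerDl mulr_ge0 ?ltW. Qed.
Let N0 : 0 < N%:R :> R. Proof. by rewrite ltr0n. Qed.
Let Rmax0 : 0 < Rmax. Proof. exact: lt_le_trans Rmax1. Qed.
Let c0_gt0 : 0 < c0.
Proof.
by apply: divr_gt0 => //; apply: mulr_gt0 => //; exact: mulr_gt0.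
Qed.
Let homdim_ge0 : 0 <= homdim H.
Proof. by apply: sumr_ge0 => j _; rewrite invr_ge0; case/andP: (H01 j) => /ltW. Qed.
Let Qp_bound : 0 <= Qp <= (2 * p)%:R.
Proof.
rewrite /Qp addr_ge0//= natrM; have := truncnS_gt Qp; rewrite -/p /Qp.
by have := homdim_ge0; lra.
Qed.
Let K_gt0 : 0 < K.
Proof.
rewrite mulr_gt0 ?exprn_gt0// /decay_const.
apply: mulr_gt0; first by apply: powR_gt0; exact: lt_le_trans N1.
apply: ltr_wpDl; first exact: powR_ge0.
by apply: mulr_gt0; [exact: powR_gt0|rewrite exprn_gt0// mulr_gt0// exprn_gt0].
Qed.
Let A_gt0 : 0 < A. Proof. by rewrite !exprn_gt0. Qed.

Lemma grid_const_gt0 : 0 < c.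
Proof.
apply: divr_gt0; last exact: mulr_gt0.
apply: mulr_gt0; first exact: exprn_gt0.
by apply: mulr_gt0; [rewrite exprn_gt0// subr_gt0|exact: exprn_gt0].
Qed.

Section resolution.
Variables (r : R).
Hypothesis r_gt0 : 0 < r.
Hypothesis r_le : r <= Rmax.

Let r0 := c0 * r.
(** The sides of an anisotropic box whose [rho]-size is r0 in each coordinate; their product is
    r0^Q. *)
Let bw j := r0 `^ (H j)^-1.

Let r0_gt0 : 0 < r0. Proof. exact: mulr_gt0. Qed.
Let r0_le : r0 <= delta'.
Proof.
rewrite /r0 /c0 mulrAC ler_pdivrMr; last by apply: mulr_gt0 => //; exact: mulr_gt0.
rewrite ler_wpM2l ?(ltW delta'_gt0)//.
by apply: (le_trans r_le); rewrite ler_peMl ?(ltW Rmax0)//; have := N1; lra.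
Qed.
Let delta'1 : delta' <= 1. Proof. by rewrite ge_min lexx. Qed.
Let delta'2 : delta' <= delta / 2. Proof. by rewrite ge_min lexx orbT. Qed.
Let Nr0 : N%:R * r0 < r.
Proof.
rewrite /r0 mulrA gtr_pMl// /c0 mulrA ltr_pdivrMr; last by apply: mulr_gt0 => //; exact: mulr_gt0.
have h1 : N%:R * delta' <= N%:R by rewrite ler_piMr.
have h2 : N%:R <= N%:R * Rmax by rewrite ler_peMr.
by rewrite mul1r -mulrA; have := N0; lra.
Qed.
Let b_gt0 j : 0 < bw j. Proof. exact: powR_gt0. Qed.
Let bH j : bw j `^ H j = r0.
Proof.
rewrite /bw -powRrM mulVf ?powRr1 ?(ltW r0_gt0)//.
by rewrite gt_eqF//; case/andP: (H01 j).
Qed.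
Let b_le j : bw j <= delta'.
Proof.
apply: le_trans r0_le; apply: powR_le_self; first by rewrite r0_gt0 (le_trans r0_le).
by case/andP: (H01 j) => H0 H1; rewrite invf_ge1// ltW.
Qed.

(** Beyond [M0] the mesh T' / M is fine enough for every [q j] below to be at least 1 and for the
    quotient defining [kap] to be at least 2. *)
Let M0 := (Num.trunc (\sum_j p%:R * T' / bw j + 4 * T' * m1%:R / delta)).+1.

Variables (M : nat).
Hypothesis M_ge : (M0 <= M)%N.
Let L := M.*2.+1.
Notation B := {ffun 'I_N -> 'I_L}.
Let theta := T' / M%:R.
Let eta := pi *+ 2 / (theta * L%:R).
Let M_gt0 : (0 < M)%N. Proof. exact: leq_trans M_ge. Qed.
Let MR0 : 0 < M%:R :> R. Proof. by rewrite ltr0n. Qed.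
Let MR1 : 1 <= M%:R :> R. Proof. by rewrite ler1n. Qed.
Let M_big : \sum_j p%:R * T' / bw j + 4 * T' * m1%:R / delta <= M%:R.
Proof. by apply: ltW; apply: (lt_le_trans (truncnS_gt _)); rewrite ler_nat. Qed.
Let theta_gt0 : 0 < theta. Proof. exact: divr_gt0. Qed.
Let thetaM : theta * M%:R = T'. Proof. by rewrite divfK// gt_eqF. Qed.
Let LR : L%:R = 2 * M%:R + 1 :> R.
Proof. by rewrite /L -natr1 -mul2n natrM. Qed.
Let te : theta * eta = pi *+ 2 / L%:R.
Proof.
rewrite /eta mulrC -mulrA invfM; congr (_ * _).
by rewrite mulrAC mulVf ?mul1r// gt_eqF.
Qed.
Let eta_gt0 : 0 < eta.
Proof.
apply: divr_gt0; first by apply: mulrn_wgt0 => //; exact: pi_gt0.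
by rewrite mulr_gt0// ltr0n.
Qed.
Let thetaL : theta * L%:R <= 3 * T'.
Proof.
have h1 : theta * 1 <= theta * M%:R by rewrite ler_pM2l.
by move: h1; rewrite LR thetaM; have := thetaM; lra.
Qed.
Let eta_ge : 2 * pi <= 3 * T' * eta.
Proof.
have : eta * (theta * L%:R) = 2 * pi by rewrite divfK ?mulr_natl// gt_eqF// mulr_gt0// ltr0n.
by move=> h1; have := thetaL; have := eta_gt0; nra.
Qed.

(** theta L = T' (2 + 1/M) <= 3 T' gives eta >= 2 pi / (3 T'), which exceeds 2 h because 3 T' h <
    pi. Cubes around distinct lattice points are thereby disjoint. *)
Lemma spacing_gt : 2 * h < eta.
Proof. by have := eta_ge; have := T'h; have := T'_gt0; nra. Qed.

Let Mb j : p%:R * T' / bw j <= M%:R.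
Proof.
apply: le_trans M_big; rewrite (bigD1 j)//= -addrA lerDl addr_ge0//.
  by apply: sumr_ge0 => i _; rewrite !mulr_ge0 ?invr_ge0 ?ltW.
by rewrite !mulr_ge0 ?invr_ge0 ?ltW.
Qed.
Let Md : 4 * T' * m1%:R / delta <= M%:R.
Proof.
apply: le_trans M_big; rewrite lerDr.
by apply: sumr_ge0 => i _; rewrite !mulr_ge0 ?invr_ge0 ?ltW.
Qed.

(** The kernel gets width p q_j theta between b_j / 2 and b_j, and the m1 shifts by [kap] together
    take at most delta / 2. *)
Let q j := Num.trunc (bw j / (p%:R * theta)).
Let kap := Num.trunc (delta * M%:R / (2 * T' * m1%:R)).

Let pR0 : 0 < p%:R :> R. Proof. by rewrite ltr0n. Qed.
Let m1R0 : 0 < m1%:R :> R. Proof. by rewrite ltr0n. Qed.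
Let ptheta0 : 0 < p%:R * theta. Proof. exact: mulr_gt0. Qed.
Let Tm1 : 0 < 2 * T' * m1%:R. Proof. by rewrite !mulr_gt0. Qed.
Let q_arg j : 1 <= bw j / (p%:R * theta).
Proof.
rewrite ler_pdivlMr// mul1r.
have hM := Mb j; rewrite ler_pdivrMr// in hM.
by rewrite /theta mulrA ler_pdivrMr// [leRHS]mulrC.
Qed.
Let q_gt0 j : (0 < q j)%N. Proof. by rewrite truncn_gt0. Qed.
Let pq_le j : (p * q j)%:R * theta <= bw j.
Proof.
have := trunc_le (le_trans ler01 (q_arg j)); rewrite -/(q j) natrM.
by rewrite ler_pdivlMr//; lra.
Qed.
Let bq j : bw j <= (2 * p)%:R * ((q j)%:R * theta).
Proof.
have := trunc_half (q_arg j); rewrite -/(q j) natrM.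
by rewrite ler_pdivrMr//; lra.
Qed.
Let kap_arg : 2 <= delta * M%:R / (2 * T' * m1%:R).
Proof.
rewrite ler_pdivlMr//; move: Md; rewrite ler_pdivrMr//; lra.
Qed.
Let kap_le : kap%:R * (2 * T' * m1%:R) <= delta * M%:R.
Proof.
rewrite -ler_pdivlMr// trunc_le//; apply: le_trans kap_arg; lra.
Qed.
Let kap_ge : delta * M%:R <= kap%:R * (4 * T' * m1%:R).
Proof.
have k1 : 1 <= delta * M%:R / (2 * T' * m1%:R) by apply: le_trans kap_arg; lra.
have := trunc_half k1; rewrite -/kap ler_pdivrMr//; lra.
Qed.

Let kapJ : (L <= kap * J.+1)%N.
Proof.
rewrite -(ler_nat R) natrM LR.
have := truncnS_gt (12 * T' * m1%:R / delta); rewrite -/J ltr_pdivrMr// => hJ.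
have : 3 * (delta * M%:R) <= kap%:R * J.+1%:R * delta.
  apply: le_trans (_ : kap%:R * (12 * T' * m1%:R) <= _); first by have := kap_ge; lra.
  by rewrite -[leRHS]mulrA ler_wpM2l// ltW.
move=> h1; have h2 : 3 * M%:R <= kap%:R * J.+1%:R :> R.
  by rewrite -(ler_pM2l delta_gt0); lra.
by have := MR1; lra.
Qed.

Variables (n : nat) (u : 'rV[int]_N) (t : 'I_n -> 'rV[int]_N) (a : 'I_n -> R).
Hypothesis uT : forall j, `|gridpt theta u 0 j| <= T.
Hypothesis tT : forall k j, `|gridpt theta (t k) 0 j| <= T.
Hypothesis sep : forall k, r <= rho H (gridpt theta u) (gridpt theta (t k)).
Variable y : B -> 'rV[R]_N.
Let lam (b : B) := gridpt eta (ctr b).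
Hypothesis yh : forall b j, `|y b 0 j - lam b 0 j| <= h.

(** The i-th factor vanishes at the lattice points whose first index is i - m0; together the factors
    kill the slab where that index is at most m0 in absolute value. *)
Let zs : seq R[i] :=
  [seq expi (- (kap%:R * theta * eta * (i%:R - m0%:R))) | i <- iota 0 m1].

Let size_zs : size zs = m1. Proof. by rewrite size_map size_iota. Qed.

(** The budget is T for the point, delta / 2 for the kernel and delta / 2 for the factors: in total
    T' = theta M. *)
Let grid_bound (k : 'rV[int]_N) j : `|gridpt theta k 0 j| <= T ->
  `|k 0 j| + (p * q j + size zs * kap)%:Z <= M%:Z.
Proof.
move=> kT; rewrite size_zs -(ler_int R) PoszD !intrD intr_norm.
rewrite -[(p * q j)%:Z%:~R]/((p * q j)%:R) -[(m1 * kap)%:Z%:~R]/((m1 * kap)%:R).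
rewrite -[M%:Z%:~R]/(M%:R) -(ler_pM2l theta_gt0) thetaM !mulrDr.
have h1 : theta * `|(k 0 j)%:~R| <= T.
  by move: kT; rewrite mxE normrM gtr0_norm.
have h2 := pq_le j; have h3 := le_trans (b_le j) delta'2.
have h4 : theta * (m1 * kap)%:R <= delta / 2.
  have := kap_le; rewrite -(ler_pM2l theta_gt0) [leRHS]mulrCA thetaM natrM.
  have := T'_gt0; set X := theta * (m1%:R * kap%:R).
  have -> : theta * (kap%:R * (2 * T' * m1%:R)) = X * 2 * T' by rewrite /X; ring.
  by move=> ?; rewrite ler_pM2r//; lra.
by move: h1 h2 h3 h4; rewrite /delta; lra.
Qed.

(** If t_k were within p q_j of u in every coordinate, the [rho]-distance would be at most sum_j
    b_j^(H_j) = N r0 < r. *)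
Let sep_grid k : exists j, (p * q j)%:Z < `|t k 0 j - u 0 j|.
Proof.
apply/existsP; apply: contraT; rewrite negb_exists => /forallP close.
suff : rho H (gridpt theta u) (gridpt theta (t k)) < r by rewrite ltNge sep.
apply: le_lt_trans Nr0; rewrite /rho -[N in N%:R]card_ord -sumr_const mulr_suml.
apply: ler_sum => j _; rewrite mul1r -(bH j); apply: le_powR => //.
  by case/andP: (H01 j) => /ltW.
apply: le_trans (pq_le j); rewrite !mxE -mulrBr -rmorphB /= normrM gtr0_norm// mulrC.
rewrite ler_wpM2r ?(ltW theta_gt0)// -intr_norm distrC.
by have := close j; rewrite -leNgt -(ler_int R).
Qed.

Let good (b : B) := (m0 < absz (ctr b 0%R (Ordinal N_gt0)))%N.

Let lam0 (b : B) : lam b 0 (Ordinal N_gt0) = eta * (ctr b 0 (Ordinal N_gt0))%:~R.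
Proof. by rewrite mxE. Qed.

(** A first index above m0 exceeds |MF| T', and eta T' >= 2 pi / 3 > 1. *)
Let good_far b : good b -> MF < enorm (lam b).
Proof.
rewrite /good -(ler_nat R) => gb; apply: lt_le_trans (enorm_ge _ (Ordinal N_gt0)).
rewrite lam0 normrM gtr0_norm// -intr_norm.
have e1 : 1 <= eta * T' by have := eta_ge; have := @pi_ge2 R; have := T'_gt0; nra.
have := truncnS_gt (`|MF| * T'); rewrite -/m0 => m0b.
have : `|MF| * T' < `|ctr b 0 (Ordinal N_gt0)|%:~R.
  apply: (lt_le_trans m0b); apply: le_trans gb _.
  by rewrite -[leLHS]/((absz (ctr b 0 (Ordinal N_gt0)))%:Z%:~R) abszE.
set X : R := _%:~R => hX.
have : `|MF| <= eta * (`|MF| * T') by have := normr_ge0 MF; nra.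
have := ler_norm MF; have := eta_gt0; nra.
Qed.

(** In the killed slab the node is moved back to the lattice point itself, where G vanishes, so the
    slab drops out of the sum. *)
Let y' b := if good b then y b else lam b.

Let G := efactors zs (kap%:Z *: delta_mx 0 (Ordinal N_gt0))
  (emul (esampled u t a) (ekernel q p)).

Let ftG l : ft theta G l =
  \prod_(z <- zs) (1 - z * expi (theta * (kap%:R * l 0 (Ordinal N_gt0)))) *
  (gval (gridpt theta u) (fun k => gridpt theta (t k)) a l *
   \prod_j dirker (q j) (theta * l 0 j) ^+ p).
Proof.
rewrite ft_efactors ft_emul ft_esampled ft_ekernel /gval edot_gridpt.
congr (_ * ((_ - _) * _)); apply: eq_bigr => i _; last by rewrite edot_gridpt.
by rewrite ipair_delta.
Qed.

Let ftG_bad b : ~~ good b -> ft theta G (lam b) = 0.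
Proof.
rewrite /good -leqNgt => gb; rewrite ftG; set k := ctr b 0 _ in gb *.
have -> : \prod_(z <- zs) (1 - z * expi (theta * (kap%:R * lam b 0 (Ordinal N_gt0)))) = 0.
  apply/eqP; rewrite prodf_seq_eq0; apply/hasP.
  have [km kE] := shifted_index gb.
  exists (expi (- (kap%:R * theta * eta * k%:~R))) => /=.
    apply/mapP; exists (absz (k + m0%:Z)); first by rewrite mem_iota.
    by congr (expi (- (_ * _))); rewrite {1}kE intrD rmorphN.
  rewrite -expiD lam0 -/k.
  have -> : - (kap%:R * theta * eta * k%:~R) + theta * (kap%:R * (eta * k%:~R)) = 0 by ring.
  by rewrite expi0 subrr.
by rewrite mul0r.
Qed.

(** The nodes stay within half a period, where the kernel estimate holds: theta eta M = pi - pi / L,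
    and theta h <= pi / L because theta L h <= 3 T' h < pi. *)
Let thy b j : theta * `|y b 0 j| <= pi.
Proof.
have yl : `|y b 0 j| <= eta * M%:R + h.
  rewrite -(subrK (lam b 0 j) (y b 0 j)) addrC (le_trans (ler_normD _ _))//.
  apply: lerD => //; rewrite mxE normrM gtr0_norm// ler_wpM2l ?(ltW eta_gt0)//.
  by rewrite -intr_norm; have /forallP/(_ j) := ctr_inbox b; rewrite -(ler_int R).
apply: le_trans (ler_wpM2l (ltW theta_gt0) yl) _.
have L0 : 0 < L%:R :> R by rewrite ltr0n.
have hL : theta * h <= pi / L%:R.
  rewrite ler_pdivlMr// mulrAC; apply: le_trans (ler_wpM2r (ltW h_gt0) thetaL) _.
  by have := T'h; lra.
have piL : pi *+ 2 / L%:R * M%:R = pi - pi / L%:R :> R.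
  apply: (mulIf (lt0r_neq0 L0)); rewrite mulrBl mulrAC !divfK ?gt_eqF// LR -mulr_natl.
  by ring.
by rewrite mulrDr mulrA te piL; lra.
Qed.

Let rho_gt0 b : good b -> 0 < rho H 0 (lam b).
Proof.
rewrite /good => gb; rewrite /rho (bigD1 (Ordinal N_gt0))//=.
apply: ltr_pwDl; last by apply: sumr_ge0 => i _; exact: powR_ge0.
rewrite powR_gt0// normr_gt0 mxE sub0r oppr_eq0 lam0 mulf_eq0 gt_eqF//= intr_eq0.
by move: gb; apply: contraL => /eqP ->.
Qed.

(** Each of the m1 factors has squared modulus at most 4. The kernel is evaluated at the node but
    its decay is expressed at the lattice centre, at most h away in each coordinate. *)
Let ftG_good b : good b -> sqn (ft theta G (y b)) <=
  K / r0 `^ Qp * ((rho H 0 (lam b) `^ Qp)^-1 *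
    sqn (gval (gridpt theta u) (fun k => gridpt theta (t k)) a (y b))).
Proof.
move=> gb; rewrite ftG !sqnM.
set P := sqn (\prod_(z <- zs) _); set g := sqn (gval _ _ _ _); set D := sqn _.
have P4 : P <= 4 ^+ m1.
  rewrite /P (big_morph (@sqn R) (@sqnM R) (@sqn1 R)) -size_zs.
  have h1 : \prod_(z <- zs) sqn (1 - z * expi (theta * (kap%:R * y b 0 (Ordinal N_gt0)))) <=
      \prod_(z <- zs) (4 : R).
    rewrite big_seq [leRHS]big_seq; apply: ler_prod => _ /mapP[i _ ->].
    by rewrite sqn_ge0 -expiD sqn_1Bexpi_le4.
  by apply: (le_trans h1); rewrite big_const_seq count_predT size_zs iter_mulr mulr1.
have rQ : 0 < r0 `^ Qp by exact: powR_gt0.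
have rhoQ : 0 < rho H 0 (lam b) `^ Qp by apply: powR_gt0; exact: rho_gt0.
have Dle : r0 `^ Qp * rho H 0 (lam b) `^ Qp * D <= @decay_const R N h Qp p.
  rewrite -powRM ?(ltW r0_gt0) ?(ltW (rho_gt0 gb))//.
  apply: (@ekernel_decay R N H bw q r0 h theta Qp p N_gt0) => //.
  - by move=> j; case/andP: (H01 j) => -> /ltW.
  - by move=> j; rewrite b_gt0 (le_trans (b_le j)).
  - exact: ltW.
  - move=> j; rewrite -[lam b 0 j](subrK (y b 0 j)) addrC.
    by rewrite (le_trans (ler_normD _ _))// lerD// distrC.
have g0 : 0 <= g by exact: sqn_ge0.
have D0 : 0 <= D by exact: sqn_ge0.
have P0 : 0 <= P by exact: sqn_ge0.
have Dle2 : D <= @decay_const R N h Qp p / r0 `^ Qp / rho H 0 (lam b) `^ Qp.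
  by rewrite !ler_pdivlMr// mulrC [D * _]mulrC mulrA [leLHS](_ : _ = r0 `^ Qp * rho H 0 (lam b) `^ Qp * D)//; ring.
apply: le_trans (_ : 4 ^+ m1 * (g * (@decay_const R N h Qp p / r0 `^ Qp / rho H 0 (lam b) `^ Qp)) <= _).
  by apply: ler_pM => //; [exact: mulr_ge0|exact: ler_wpM2l].
by rewrite /K le_eqVlt; apply/orP; left; apply/eqP; ring.
Qed.

(** The kernel has of order theta^(-N) r0^Q frequencies, the lattice has of order theta^(-N) nodes,
    and the kernel decay contributes r0^(-(Q+2)). The mesh cancels and r0^2 remains. *)
Lemma grid_lower_bound :
  c * r ^+ 2 <= \sum_(b : B | MF < enorm (lam b)) (rho H 0 (lam b) `^ Qp)^-1 *
    sqn (gval (gridpt theta u) (fun k => gridpt theta (t k)) a (y b)).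
Proof.
set S := \sum_(b | _) _.
have E2 : expR (N%:R * h * (theta * M%:R)) <= 2 by rewrite thetaM ltW.
have zs1 z : z \in zs -> sqn z = 1 by move=> /mapP[i _ ->]; exact: sqn_expi.
have xh b j : `|(y' b - lam b) 0 j| <= h.
  rewrite /y'; case: ifP => _; last by rewrite subrr mxE normr0 ltW.
  by rewrite mxE [X in _ + X]mxE; exact: yh.
have := @discrete_lower_bound R N M n p q u t a (Ordinal N_gt0) kap J zs
  isT q_gt0 (fun j => grid_bound (uT j)) (fun k j => grid_bound (tT k j)) sep_grid
  zs1 kapJ theta eta h (fun b => y' b - lam b) te (ltW h_gt0) (ltW theta_gt0) xh E2.
rewrite thetaM size_zs -/A; set E := (2 - _) ^+ 2; set W := (\prod_j _)%:R.
under eq_bigr do rewrite addrC subrK.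
set S' := \sum_b _ => main.
have E0 : 0 < E by rewrite exprn_gt0// subr_gt0.
have S'S : S' <= K / r0 `^ Qp * S.
  rewrite /S' (bigID good) /= [X in _ + X]big1 ?addr0; last first.
    by move=> b gb; rewrite /y' (negbTE gb) -/G ftG_bad ?sqn0.
  rewrite /S mulr_sumr [leLHS]big_mkcond [leRHS]big_mkcond; apply: ler_sum => b _.
  case: ifP => gb; first by rewrite good_far// /y' gb; exact: ftG_good.
  case: ifP => // _; apply: mulr_ge0; last first.
    by rewrite mulr_ge0 ?invr_ge0 ?powR_ge0 ?sqn_ge0.
  by rewrite mulr_ge0 ?invr_ge0 ?powR_ge0 ?(ltW K_gt0).
have W2 : W * theta ^+ N <= 2 ^+ N * r0 `^ homdim H.
  have cN (x : R) : x ^+ N = \prod_(j < N) x by rewrite prodr_const card_ord.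
  rewrite /W natr_prod [theta ^+ N]cN -big_split /=.
  rewrite [2 ^+ N]cN /homdim -prod_powR// -big_split /=.
  apply: ler_prod => j _; rewrite mulr_ge0 ?(ltW theta_gt0)//=.
  rewrite -natr1 mulrDl mul1r.
  have : theta <= (p * q j)%:R * theta.
    by rewrite ler_peMl ?(ltW theta_gt0)// ler1n muln_gt0 q_gt0.
  by have := pq_le j; rewrite -/(bw j); lra.
have S'0 : 0 <= S' by apply: sumr_ge0 => b _; exact: sqn_ge0.
have S0 : 0 <= S.
  by apply: sumr_ge0 => b _; rewrite mulr_ge0 ?invr_ge0 ?powR_ge0 ?sqn_ge0.
have rQ : 0 < r0 `^ homdim H by exact: powR_gt0.
have step : E * (2 * T') ^+ N <= A * (2 ^+ N * r0 `^ homdim H) * S'.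
  apply: le_trans (_ : E * (L%:R * theta) ^+ N <= _).
    rewrite ler_wpM2l ?(ltW E0)// lerXn2r ?nnegrE ?mulr_ge0 ?(ltW theta_gt0) ?(ltW T'_gt0)//.
    by rewrite LR -thetaM; have := theta_gt0; lra.
  rewrite exprMn [leLHS]mulrA; apply: le_trans (_ : A * W * S' * theta ^+ N <= _).
    by rewrite ler_wpM2r// exprn_ge0// ltW.
  rewrite [leLHS](_ : _ = A * (W * theta ^+ N) * S'); last by ring.
  by rewrite ler_wpM2r// ler_wpM2l// ltW.
have step2 : E * T' ^+ N <= A * K * S / r0 ^+ 2.
  have -> : A * K * S / r0 ^+ 2 = A * r0 `^ homdim H * (K / r0 `^ Qp * S).
    rewrite /Qp powRD; last by rewrite (gt_eqF r0_gt0) implybT.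
    rewrite -[r0 `^ 2]/(r0 `^ 2%:R) powR_mulrn ?(ltW r0_gt0)// invfM.
    by rewrite mulrACA; field; rewrite (gt_eqF rQ) (gt_eqF r0_gt0).
  apply: le_trans (_ : A * r0 `^ homdim H * S' <= _); last first.
    by rewrite ler_wpM2l// mulr_ge0 ?ltW.
  have t2 : 0 < 2 ^+ N :> R by rewrite exprn_gt0.
  rewrite -(ler_pM2l t2) (_ : 2 ^+ N * (E * _) = E * (2 * T') ^+ N).
    by apply: (le_trans step); rewrite le_eqVlt; apply/orP; left; apply/eqP; ring.
  by rewrite exprMn; ring.
rewrite /c -/E; have AK : 0 < A * K by exact: mulr_gt0.
have -> : c0 ^+ 2 * (E * T' ^+ N) / (A * K) * r ^+ 2 = (E * T' ^+ N) * r0 ^+ 2 / (A * K).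
  by rewrite /r0; ring.
rewrite ler_pdivrMr// [leRHS]mulrC.
by move: step2; rewrite ler_pdivlMr ?exprn_gt0.
Qed.

End resolution.
End grid_lower_bound.
End grid.

Section grid_sampling.
Context {R : realType} {N : nat}.

Lemma grid_sampling (H : 'I_N -> R) (h T MF : R) :
  (0 < N)%N -> (forall j, 0 < H j < 1) -> 0 < h -> 0 < T -> T * h * N%:R < ln 2 ->
  exists T' c : R, [/\ T < T', 0 < c &
    forall r, 0 < r -> r <= N%:R * (1 + 2 * T) ->
    exists M0 : nat, forall M : nat, (M0 <= M)%N ->
    exists eta, 2 * h < eta /\
    forall n (u : 'rV[int]_N) (t : 'I_n -> 'rV[int]_N) (a : 'I_n -> R),
    (forall j, `|gridpt (T' / M%:R) u 0 j| <= T) ->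
    (forall k j, `|gridpt (T' / M%:R) (t k) 0 j| <= T) ->
    (forall k, r <= rho H (gridpt (T' / M%:R) u) (gridpt (T' / M%:R) (t k))) ->
    forall y : {ffun 'I_N -> 'I_M.*2.+1} -> 'rV[R]_N,
    (forall b j, `|y b 0 j - gridpt eta (ctr b) 0 j| <= h) ->
    c * r ^+ 2 <= \sum_(b | MF < enorm (gridpt eta (ctr b)))
      (rho H 0 (gridpt eta (ctr b)) `^ (homdim H + 2))^-1 *
      sqn (gval (gridpt (T' / M%:R) u) (fun k => gridpt (T' / M%:R) (t k)) a (y b))].
Proof.
move=> N0 H01 h0 T0 ThN; have NR : 1 <= N%:R :> R by rewrite ler1n.
have hN0 : 0 < h * N%:R by rewrite mulr_gt0// (lt_le_trans ltr01).
(* Strictness of the hypothesis leaves room for T' > T with N h T' < log 2; the gap T' - T pays for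
   the kernel and the factors. *)
have [T' /andP[TT' T'l]] : exists T', T < T' < ln 2 / (h * N%:R).
  have mid (B : R) : T < B -> exists T', T < T' < B.
    by move=> TB; exists ((T + B) / 2); lra.
  by apply: mid; rewrite ltr_pdivlMr// mulrA.
have T'hN : N%:R * h * T' < ln 2 by move: T'l; rewrite ltr_pdivlMr//; lra.
have E2 : expR (N%:R * h * T') < 2 by rewrite -[ltRHS](@lnK _ 2) ?posrE// ltr_expR.
have T'h : 3 * (T' * h) < pi.
  have := @pi_gt14_5 R; have := @ln2_lt R.
  have : T' * h <= N%:R * h * T'.
    have -> : N%:R * h * T' = N%:R * (T' * h) by ring.
    by rewrite ler_peMl// mulr_ge0 ?(ltW h0)// ltW// (lt_trans T0).
  by lra.
exists T'; eexists; split; [exact: TT'|exact: (grid_const_gt0 H MF N0 T0 TT' E2)|].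
move=> r r0 rle.
(* This is [M0] of the preceding section with its local constants expanded. *)
exists (Num.trunc (\sum_j (Num.trunc (homdim H + 2)).+1%:R * T' /
   (Num.min 1 ((T' - T) / 2) / (2 * N%:R * (N%:R * (1 + 2 * T))) * r) `^ (H j)^-1 +
   4 * T' * (Num.trunc (`|MF| * T')).*2.+1%:R / (T' - T))).+1.
move=> M MM; eexists; split.
  exact: (spacing_gt (H := H) (MF := MF) (r := r) T0 TT' T'h MM).
move=> n u t a uT tT sep y yh.
exact: (grid_lower_bound N0 H01 h0 T0 TT' T'h E2 r0 rle MM a uT tT sep yh).
Qed.

End grid_sampling.

(** * From sampled values to integrals against the spectral measure *)

Section borel_rV.
Context {R : realType} {N : nat}.

Lemma measurable_open_rV (A : set 'rV[R]_N) : open A -> measurable (A : set (borelRV R N)).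
Proof. by move=> oA; apply: sub_sigma_algebra. Qed.

Lemma measurable_closed_rV (A : set 'rV[R]_N) : closed A -> measurable (A : set (borelRV R N)).
Proof.
move=> cA; rewrite -[A]setCK; apply: measurableC; apply: measurable_open_rV.
exact: closed_openC.
Qed.

Lemma measurable_continuous_rV (f : 'rV[R]_N -> R) : continuous f ->
  measurable_fun setT (f : borelRV R N -> R).
Proof.
move=> /continuousP cf; apply: (measurability _ (RGenOpens.measurableE R)).
move=> _ [_ [a [b ->] <-]]; rewrite setTI; apply: measurable_open_rV.
exact/cf/interval_open.
Qed.

Lemma compact_cube (l : 'rV[R]_N) (h : R) : compact (cube l h).
Proof.
have -> : cube l h = [set v | forall j, `[l 0 j - h, l 0 j + h]%classic (v ord0 j)].
  by apply/seteqP; split => v /= vh j; have := vh j; rewrite in_itv /= ler_distl.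
apply: (@rV_compact R N (fun j => `[l 0 j - h, l 0 j + h]%classic)) => j.
exact: segment_compact.
Qed.

Lemma measurable_cube (l : 'rV[R]_N) (h : R) : measurable (cube l h : set (borelRV R N)).
Proof.
apply: measurable_closed_rV; apply: (@compact_closed 'rV[R]_N); last exact: compact_cube.
exact: norm_hausdorff.
Qed.

Lemma continuous_sum_rV (I : Type) (s : seq I) (f : I -> 'rV[R]_N -> R) :
  (forall i, continuous (f i)) -> continuous (fun l => \sum_(i <- s) f i l).
Proof.
move=> cf; elim: s => [|i s IH].
  rewrite (_ : (fun l => _) = cst 0); first exact: cst_continuous.
  by apply/funext => l; rewrite big_nil.
rewrite (_ : (fun l => _) = (fun l => f i l + \sum_(i <- s) f i l)).
  by move=> l; exact: (cvgD (cf i l) (IH l)).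
by apply/funext => l; rewrite big_cons.
Qed.

Lemma continuous_edot (u : 'rV[R]_N) : continuous (edot u).
Proof.
apply: continuous_sum_rV => j l.
exact: (cvgM (@cst_continuous _ _ (u 0 j) l) (@coord_continuous R 1 N 0 j l)).
Qed.

Lemma Re_gval n u (t : 'I_n -> 'rV[R]_N) a l :
  complex.Re (gval u t a l) = cos (edot u l) - \sum_k a k * cos (edot (t k) l).
Proof.
rewrite /gval /=; case E: (\sum_k _) => [x y] /=; congr (_ - _).
have := congr1 (@complex.Re R) E; rewrite Re_sum /= => <-.
by apply: eq_bigr => k _; rewrite mul0r subr0.
Qed.

Lemma Im_gval n u (t : 'I_n -> 'rV[R]_N) a l :
  complex.Im (gval u t a l) = sin (edot u l) - \sum_k a k * sin (edot (t k) l).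
Proof.
rewrite /gval /=; case E: (\sum_k _) => [x y] /=; congr (_ - _).
have := congr1 (@complex.Im R) E; rewrite Im_sum /= => <-.
by apply: eq_bigr => k _; rewrite mul0r addr0.
Qed.

Lemma continuous_sqn_gval n u (t : 'I_n -> 'rV[R]_N) a :
  continuous (fun l => sqn (gval u t a l)).
Proof.
have ce (f : R -> R) v : continuous f -> continuous (fun l : 'rV[R]_N => f (edot v l)).
  by move=> cf l; apply: continuous_comp; [exact: continuous_edot|exact: cf].
have cs (f : R -> R) : continuous f ->
    continuous (fun l : 'rV[R]_N => f (edot u l) - \sum_k a k * f (edot (t k) l)).
  move=> cf l; apply: (cvgB (ce _ u cf l)); apply: continuous_sum_rV => k l'.
  exact: (cvgM (@cst_continuous _ _ (a k) l') (ce _ (t k) cf l')).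
pose D (f : R -> R) (l : 'rV[R]_N) := f (edot u l) - \sum_k a k * f (edot (t k) l).
rewrite (_ : (fun l => _) = (fun l => D cos l * D cos l + D sin l * D sin l)); last first.
  by apply/funext => l; rewrite /sqn Re_gval Im_gval !expr2.
move=> l; have h1 := cs _ (@continuous_cos R) l; have h2 := cs _ (@continuous_sin R) l.
exact: (cvgD (cvgM h1 h1) (cvgM h2 h2)).
Qed.

Section sampled_integral.
Variable F : {measure set (borelRV R N) -> \bar R}.

(** The integrand is at least its value at the node on each cube, and disjointness lets the cube
    contributions add up. *)
Lemma sampled_integral_le (I : finType) (P : pred I) (c : I -> 'rV[R]_N) (h : R)
    (w : I -> R) (f : 'rV[R]_N -> R) (y : I -> 'rV[R]_N) :
  continuous f -> (forall l, 0 <= f l) ->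
  (forall i, P i -> 0 <= w i) ->
  (forall i, P i -> ((w i)%:E <= F (cube (c i) h))%E) ->
  (forall i i', i != i' -> cube (c i) h `&` cube (c i') h = set0) ->
  (forall i l, cube (c i) h l -> f (y i) <= f l) ->
  ((\sum_(i | P i) w i * f (y i))%:E <= \int[F]_l (f l)%:E)%E.
Proof.
move=> cf f0 w0 wF disj ymin.
have mf : measurable_fun setT (EFin \o (f : borelRV R N -> R)).
  by apply/measurable_EFinP; exact: measurable_continuous_rV.
pose D := \big[setU/set0]_(i <- [seq i <- index_enum I | P i]) (cube (c i) h : set (borelRV R N)).
have mD : measurable D by apply: bigsetU_measurable => i _; exact: measurable_cube.
apply: (@le_trans _ _ (\int[F]_(l in D) (f l)%:E)%E); last first.
  by apply: ge0_subset_integral => // l _; rewrite lee_fin.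
rewrite ge0_integral_bigsetU//=; first last.
- by move=> l _; rewrite lee_fin.
- exact: measurable_funTS.
- apply/trivIsetP => i i' _ _ ii'; exact: disj.
- exact/filter_uniq/index_enum_uniq.
- by move=> i; exact: measurable_cube.
rewrite big_filter -sumEFin; apply: lee_sum => i Pi.
apply: (@le_trans _ _ (\int[F]_(l in cube (c i) h) (cst (f (y i))%:E) l)%E).
  rewrite integral_cst; last exact: measurable_cube.
  by rewrite mulrC EFinM lee_wpmul2l ?lee_fin//; exact: wF.
apply: ge0_le_integral => //=.
- exact: measurable_cube.
- by move=> l _; rewrite lee_fin.
- exact: measurable_funTS.
- by move=> l il; rewrite lee_fin; exact: ymin.
Qed.

Lemma cube_minimizer (l : 'rV[R]_N) (h : R) (f : 'rV[R]_N -> R) : 0 <= h -> continuous f ->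
  exists y, cube l h y /\ forall l', cube l h l' -> f y <= f l'.
Proof.
move=> h0 cf; have [||y] := @EVT_min_rV R N f (cube l h) _ (@compact_cube l h).
- by exists l => j; rewrite subrr normr0.
- exact: continuous_subspaceT.
rewrite inE => ly ymin; exists y; split => // l' l'h; apply: ymin.
by rewrite inE.
Qed.

Section lower_bound.
Variables (H : 'I_N -> R) (h T cF MF : R).
Hypothesis N_gt0 : (0 < N)%N.
Hypothesis H01 : forall j, 0 < H j < 1.
Hypothesis h_gt0 : 0 < h.
Hypothesis T_gt0 : 0 < T.
Hypothesis ThN : T * h * N%:R < ln 2.
Hypothesis cF_gt0 : 0 < cF.
Hypothesis F_ge : forall l, MF < enorm l ->
  (cF%:E <= (rho H 0 l `^ (homdim H + 2))%:E * F (cube l h))%E.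

Lemma rho_ge0 (s t : 'rV[R]_N) : 0 <= rho H s t.
Proof. by apply: sumr_ge0 => j _; exact: powR_ge0. Qed.

(** The nodes are minimisers of |g|^2 on the cubes. Their position is unknown, hence a sampling
    bound valid for every choice of nodes within h of the lattice. *)
Lemma spectral_grid_bound : exists T' c : R, [/\ T < T', 0 < c &
    forall r, 0 < r -> r <= N%:R * (1 + 2 * T) ->
    exists M0 : nat, forall M : nat, (M0 <= M)%N ->
    forall n (u : 'rV[int]_N) (t : 'I_n -> 'rV[int]_N) (a : 'I_n -> R),
    (forall j, `|gridpt (T' / M%:R) u 0 j| <= T) ->
    (forall k j, `|gridpt (T' / M%:R) (t k) 0 j| <= T) ->
    (forall k, r <= rho H (gridpt (T' / M%:R) u) (gridpt (T' / M%:R) (t k))) ->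
    ((c * r ^+ 2)%:E <= \int[F]_l
      (sqn (gval (gridpt (T' / M%:R) u) (fun k => gridpt (T' / M%:R) (t k)) a l))%:E)%E].
Proof.
have [T' [c [TT' c0 Hr]]] := @grid_sampling R N H h T MF N_gt0 H01 h_gt0 T_gt0 ThN.
exists T', (cF * c); split => //; first exact: mulr_gt0.
move=> r r0 rle; have [M0 HM] := Hr r r0 rle; exists M0 => M MM.
have [eta [heta Hn]] := HM M MM; move=> n u t a uT tT sep.
pose B := {ffun 'I_N -> 'I_M.*2.+1}.
pose lam (b : B) := gridpt eta (ctr b).
pose f l := sqn (gval (gridpt (T' / M%:R) u) (fun k => gridpt (T' / M%:R) (t k)) a l).
have cf : continuous f by exact: continuous_sqn_gval.
have f0 l : 0 <= f l by exact: sqn_ge0.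
have /choice [y yP] : forall b : B, exists y, cube (lam b) h y /\
    forall l', cube (lam b) h l' -> f y <= f l'.
  by move=> b; apply: cube_minimizer => //; exact: ltW.
have := Hn n u t a uT tT sep y (fun b => (yP b).1) => main.
have Qp0 : homdim H + 2 != 0.
  rewrite gt_eqF// ltr_wpDl// sumr_ge0// => j _.
  by rewrite invr_ge0 ltW//; case/andP: (H01 j).
apply: (@le_trans _ _ (\sum_(b : B | MF < enorm (lam b))
    (cF * (rho H 0 (lam b) `^ (homdim H + 2))^-1) * f (y b))%:E).
  rewrite lee_fin -mulrA; apply: le_trans (ler_wpM2l (ltW cF_gt0) main) _.
  rewrite mulr_sumr le_eqVlt; apply/orP; left; apply/eqP.
  by apply: eq_bigr => b _; rewrite mulrA.
apply: (@sampled_integral_le B _ lam h _ f y) => //.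
- by move=> b _; rewrite mulr_ge0 ?invr_ge0 ?powR_ge0 ?ltW.
- move=> b lb; have := F_ge lb; set w := rho _ _ _ `^ _ => hw.
  have w0 : 0 < w.
    rewrite lt_neqAle powR_ge0 andbT eq_sym; apply/eqP => w0.
    by move: hw; rewrite w0 mul0e lee_fin leNgt cF_gt0.
  by rewrite mulrC EFinM lee_pdivrMl.
- move=> b b' bb'; apply/seteqP; split => // l [/= lb lb'].
  have [j bj] : exists j, ctr b 0 j != ctr b' 0 j.
    apply/existsP; apply: contraR bb'; rewrite negb_exists => /forallP hb.
    by apply/eqP/(@ctr_inj N M)/rowP => j; have := hb j; rewrite negbK => /eqP.
  have : `|lam b 0 j - lam b' 0 j| <= 2 * h.
    have := lb j; have := lb' j; rewrite !ler_norml; lra.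
  have eta0 : 0 < eta by apply: lt_trans heta; rewrite mulr_gt0.
  have lamE i : lam i 0 j = eta * (ctr i 0 j)%:~R by rewrite mxE.
  rewrite !lamE -mulrBr -intrB normrM gtr0_norm// => close.
  have : 1 <= `|(ctr b 0 j - ctr b' 0 j)%:~R| :> R.
    by rewrite -intr_norm ler1z -gtz0_ge1 normr_gt0 subr_eq0.
  by rewrite -(ler_pM2l eta0) mulr1 => /le_trans/(_ close); rewrite leNgt heta.
- by move=> b l'; exact: (yP b).2.
Qed.

End lower_bound.
End sampled_integral.
End borel_rV.

(** * Integrals of finite linear combinations and of their squares *)

Section linear_combinations.
Context {d : measure_display} {T : measurableType d} {R : realType}.
Variables (mu : {measure set T -> \bar R}) (I : finType) (c : I -> R) (f : I -> T -> R).
Hypothesis fi : forall i, mu.-integrable setT (EFin \o f i).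

Lemma integrable_lincomb : mu.-integrable setT (EFin \o (fun x => \sum_i c i * f i x)).
Proof.
have -> : EFin \o (fun x => \sum_i c i * f i x) =
    (fun x => \sum_(i <- index_enum I | xpredT i) ((c i)%:E * (EFin \o f i) x))%E.
  by apply/funext => x; rewrite /= -sumEFin; apply: eq_bigr => i _; rewrite EFinM.
by apply: integrable_sum => // i _; apply: integrableZl => //; exact: fi.
Qed.

Lemma integral_lincomb : (\int[mu]_x (\sum_i c i * f i x)%:E =
  (\sum_i c i * \int[mu]_x (f i x))%:E)%E.
Proof.
under eq_integral do rewrite -sumEFin.
rewrite integral_sum//; last first.
  move=> i; under eq_fun do rewrite EFinM.
  by apply: integrableZl => //; exact: fi.
rewrite -sumEFin; apply: eq_bigr => i _.
under eq_integral do rewrite EFinM.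
rewrite integralZl//; last exact: fi.
rewrite EFinM; congr (_ * _)%E; rewrite /Rintegral fineK//.
by apply: integrable_fin_num => //; exact: fi.
Qed.

End linear_combinations.

Section quadratic_forms.
Context {d : measure_display} {T : measurableType d} {R : realType}.
Variables (mu : {measure set T -> \bar R}) (I : finType) (f : I -> T -> R).
Hypothesis fi : forall i j, mu.-integrable setT (EFin \o (fun x => f i x * f j x)).

Lemma integral_sqr_lincomb (c : I -> R) : (\int[mu]_x ((\sum_i c i * f i x) ^+ 2)%:E =
  (\sum_i \sum_j c i * c j * \int[mu]_x (f i x * f j x))%:E)%E.
Proof.
have E x : (\sum_i c i * f i x) ^+ 2 =
    \sum_(p : I * I) (c p.1 * c p.2) * (f p.1 x * f p.2 x).
  rewrite expr2 mulr_suml -(pair_bigA _ (fun i j => c i * c j * (f i x * f j x))) /=.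
  by apply: eq_bigr => i _; rewrite mulr_sumr; apply: eq_bigr => j _; ring.
under eq_integral do rewrite E.
rewrite (integral_lincomb (fun p : I * I => c p.1 * c p.2)
  (f := fun p x => f p.1 x * f p.2 x)); last by move=> p; exact: fi.
by rewrite -(pair_bigA _ (fun i j => c i * c j * \int[mu]_x (f i x * f j x))).
Qed.

End quadratic_forms.

(** * The metric [rho] and rounding to a grid *)

Section rho_metric.
Context {R : realType} {N : nat}.
Variables (H : 'I_N -> R).
Hypothesis H01 : forall j, 0 < H j < 1.

(** A fraction w in [0, 1] satisfies w <= w^s; apply this to x / (x + y) and y / (x + y), which add
    up to 1. *)
Lemma powR_subadd (x y s : R) : 0 <= x -> 0 <= y -> 0 <= s <= 1 ->
  (x + y) `^ s <= x `^ s + y `^ s.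
Proof.
move=> x0 y0 /andP[s0 s1].
have [xy0|xy0] := eqVneq (x + y) 0.
  have -> : x = 0 by lra.
  by rewrite add0r lerDr powR_ge0.
have z0 : 0 < x + y by rewrite lt_neqAle eq_sym xy0 addr_ge0.
have key a : 0 <= a -> a <= x + y -> a / (x + y) * (x + y) `^ s <= a `^ s.
  move=> a0 axy; have [->|an0] := eqVneq a 0; first by rewrite !mul0r powR_ge0.
  have apos : 0 < a by rewrite lt_neqAle eq_sym an0.
  have b1 : a / (x + y) <= 1 by rewrite ler_pdivrMr// mul1r.
  have b0 : 0 < a / (x + y) by rewrite divr_gt0.
  rewrite -[in leRHS](divfK xy0 a) powRM ?(ltW b0) ?(ltW z0)// ler_wpM2r ?powR_ge0//.
  rewrite -[leLHS]powRr1 ?(ltW b0)// -[X in _ `^ X <= _](subrKC s 1).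
  rewrite powRD ?(gt_eqF b0) ?implybT// ler_piMr ?powR_ge0//.
  by rewrite -[leRHS](pow1R (1 - s)) le_powR ?subr_ge0// ltW.
have xle : x <= x + y by rewrite lerDl.
have yle : y <= x + y by rewrite lerDr.
have := lerD (key x x0 xle) (key y y0 yle).
by rewrite -mulrDl -mulrDl divff// mul1r.
Qed.

Lemma rho_triangle (s t u : 'rV[R]_N) : rho H s u <= rho H s t + rho H t u.
Proof.
rewrite /rho -big_split /=; apply: ler_sum => j _.
case/andP: (H01 j) => H0 H1.
apply: le_trans (_ : (`|s 0 j - t 0 j| + `|t 0 j - u 0 j|) `^ H j <= _).
  apply: le_powR; [exact: ltW|by []|].
  by rewrite (le_trans _ (ler_normD _ _))// addrA subrK.
by apply: powR_subadd => //; rewrite !ltW.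
Qed.

Lemma rho_sym (s t : 'rV[R]_N) : rho H s t = rho H t s.
Proof. by apply: eq_bigr => j _; rewrite distrC. Qed.

Lemma rho_cube_le (T : R) (s t : 'rV[R]_N) : 0 <= T -> cube 0 T s -> cube 0 T t ->
  rho H s t <= N%:R * (1 + 2 * T).
Proof.
move=> T0 sT tT; rewrite -[N in N%:R]card_ord -sumr_const mulr_suml.
apply: ler_sum => j _; rewrite mul1r; case/andP: (H01 j) => H0 H1.
have hT : `|s 0 j - t 0 j| <= 2 * T.
  by have := sT j; have := tT j; rewrite !mxE !subr0 !ler_norml; lra.
apply: le_trans (_ : (1 + 2 * T) `^ H j <= _).
  by apply: le_powR; [exact: ltW|by []|lra].
by rewrite -[leRHS]powRr1; [apply: ler_powR; lra|lra].
Qed.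

End rho_metric.

Section grid_approximation.
Context {R : realType} {N : nat}.

(** Rounding is towards zero, so that rounded points remain in [cube 0 T]. *)
Definition zround (x : R) : int :=
  if 0 <= x then (Num.trunc x)%:Z else - (Num.trunc (- x))%:Z.

Lemma zround_le x : `|(zround x)%:~R| <= `|x| :> R.
Proof.
rewrite /zround; case: ifPn => [x0|]; last rewrite -ltNge => x0.
  by rewrite (ger0_norm x0) ger0_norm ?ler0z// -[leLHS]/((Num.trunc x)%:R) trunc_le.
rewrite mulrNz normrN (ltr0_norm x0) ger0_norm ?ler0z//.
by rewrite -[leLHS]/((Num.trunc (- x))%:R) trunc_le// oppr_ge0 ltW.
Qed.

Lemma zround_dist x : `|x - (zround x)%:~R| <= 1.
Proof.
rewrite /zround; case: ifPn => [x0|]; last rewrite -ltNge => x0.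
  rewrite -[_%:~R]/((Num.trunc x)%:R).
  have := truncnS_gt x; rewrite -natr1 => h1.
  have := trunc_le x0; rewrite ler_norml; lra.
rewrite mulrNz opprK -[_%:~R]/((Num.trunc (- x))%:R).
have := truncnS_gt (- x); rewrite -natr1 => h1.
have x0' : 0 <= - x by rewrite oppr_ge0 ltW.
have := trunc_le x0'; rewrite ler_norml; lra.
Qed.

Definition grid_round (theta : R) (u : 'rV[R]_N) : 'rV[int]_N := \row_j zround (u 0 j / theta).

Lemma grid_round_le (theta : R) (u : 'rV[R]_N) j : 0 < theta ->
  `|gridpt theta (grid_round theta u) 0 j| <= `|u 0 j|.
Proof.
move=> t0; rewrite !mxE normrM gtr0_norm// mulrC -ler_pdivlMr//.
by apply: (le_trans (zround_le _)); rewrite normrM [`|_^-1|]gtr0_norm ?invr_gt0.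
Qed.

Lemma grid_round_dist (theta : R) (u : 'rV[R]_N) j : 0 < theta ->
  `|u 0 j - gridpt theta (grid_round theta u) 0 j| <= theta.
Proof.
move=> t0; rewrite !mxE -{1}(divfK (lt0r_neq0 t0) (u 0 j)) mulrC -mulrBr normrM gtr0_norm//.
by rewrite -[leRHS]mulr1 ler_pM2l// zround_dist.
Qed.

Lemma cvg_grid_round (T' : R) (u : 'rV[R]_N) : 0 < T' ->
  gridpt (T' / M%:R) (grid_round (T' / M%:R) u) @[M --> \oo] --> u.
Proof.
move=> T'0; apply/cvgrPdist_le => e e0.
near=> M.
have M0 : 0 < M%:R :> R by near: M; exact: nbhs_infty_gtr.
have th0 : 0 < T' / M%:R by rewrite divr_gt0.
have : T' / M%:R <= e.
  by rewrite ler_pdivrMr// mulrC -ler_pdivrMr//; near: M; exact: nbhs_infty_ger.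
apply: le_trans; set x := (X in `|X| <= _).
rewrite -[leLHS]/(mx_norm x).
have [->|/mx_norm_neq0[[i j] /= ->]] := eqVneq (mx_norm x) 0; first exact: ltW.
rewrite /x (ord1 i) mxE [X in _ + X]mxE.
exact: grid_round_dist.
Unshelve. all: by end_near. Qed.

End grid_approximation.

(** * The spectral form of the covariance, and the lower bound on variances *)

Section spectral_kernel.
Context {R : realType} {N : nat}.
Implicit Types (s t l : 'rV[R]_N).

Definition skernel s t l : R :=
  (cos (edot s l) - 1) * (cos (edot t l) - 1) + sin (edot s l) * sin (edot t l).

Lemma skernelE s t l : complex.Re ((expi (edot s l) - 1) * (expi (- edot t l) - 1)) =
  skernel s t l.
Proof. by rewrite /expi cosN sinN /skernel /=; ring. Qed.

Lemma skernel_diag s l : skernel s s l = 2 * (1 - cos (edot s l)).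
Proof. by rewrite /skernel; have := cos2Dsin2 (edot s l); nra. Qed.

Lemma skernel_norm_le s t l : `|skernel s t l| <= skernel s s l + skernel t t l.
Proof.
rewrite /skernel; move: (cos _ - 1) (cos _ - 1) (sin _) (sin _) => x y z w.
rewrite ler_norml; apply/andP; split.
  have := sqr_ge0 (x + y); have := sqr_ge0 (z + w); have := sqr_ge0 x.
  by have := sqr_ge0 y; have := sqr_ge0 z; have := sqr_ge0 w; lra.
have := sqr_ge0 (x - y); have := sqr_ge0 (z - w); have := sqr_ge0 x.
by have := sqr_ge0 y; have := sqr_ge0 z; have := sqr_ge0 w; lra.
Qed.

Lemma enorm_sqr l : enorm l ^+ 2 = \sum_j l 0 j ^+ 2.
Proof.
rewrite /enorm sqr_sqrtr /edot; first by apply: eq_bigr => j _; rewrite expr2.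
by apply: sumr_ge0 => j _; rewrite -expr2 sqr_ge0.
Qed.

Lemma enorm_ge0 l : 0 <= enorm l. Proof. exact: sqrtr_ge0. Qed.

Lemma edot_sqr_le s l : edot s l ^+ 2 <= N%:R * enorm s ^+ 2 * enorm l ^+ 2.
Proof.
have := sqn_sum_le (enum 'I_N) (fun j => (s 0 j * l 0 j)%:C%C).
rewrite -rmorph_sum /= sqn_real size_enum_ord.
under [X in _ <= _ * X]eq_bigr do rewrite sqn_real exprMn.
rewrite big_enum /= => h; apply: (le_trans h) => {h}.
rewrite big_enum /= -mulrA ler_wpM2l// [X in _ <= _ * X]enorm_sqr mulr_sumr.
apply: ler_sum => j _; rewrite ler_wpM2r ?sqr_ge0// enorm_sqr (bigD1 j)//= lerDl.
by apply: sumr_ge0 => i _; exact: sqr_ge0.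
Qed.

(** 1 - cos x is at most 2 and at most x^2 / 2, so the kernel is dominated by the weight whose
    [F]-integral is finite. *)
Lemma skernel_diag_le s l :
  skernel s s l <= (4 + N%:R * enorm s ^+ 2) * (enorm l ^+ 2 / (1 + enorm l ^+ 2)).
Proof.
rewrite skernel_diag; have h1 := one_minus_cos_le (edot s l).
have h2 := edot_sqr_le s l; have h3 := cos_geN1 (edot s l).
have l0 := sqr_ge0 (enorm l); set m := enorm l ^+ 2 in h2 l0 *.
set k := N%:R * _ in h2 *.
have k0 : 0 <= k by rewrite mulr_ge0 ?sqr_ge0.
rewrite mulrA ler_pdivlMr; last by rewrite ltr_pwDl.
set x := 1 - cos _ in h1 *.
have x0 : 0 <= x by rewrite subr_ge0 cos_le1.
have x2 : x <= 2 by rewrite /x; lra.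
have xk : 2 * x <= k * m by lra.
have : x * m <= 2 * m by rewrite ler_wpM2r.
lra.
Qed.

Lemma continuous_skernel s t : continuous (skernel s t).
Proof.
have ce (f : R -> R) v : continuous f -> continuous (fun l : 'rV[R]_N => f (edot v l)).
  by move=> cf l; apply: continuous_comp; [exact: continuous_edot|exact: cf].
have cc v : continuous (fun l : 'rV[R]_N => cos (edot v l) - 1).
  move=> l; exact: (cvgB (ce _ v (@continuous_cos R) l) (@cst_continuous _ _ (1 : R) l)).
have cs v : continuous (fun l : 'rV[R]_N => sin (edot v l)) by apply: ce; exact: continuous_sin.
move=> l; exact: (cvgD (cvgM (cc s l) (cc t l)) (cvgM (cs s l) (cs t l))).
Qed.

Lemma continuous_enorm_sqr : continuous (fun l : 'rV[R]_N => enorm l ^+ 2).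
Proof.
rewrite (_ : (fun l => _) = (fun l : 'rV[R]_N => \sum_j l 0 j * l 0 j)); last first.
  by apply/funext => l; rewrite enorm_sqr; apply: eq_bigr => j _; rewrite expr2.
apply: continuous_sum_rV => j l.
exact: (cvgM (@coord_continuous R 1 N 0 j l) (@coord_continuous R 1 N 0 j l)).
Qed.

End spectral_kernel.

Section spectral_covariance.
Context {R : realType} {N : nat} {d : measure_display} {Omega : measurableType d}.
Variables (P : probability Omega R) (X : 'rV[R]_N -> {RV P >-> R}).
Variable F : {measure set (borelRV R N) -> \bar R}.
Hypothesis XF : spectral_measure X F.

Let levy (l : 'rV[R]_N) : R := enorm l ^+ 2 / (1 + enorm l ^+ 2).

Lemma levy_ge0 l : 0 <= levy l.
Proof. by rewrite divr_ge0 ?addr_ge0 ?sqr_ge0. Qed.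

Lemma levy_integrable : F.-integrable setT (EFin \o (levy : borelRV R N -> R)).
Proof.
case: XF => _ _ lty _; apply/integrableP; split.
  apply/measurable_EFinP; apply: measurable_continuous_rV => l.
  have cm := @continuous_enorm_sqr R N l.
  apply: (cvgM cm); apply: cvgV; first by rewrite gt_eqF// ltr_pwDl ?sqr_ge0.
  exact: (cvgD (@cst_continuous _ _ (1 : R) l) cm).
by under eq_integral do rewrite /= ger0_norm ?levy_ge0//.
Qed.

Lemma skernel_integrable s t : F.-integrable setT (EFin \o (skernel s t : borelRV R N -> R)).
Proof.
pose k := (4 + N%:R * enorm s ^+ 2) + (4 + N%:R * enorm t ^+ 2).
apply: (@le_integrable _ _ _ _ _ _ _ (fun l : borelRV R N => k%:E * (levy l)%:E)%E) => //.
- by apply/measurable_EFinP; apply: measurable_continuous_rV; exact: continuous_skernel.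
- move=> l _; rewrite -EFinM lee_fin; apply: (le_trans (skernel_norm_le s t l)).
  rewrite (le_trans _ (ler_norm _))// /k mulrDl.
  by apply: lerD; exact: skernel_diag_le.
- by apply: integrableZl => //; exact: levy_integrable.
Qed.

Lemma covariance_spectral s t :
  covariance_function X s t = \int[F]_l (skernel s t l).
Proof.
case: XF => _ _ _ /(_ s t) /(congr1 (@complex.Re R)) /= ->.
by apply: eq_Rintegral => l _; exact: skernelE.
Qed.

(** The variance of sum_i b_i X(p_i) for a centred square-integrable field, written in the
    covariance so that it is visibly continuous in the points and is also a spectral integral. *)
Definition qform (n : nat) (b : 'I_n -> R) (p : 'I_n -> 'rV[R]_N) : R :=
  \sum_i \sum_j b i * b j * covariance_function X (p i) (p j).

Lemma qform_spectral n (b : 'I_n -> R) (p : 'I_n -> 'rV[R]_N) :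
  ((qform b p)%:E = \int[F]_l ((\sum_i b i * (cos (edot (p i) l) - 1)) ^+ 2 +
    (\sum_i b i * sin (edot (p i) l)) ^+ 2)%:E)%E.
Proof.
have E l : (\sum_i b i * (cos (edot (p i) l) - 1)) ^+ 2 +
    (\sum_i b i * sin (edot (p i) l)) ^+ 2 =
    \sum_(ij : 'I_n * 'I_n) (b ij.1 * b ij.2) * skernel (p ij.1) (p ij.2) l.
  rewrite -(pair_bigA _ (fun i j => b i * b j * skernel (p i) (p j) l)) /=.
  rewrite !expr2 !mulr_suml -big_split /=; apply: eq_bigr => i _.
  rewrite !mulr_sumr -big_split /=; apply: eq_bigr => j _.
  by rewrite /skernel; ring.
under eq_integral do rewrite E.
rewrite (integral_lincomb (mu := F) (fun ij : 'I_n * 'I_n => b ij.1 * b ij.2)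
  (f := fun ij l => skernel (p ij.1) (p ij.2) l)); last first.
  by move=> ij; exact: skernel_integrable.
rewrite -(pair_bigA _ (fun i j => b i * b j * \int[F]_l (skernel (p i) (p j) l))) /=.
congr EFin; apply: eq_bigr => i _; apply: eq_bigr => j _.
by rewrite covariance_spectral.
Qed.

(** The constants -1 of the spectral kernel cancel because the b_i sum to zero. *)
Lemma qform_gval n (b : 'I_n.+1 -> R) (p : 'I_n.+1 -> 'rV[R]_N) :
  b ord0 = 1 -> \sum_i b i = 0 ->
  ((qform b p)%:E = \int[F]_l
    (sqn (gval (p ord0) (fun k => p (lift ord0 k)) (fun k => - b (lift ord0 k)) l))%:E)%E.
Proof.
move=> b0 bsum; rewrite qform_spectral; apply: eq_integral => l _; congr EFin.
rewrite /sqn Re_gval Im_gval; congr (_ ^+ 2 + _ ^+ 2).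
  have -> : \sum_i b i * (cos (edot (p i) l) - 1) = \sum_i b i * cos (edot (p i) l).
    under eq_bigr do rewrite mulrBr mulr1.
    by rewrite sumrB bsum subr0.
  rewrite big_ord_recl b0 mul1r; congr (_ + _); rewrite -sumrN.
  by apply: eq_bigr => k _; rewrite mulNr opprK.
rewrite big_ord_recl b0 mul1r; congr (_ + _); rewrite -sumrN.
by apply: eq_bigr => k _; rewrite mulNr opprK.
Qed.

Hypothesis Xcont : continuous_covariance X.

Lemma cvg_qform n (b : 'I_n -> R) (p_ : nat -> 'I_n -> 'rV[R]_N) (p : 'I_n -> 'rV[R]_N) :
  (forall i, p_ m i @[m --> \oo] --> p i) -> qform b (p_ m) @[m --> \oo] --> qform b p.
Proof.
move=> pc; apply: cvg_big; first exact: add_continuous.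
move=> i _; apply: cvg_big; first exact: add_continuous.
move=> j _; apply: cvgM; first exact: cvg_cst.
have cc : {for (p i, p j), continuous (fun st : 'rV[R]_N * 'rV[R]_N =>
  covariance_function X st.1 st.2)} by exact: Xcont.
have pp : (p_ m i, p_ m j) @[m --> \oo] --> (p i, p j) by exact: (cvg_pair (pc i) (pc j)).
exact: (cvg_comp _ _ pp cc).
Qed.

Section slnd.
Variables (H : 'I_N -> R) (h T cF MF : R).
Hypothesis N_gt0 : (0 < N)%N.
Hypothesis H01 : forall j, 0 < H j < 1.
Hypothesis h_gt0 : 0 < h.
Hypothesis T_gt0 : 0 < T.
Hypothesis ThN : T * h * N%:R < ln 2.
Hypothesis cF_gt0 : 0 < cF.
Hypothesis F_ge : forall l, MF < enorm l ->
  (cF%:E <= (rho H 0 l `^ (homdim H + 2))%:E * F (cube l h))%E.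

(** Apply the grid bound to rounded points and let the mesh tend to 0. Rounding moves each point by
    at most r / 4 in [rho], so a separation r / 2 survives, and its square accounts for the factor
    4. *)
Lemma qform_lower_bound : exists2 c : R, 0 < c &
  forall n (b : 'I_n.+1 -> R) (p : 'I_n.+1 -> 'rV[R]_N) r,
    b ord0 = 1 -> \sum_i b i = 0 -> (forall i, cube 0 T (p i)) ->
    0 <= r -> (forall k, r <= rho H (p ord0) (p (lift ord0 k))) ->
    c * r ^+ 2 <= qform b p.
Proof.
have [T' [c [TT' c0 Hc]]] := spectral_grid_bound N_gt0 H01 h_gt0 T_gt0 ThN cF_gt0 F_ge.
have T'0 : 0 < T' by exact: lt_trans TT'.
exists (c / 4); first by rewrite divr_gt0.
move=> n b p r b0 bsum pT r_ge0 rp.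
have [->|rn0] := eqVneq r 0.
  rewrite expr0n mulr0 -lee_fin qform_spectral; apply: integral_ge0 => l _.
  by rewrite lee_fin addr_ge0 ?sqr_ge0.
have r0 : 0 < r by rewrite lt_neqAle eq_sym rn0.
have NR : 0 < N%:R :> R by rewrite ltr0n.
(* With no further point the single coefficient 1 cannot sum to zero. *)
case: n b p b0 bsum pT rp => [|n] b p b0 bsum pT rp.
  by move: bsum; rewrite big_ord1 b0 => /eqP; rewrite oner_eq0.
have rle : r / 2 <= N%:R * (1 + 2 * T).
  apply: le_trans (rho_cube_le H01 (ltW T_gt0) (pT ord0) (pT (lift ord0 ord0))).
  by apply: le_trans (rp ord0); rewrite ler_pdivrMr// ler_peMr ?ltW//; lra.
have [M0 HM] := Hc (r / 2) (divr_gt0 r0 (ltr0Sn _ 1)) rle.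
(* A mesh at most s^Q displaces coordinate j by at most s^(Q H_j) <= s in [rho], since Q H_j >= 1
   and s <= 1; in total this is N s <= r / 4. *)
pose s := Num.min 1 (r / (4 * N%:R)).
have s0 : 0 < s by rewrite lt_min ltr01 divr_gt0// mulr_gt0.
have s1 : s <= 1 by rewrite ge_min lexx.
have sr : s <= r / (4 * N%:R) by rewrite ge_min lexx orbT.
pose p_ M i := gridpt (T' / M%:R) (grid_round (T' / M%:R) (p i)).
have pc i : p_ M i @[M --> \oo] --> p i by exact: cvg_grid_round.
have qc := @cvg_qform _ b _ _ pc.
rewrite -(cvg_lim _ qc)//; apply: limr_ge; first by apply/cvg_ex; eexists; exact: qc.
near=> M.
have MR0 : 0 < M%:R :> R by near: M; exact: nbhs_infty_gtr.
have th0 : 0 < T' / M%:R by rewrite divr_gt0.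
have ths : T' / M%:R <= s `^ homdim H.
  rewrite ler_pdivrMr// mulrC -ler_pdivrMr ?powR_gt0//; near: M; exact: nbhs_infty_ger.
have close i : rho H (p i) (p_ M i) <= r / 4.
  apply: le_trans (_ : N%:R * s <= _); last first.
    by apply: le_trans (ler_wpM2l (ltW NR) sr) _; rewrite le_eqVlt; apply/orP; left;
      apply/eqP; field; rewrite gt_eqF.
  rewrite -[N in N%:R]card_ord -sumr_const mulr_suml; apply: ler_sum => j _.
  rewrite mul1r; case/andP: (H01 j) => H0 H1.
  apply: le_trans (_ : (s `^ homdim H) `^ H j <= _).
    by apply: le_powR; [exact: ltW|by []|exact: le_trans (grid_round_dist _ _ th0) ths].
  rewrite -powRrM; apply: powR_le_self; first by rewrite s0.
  rewrite /homdim mulr_suml (bigD1 j)//= mulVf ?gt_eqF// lerDl sumr_ge0// => i' _.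
  by rewrite mulr_ge0 ?invr_ge0 ?ltW//; case/andP: (H01 i').
have sep k : r / 2 <= rho H (p_ M ord0) (p_ M (lift ord0 k)).
  have := rho_triangle H01 (p ord0) (p_ M ord0) (p (lift ord0 k)).
  have := rho_triangle H01 (p_ M ord0) (p_ M (lift ord0 k)) (p (lift ord0 k)).
  have := close ord0; have := close (lift ord0 k); rewrite rho_sym.
  have := rp k; lra.
have gT i j : `|p_ M i 0 j| <= T.
  by apply: le_trans (grid_round_le _ _ th0) _; have := pT i j; rewrite mxE subr0.
have MM : (M0 <= M)%N by near: M; exact: nbhs_infty_ge.
have := HM M MM n.+1 (grid_round (T' / M%:R) (p ord0))
  (fun k => grid_round (T' / M%:R) (p (lift ord0 k))) (fun k => - b (lift ord0 k))
  (gT ord0) (fun k => gT (lift ord0 k)) sep.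
rewrite -(qform_gval (p_ M) b0 bsum) lee_fin; apply: le_trans.
by rewrite le_eqVlt; apply/orP; left; apply/eqP; field.
Unshelve. all: by end_near. Qed.

End slnd.
End spectral_covariance.

(** * The tail of the spectral measure *)

Section spectral_tail.
Context {R : realType} {N : nat}.
Variable F : {measure set (borelRV R N) -> \bar R}.
Variables (H : 'I_N -> R) (h CF MF : R).
Hypothesis H01 : forall j, 0 < H j < 1.
Hypothesis h_gt0 : 0 < h.
Hypothesis CF_ge0 : 0 <= CF.
Hypothesis F_le : forall l, MF < enorm l ->
  ((rho H 0 l `^ (homdim H + 2))%:E * F (cube l h) <= CF%:E)%E.

Let H0 j : 0 < H j. Proof. by case/andP: (H01 j). Qed.

Lemma measurable_rho : measurable_fun setT (rho H 0 : borelRV R N -> R).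
Proof.
apply: measurable_sum => j; apply: (measurableT_comp (@measurable_powR R (H j))).
apply: measurableT_comp => //; apply: measurable_funB => //.
by apply: measurable_continuous_rV; exact: coord_continuous.
Qed.

Let measurable_shell (D : set R) : measurable D ->
  measurable ([set l | D (rho H 0 l)] : set (borelRV R N)).
Proof. by move=> mD; rewrite -[X in measurable X]setTI; exact: measurable_rho. Qed.

Lemma measure_cover_le (I : Type) (s : seq I) (B : I -> set (borelRV R N)) :
  (forall i, measurable (B i)) ->
  (F (\big[setU/set0]_(i <- s) B i) <= \sum_(i <- s) F (B i))%E.
Proof.
move=> mB; elim: s => [|i s IH]; first by rewrite !big_nil measure0.
rewrite !big_cons; apply: le_trans.
  by apply: measureU2 => //; exact: bigsetU_measurable.
by rewrite leeD2l.
Qed.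

(** For S >= R0, a cube of half-side h has [rho]-radius at most S / 2, and points with [rho] at
    least S / 2 have norm above [MF]. *)
Let R0 : R := 1 + 2 * (N%:R * (1 + 2 * h)) + 2 * (N%:R * (1 + 2 * `|MF|)).

Let R0_ge1 : 1 <= R0.
Proof.
have h1 : 0 <= N%:R * (1 + 2 * h) by rewrite mulr_ge0// addr_ge0// mulr_ge0// ltW.
have h2 : 0 <= N%:R * (1 + 2 * `|MF|) by rewrite mulr_ge0// addr_ge0// mulr_ge0.
rewrite /R0; lra.
Qed.

Lemma rho_coord_le (l : 'rV[R]_N) (S : R) j : rho H 0 l <= S -> `|l 0 j| <= S `^ (H j)^-1.
Proof.
move=> lS; have h1 : `|l 0 j| `^ H j <= S.
  apply: le_trans lS; rewrite /rho (bigD1 j)//= mxE sub0r normrN lerDl.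
  by apply: sumr_ge0 => i _; exact: powR_ge0.
rewrite -[leLHS](powRr1 (normr_ge0 _)) -(@mulfV _ (H j)) ?gt_eqF// powRrM.
by apply: le_powR => //; rewrite ?invr_ge0 ?ltW ?powR_ge0.
Qed.

Let cover_const : R := CF * \prod_j (2 `^ (H j)^-1 / h + 1) * 2 `^ (homdim H + 2).

Let cover_const_ge0 : 0 <= cover_const.
Proof.
rewrite /cover_const mulr_ge0 ?powR_ge0// mulr_ge0//; apply: prodr_ge0 => j _.
by rewrite addr_ge0// divr_ge0 ?powR_ge0// ltW.
Qed.

(** The shell lies in a box of half-sides (2S)^(1/H_j), which a constant times S^Q cubes of
    half-side h cover. Those meeting the shell have centres with [rho] at least S / 2, hence mass at
    most CF (S/2)^(-(Q+2)); the total is of order S^(-2). *)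
Lemma shell_measure_le (S : R) : R0 <= S ->
  (F [set l | (S < rho H 0 l <= 2 * S)%R] <= (cover_const * (S ^+ 2)^-1)%:E)%E.
Proof.
move=> R0S; have S1 : 1 <= S by exact: le_trans R0S.
have Sgt0 : 0 < S by exact: lt_le_trans S1.
have [hS1 hS2] : N%:R * (1 + 2 * h) <= S / 2 /\ N%:R * (1 + 2 * `|MF|) < S / 2.
  have h1 : 0 <= N%:R * (1 + 2 * h) by rewrite mulr_ge0// addr_ge0// mulr_ge0// ltW.
  have h2 : 0 <= N%:R * (1 + 2 * `|MF|) by rewrite mulr_ge0// addr_ge0// mulr_ge0.
  by move: R0S; rewrite /R0 => ?; split; lra.
pose A j := (2 * S) `^ (H j)^-1.
have A0 j : 0 <= A j by exact: powR_ge0.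
pose m j := (Num.trunc (A j / h)).+1.
pose M := (\sum_j m j)%N.
have mM j : (m j <= M)%N by rewrite /M (bigD1 j)//= leq_addr.
(* Centres start at -A_j + h and advance by 2 h. All directions share the index type of size [M];
   [Pf] keeps the first m_j indices of direction j and only centres with [rho] at least S / 2. *)
pose c (f : {ffun 'I_N -> 'I_M}) : 'rV[R]_N := \row_j (- A j + h + 2 * h * (f j)%:R).
pose Pf (f : {ffun 'I_N -> 'I_M}) := [forall j, (f j < m j)%N] && (S / 2 <= rho H 0 (c f)).
pose B f := if Pf f then (cube (c f) h : set (borelRV R N)) else set0.
have mB f : measurable (B f) by rewrite /B; case: ifP => // _; exact: measurable_cube.
have mshell : measurable ([set l | S < rho H 0 l <= 2 * S] : set (borelRV R N)).
  have := @measurable_shell `]S, 2 * S]%classic (measurable_itv _).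
  by congr measurable; apply/seteqP; split => l /=; rewrite in_itv.
apply: (@le_trans _ _ (F (\big[setU/set0]_(f <- index_enum {ffun 'I_N -> 'I_M}) B f))).
  apply: le_measure; rewrite ?inE//; first exact: bigsetU_measurable.
  move=> x /= /andP[xS x2S].
  have xA j : `|x 0 j| <= A j by exact: rho_coord_le.
  have y0 j : 0 <= (x 0 j + A j) / (2 * h).
    rewrite divr_ge0//; last by rewrite mulr_ge0// ltW.
    by have := xA j; rewrite ler_norml; lra.
  pose k j := Num.trunc ((x 0 j + A j) / (2 * h)).
  have km j : (k j < m j)%N.
    rewrite ltnS; apply: le_truncn; rewrite ler_pdivrMr ?mulr_gt0// mulrCA divfK ?gt_eqF//.
    by have := xA j; rewrite ler_norml; lra.
  have kM j : (k j < M)%N by exact: leq_trans (km j) (mM j).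
  pose f : {ffun 'I_N -> 'I_M} := [ffun j => Ordinal (kM j)].
  have xc : cube (c f) h x.
    move=> j; rewrite !mxE ffunE /=.
    have := trunc_le (y0 j); have := truncnS_gt ((x 0 j + A j) / (2 * h)); rewrite -/(k j) -natr1.
    rewrite ltr_pdivrMr ?mulr_gt0// ler_pdivlMr ?mulr_gt0// => h1 h2.
    by rewrite ler_distl; apply/andP; split; lra.
  have Pff : Pf f.
    apply/andP; split; first by apply/forallP => j; rewrite ffunE /=.
    have tr := rho_triangle H01 0 (c f) x.
    have h1 : rho H (c f) x <= N%:R * (1 + 2 * h).
      have -> : rho H (c f) x = rho H 0 (x - c f).
        by apply: eq_bigr => j _; rewrite !mxE sub0r normrN distrC.
      apply: rho_cube_le => //; first exact: ltW.
        by move=> j; rewrite mxE subrr normr0 ltW.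
      move=> j; have := xc j; rewrite !mxE.      by move=> hj; apply: le_trans hj; rewrite [X in `|X| <= _]subr0.
    by move: tr xS h1 hS1; lra.
  rewrite -bigcup_seq; exists f; first by rewrite /= mem_index_enum.
  by rewrite /B Pff.
apply: (le_trans (measure_cover_le _ mB)).
pose K := CF * (S / 2) `^ (- (homdim H + 2)).
have K0 : 0 <= K by rewrite mulr_ge0// powR_ge0.
have FB f : (F (B f) <= (K * \prod_j (f j < m j)%N%:R)%:E)%E.
  rewrite /B; case: ifPn => [/andP[/forallP fm Sc]|_]; last first.
    by rewrite measure0 lee_fin mulr_ge0// prodr_ge0.
  have -> : \prod_j (f j < m j)%N%:R = 1 :> R by rewrite big1// => j _; rewrite fm.
  have cM : MF < enorm (c f).
    rewrite ltNge; apply/negP => cM; move: Sc; apply/negP; rewrite -ltNge.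
    apply: le_lt_trans hS2; apply: rho_cube_le => //.
      by move=> j; rewrite mxE subrr normr0.
    move=> j; rewrite [X in _ - X]mxE subr0 (le_trans (enorm_ge _ j))//.
    by rewrite (le_trans cM)// ler_norm.
  have S20 : 0 < S / 2 by rewrite divr_gt0.
  have rho0 : 0 < rho H 0 (c f) by exact: lt_le_trans Sc.
  have p0 : 0 < rho H 0 (c f) `^ (homdim H + 2) by rewrite powR_gt0.
  have hQ : 0 <= homdim H + 2.
    by rewrite addr_ge0// sumr_ge0// => j _; rewrite invr_ge0 ltW.
  rewrite mulr1; apply: (@le_trans _ _ ((rho H 0 (c f) `^ (homdim H + 2))^-1%:E * CF%:E)%E).
    by rewrite lee_pdivlMl//; exact: F_le.
  rewrite -EFinM lee_fin /K mulrC ler_wpM2l// powRN lef_pV2 ?posrE ?powR_gt0//.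
  by apply: le_powR => //; exact: ltW.
apply: (@le_trans _ _ (\sum_(f : {ffun 'I_N -> 'I_M}) (K * \prod_j (f j < m j)%N%:R)%:E)%E).
  by apply: lee_sum => f _; exact: FB.
rewrite sumEFin lee_fin -mulr_sumr -(bigA_distr_bigA (fun j (i : 'I_M) => (i < m j)%N%:R)).
have sm j : \sum_(i < M) (i < m j)%N%:R = (m j)%:R :> R.
  rewrite -natr_sum; congr _%:R; rewrite -[RHS]card_ord -sum1_card.
  rewrite (big_ord_widen M (fun=> 1%N) (mM j)) [RHS]big_mkcond.
  by apply: eq_bigr => i _; case: (i < m j)%N.
under eq_bigr do rewrite sm.
have S0 : 0 <= S by exact: ltW.
have mle j : (m j)%:R <= (2 `^ (H j)^-1 / h + 1) * S `^ (H j)^-1.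
  have := trunc_le (divr_ge0 (A0 j) (ltW h_gt0)); rewrite /m -natr1 {2}/A powRM//.
  have : 1 <= S `^ (H j)^-1.
    by rewrite -(pow1R (H j)^-1); apply: le_powR => //; rewrite invr_ge0 ltW.
  rewrite mulrDl mul1r [in X in _ -> X -> _]mulrAC; lra.
apply: (@le_trans _ _ (K * \prod_j ((2 `^ (H j)^-1 / h + 1) * S `^ (H j)^-1))).
  by rewrite ler_wpM2l//; apply: ler_prod => j _; rewrite ler0n mle.
rewrite big_split /= prod_powR// -/(homdim H) /K /cover_const.
rewrite powRN powRM ?invr_ge0//.
have -> : S `^ (homdim H + 2) = S `^ homdim H * S ^+ 2.
  by rewrite powRD ?(gt_eqF Sgt0) ?implybT// -powR_mulrn.
have -> : 2^-1 `^ (homdim H + 2) = (2 `^ (homdim H + 2))^-1 :> R.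
  by rewrite -powR_inv1// -powRrM mulN1r powRN.
have p1 : 0 < S `^ homdim H by rewrite powR_gt0.
have p2 : 0 < 2 `^ (homdim H + 2) :> R by rewrite powR_gt0.
rewrite le_eqVlt; apply/orP; left; apply/eqP; field.
by rewrite !gt_eqF.
Qed.

(** The shells at 2^k S form a geometric series of ratio 1/4 with sum 4/3, rounded up to 2;
    continuity of the measure along increasing sets gives the whole tail. *)
Lemma tail_measure_le (S : R) : R0 <= S ->
  (F [set l | (S < rho H 0 l)%R] <= (2 * cover_const * (S ^+ 2)^-1)%:E)%E.
Proof.
move=> R0S; have Sgt0 : 0 < S by apply: lt_le_trans R0S; exact: lt_le_trans R0_ge1.
pose U K : set (borelRV R N) := [set l | S < rho H 0 l <= 2 ^+ K * S].
have mI a b : measurable ([set l | a < rho H 0 l <= b] : set (borelRV R N)).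
  have := @measurable_shell `]a, b]%classic (measurable_itv _).
  by congr measurable; apply/seteqP; split => l /=; rewrite in_itv.
set q := cover_const * (S ^+ 2)^-1.
have q0 : 0 <= q by rewrite mulr_ge0// invr_ge0 sqr_ge0.
have FU K : (F (U K) <= (4 / 3 * q * (1 - (4 ^+ K)^-1))%:E)%E.
  elim: K => [|K IH].
    rewrite expr0 invr1 subrr mulr0 (_ : U 0%N = set0) ?measure0//.
    apply/seteqP; split => l //=; rewrite /U /= expr0 mul1r => /andP[h1 h2].
    by have := lt_le_trans h1 h2; rewrite ltxx.
  have p1 : 1 <= 2 ^+ K :> R by rewrite -natrX ler1n expn_gt0.
  have US : U K.+1 = U K `|` [set l | 2 ^+ K * S < rho H 0 l <= 2 * (2 ^+ K * S)].
    apply/seteqP; split => l /=; rewrite /U /= exprS -mulrA.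
      move=> /andP[h1 h2]; have [h3|h3] := leP (rho H 0 l) (2 ^+ K * S); [left|right].
        by rewrite h1.
      by rewrite h2.
    move=> [/andP[h1 h2]|/andP[h1 h2]]; apply/andP; split => //.
      have : 0 <= 2 ^+ K * S by rewrite mulr_ge0 ?ltW ?exprn_gt0.
      by move: h2; lra.
    by apply: le_lt_trans h1; rewrite ler_peMl// ltW.
  rewrite US; apply: le_trans; first by apply: measureU2; exact: mI.
  have h1 : R0 <= 2 ^+ K * S by apply: (le_trans R0S); rewrite ler_peMl// ltW.
  apply: le_trans (leeD IH (shell_measure_le h1)) _.
  rewrite -EFinD lee_fin exprMn invfM -exprM mulnC exprM (_ : 2 ^+ 2 = 4); last by rewrite -natrX.
  rewrite mulrCA -/q [4 ^+ K.+1]exprS (invfM 4 (4 ^+ K)); move: (_ ^- K) => z.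
  by rewrite le_eqVlt; apply/orP; left; apply/eqP; field; rewrite gt_eqF.
have UU : \bigcup_K U K = [set l | S < rho H 0 l].
  apply/seteqP; split => [l [K _] /= /andP[]//|l /= h1].
  have l0 : 0 < rho H 0 l by exact: lt_trans h1.
  exists (Num.trunc (rho H 0 l / S)).+1 => //; rewrite /U /= h1 /=.
  rewrite -ler_pdivrMr//; apply: (@le_trans _ _ (Num.trunc (rho H 0 l / S)).+1%:R).
    by apply: ltW; exact: truncnS_gt.
  by rewrite -natrX ler_nat; apply: ltnW; exact: ltn_expl.
have mUU : measurable (\bigcup_K U K) by apply: bigcupT_measurable => K; exact: mI.
have ndU : nondecreasing_seq U.
  apply/nondecreasing_seqP => K; apply/subsetPset => l; rewrite /U /= => /andP[-> h2] /=.
  apply: (le_trans h2); rewrite ler_wpM2r ?(ltW Sgt0)// exprS ler_peMl ?exprn_ge0// ler1n//.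
have cU : (F (U K) @[K --> \oo] --> F (\bigcup_K U K))%E.
  by apply: nondecreasing_cvg_mu => // K; exact: mI.
rewrite -UU -(cvg_lim _ cU)//; apply: lime_le; first by apply/cvg_ex; eexists; exact: cU.
apply: nearW => K; apply: (le_trans (FU K)); rewrite lee_fin.
have -> : 2 * cover_const * (S ^+ 2)^-1 = 2 * q by rewrite -mulrA.
have : 0 <= (4 ^+ K)^-1 :> R by rewrite invr_ge0 exprn_ge0.
by move: ((4 ^+ K)^-1) => z z0; nra.
Qed.

Lemma tail_measure_bound : exists C S0 : R, [/\ 0 <= C, 1 <= S0 &
  forall S, S0 <= S -> (F [set l | (S < rho H 0 l)%R] <= (C * (S ^+ 2)^-1)%:E)%E].
Proof.
exists (2 * cover_const), R0; split=> //; first exact: mulr_ge0.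
exact: tail_measure_le.
Qed.

End spectral_tail.

(** * The upper bound on the variance of increments *)

Section dyadic_layers.
Context {R : realType}.
Variable e : R.
Hypothesis e_gt1 : 1 < e.

(** Equal to 4^(-e). The condition e > 1 makes it smaller than 1/4, so the layers can be summed
    against a tail of order S^(-2). *)
Definition layer_ratio : R := (2^-1 `^ e) ^+ 2.

Lemma layer_ratio_lt : layer_ratio < 4^-1.
Proof.
have h : 2^-1 `^ e < 2^-1 :> R.
  rewrite -mulr_powRB1//; last by rewrite (lt_trans _ e_gt1).
  have : 2^-1 `^ (e - 1) < 1 `^ (e - 1) :> R.
    by apply: gt0_ltr_powR; rewrite ?nnegrE ?subr_gt0//; lra.
  by rewrite pow1R gtr_pMr.
have := powR_ge0 (2^-1 : R) e; rewrite /layer_ratio expr2; move: (_ `^ e) h => z; nra.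
Qed.

Lemma layer_ratioE k : layer_ratio ^+ k = ((2^-1 ^+ k) `^ e) ^+ 2.
Proof.
rewrite /layer_ratio -exprM mulnC exprM; congr (_ ^+ 2).
by rewrite -!powR_mulrn ?powR_ge0// -!powRrM mulrC.
Qed.

(** If 2^(-k-1) < x <= 2^(-k), layer k alone dominates x^(2e); for x > 1 layer 0 does. Only
    superlevel sets of x occur on the right, and their measures are tails. *)
Lemma layer_sum_ge (x : R) K : 0 < x -> 2^-1 ^+ K.+1 < x ->
  (if 1 < x then 1 else (x `^ e) ^+ 2) <=
  \sum_(k < K.+1) layer_ratio ^+ k * (2^-1 ^+ k.+1 < x)%R%:R.
Proof.
move=> x0; have q0 : 0 <= layer_ratio by rewrite sqr_ge0.
have step k : x <= 2^-1 ^+ k -> (x `^ e) ^+ 2 <= layer_ratio ^+ k.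
  move=> xk; rewrite layer_ratioE ler_sqr ?nnegrE ?powR_ge0//.
  by apply: le_powR => //; [rewrite ltW// (lt_trans _ e_gt1)|exact: ltW].
have x1 : 1 < x = false -> x <= 2^-1 ^+ 0 by rewrite expr0 => /negbT; rewrite -leNgt.
elim: K => [|K IH] xK.
  rewrite big_ord1 expr0 mul1r xK; case: ifPn => // x1'.
  by have := step 0%N; rewrite expr0; apply; apply: (x1 (negbTE x1')).
rewrite big_ord_recr /=; have [h|h] := ltP (2^-1 ^+ K.+1) x.
  by apply: (le_trans (IH h)); rewrite lerDl mulr_ge0// exprn_ge0.
apply: (@le_trans _ _ (layer_ratio ^+ K.+1)).
  rewrite ifF; first exact: step.
  apply/negbTE; rewrite -leNgt (le_trans h)// exprn_ile1//; lra.
rewrite xK mulr1 lerDr; apply: sumr_ge0 => k _.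
by rewrite mulr_ge0// exprn_ge0.
Qed.

End dyadic_layers.

Section increment_upper_bound.
Context {R : realType} {N : nat} {d : measure_display} {Omega : measurableType d}.
Variables (P : probability Omega R) (X : 'rV[R]_N -> {RV P >-> R}).
Variable F : {measure set (borelRV R N) -> \bar R}.
Hypothesis XF : spectral_measure X F.
Variables (H : 'I_N -> R) (T C R0 : R).
Hypothesis H01 : forall j, 0 < H j < 1.
Hypothesis T_ge0 : 0 <= T.
Hypothesis C_ge0 : 0 <= C.
Hypothesis R0_ge1 : 1 <= R0.
Hypothesis tail_le : forall S, R0 <= S ->
  (F [set l | (S < rho H 0 l)%R] <= (C * (S ^+ 2)^-1)%:E)%E.

Let H0 j : 0 < H j. Proof. by case/andP: (H01 j). Qed.
Let levy (l : 'rV[R]_N) : R := enorm l ^+ 2 / (1 + enorm l ^+ 2).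

(** The value 2 is the default of the finite minimum and also exceeds 1. *)
Let exponent : exists2 e : R, 1 < e & forall j, e <= (H j)^-1.
Proof.
exists (\big[Num.min/2]_j (H j)^-1).
  apply: lt_bigmin => [|j _]; first by lra.
  by case/andP: (H01 j) => h0 h1; rewrite invf_gt1.
by move=> j; exact: bigmin_le_cond.
Qed.

Lemma enorm_le_rho (tau : 'rV[R]_N) : (forall j, `|tau 0 j| <= 1 + 2 * T) ->
  enorm tau ^+ 2 <= (1 + 2 * T) ^+ 2 * rho H 0 tau ^+ 2.
Proof.
move=> tT; rewrite enorm_sqr.
have D1 : 1 <= 1 + 2 * T by have := T_ge0; lra.
have tj j : `|tau 0 j| <= (1 + 2 * T) * `|tau 0 j| `^ H j.
  have [->|t0] := eqVneq (tau 0 j) 0; first by rewrite normr0 mulr_ge0 ?powR_ge0//; lra.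
  have p0 : 0 < `|tau 0 j| by rewrite normr_gt0.
  rewrite -{1}[`|tau 0 j|]powRr1// -[X in _ `^ X](subrK (H j)) powRD ?(gt_eqF p0) ?implybT//.
  rewrite ler_wpM2r ?powR_ge0//; case/andP: (H01 j) => h0 h1.
  apply: le_trans (_ : (1 + 2 * T) `^ (1 - H j) <= _).
    have tTj := tT j; apply: le_powR => //; lra.
  by apply: ler1_powR => //; lra.
have tr j : `|tau 0 j| `^ H j <= rho H 0 tau.
  rewrite /rho (bigD1 j)//= mxE sub0r normrN lerDl.
  by apply: sumr_ge0 => i _; exact: powR_ge0.
have r0 : 0 <= rho H 0 tau by apply: sumr_ge0 => i _; exact: powR_ge0.
apply: (@le_trans _ _ (\sum_j (1 + 2 * T) ^+ 2 * (`|tau 0 j| `^ H j * rho H 0 tau))).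
  apply: ler_sum => j _; rewrite -real_normK ?num_real//.
  apply: (@le_trans _ _ (((1 + 2 * T) * `|tau 0 j| `^ H j) ^+ 2)).
    by rewrite ler_sqr ?nnegrE ?mulr_ge0 ?powR_ge0//; lra.
  rewrite exprMn ler_wpM2l ?sqr_ge0// expr2 ler_wpM2l ?powR_ge0//.
rewrite -mulr_sumr -mulr_suml [rho H 0 tau ^+ 2]expr2 le_eqVlt; apply/orP; left; apply/eqP.
congr (_ * (_ * _)); apply: eq_bigr => j _.
by rewrite mxE sub0r normrN.
Qed.

Lemma enorm_low (l : 'rV[R]_N) : rho H 0 l <= R0 ->
  enorm l ^+ 2 <= (1 + \sum_j (R0 `^ (H j)^-1) ^+ 2) * levy l.
Proof.
move=> lR; have h1 : enorm l ^+ 2 <= \sum_j (R0 `^ (H j)^-1) ^+ 2.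
  rewrite enorm_sqr; apply: ler_sum => j _; rewrite -real_normK ?num_real//.
  by rewrite ler_sqr ?nnegrE ?powR_ge0//; apply: rho_coord_le.
have l0 := sqr_ge0 (enorm l); rewrite /levy mulrA ler_pdivlMr; last by rewrite ltr_pwDl.
by rewrite mulrC ler_wpM2r//; lra.
Qed.

(** With x the product of the two [rho]-norms and x <= 1, |tau_j l_j| <= x^(1/H_j) <= x^e, so
    |<tau,l>| <= N x^e. For x > 1 the kernel is at most 4. *)
Lemma skernel_layer (e : R) (tau l : 'rV[R]_N) : 1 < e -> (forall j, e <= (H j)^-1) ->
  0 < rho H 0 tau * rho H 0 l ->
  skernel tau tau l <= (4 + N%:R ^+ 2) *
    (if 1 < rho H 0 tau * rho H 0 l then 1 else ((rho H 0 tau * rho H 0 l) `^ e) ^+ 2).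
Proof.
move=> e1 eH x0; set x := _ * _ in x0 *; rewrite skernel_diag.
case: ifPn => [_|]; first by have := cos_geN1 (edot tau l); have := sqr_ge0 (N%:R : R); lra.
rewrite -leNgt => x1; have x01 : 0 < x <= 1 by rewrite x0.
apply: (@le_trans _ _ (edot tau l ^+ 2)); first by have := one_minus_cos_le (edot tau l); lra.
apply: (@le_trans _ _ ((N%:R * x `^ e) ^+ 2)); last first.
  by rewrite exprMn ler_wpM2r ?sqr_ge0//; lra.
rewrite -[_ ^+ 2]real_normK ?num_real// ler_sqr ?nnegrE ?mulr_ge0 ?powR_ge0//.
apply: (le_trans (ler_norm_sum _ _ _)).
rewrite -[N in N%:R]card_ord -sumr_const mulr_suml; apply: ler_sum => j _.
rewrite mul1r normrM; apply: le_trans (ger_powR x01 (eH j)).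
have r0 t : 0 <= rho H 0 t by apply: sumr_ge0 => i _; exact: powR_ge0.
by rewrite /x powRM// ler_pM// rho_coord_le.
Qed.

Lemma qform_increment (s t : 'rV[R]_N) : ((qform X (fun i : 'I_2 => if i == 0 then 1 else - 1)
    (fun i : 'I_2 => if i == 0 then s else t))%:E =
  \int[F]_l (skernel (s - t) (s - t) l)%:E)%E.
Proof.
rewrite (qform_spectral XF); apply: eq_integral => l _; congr EFin.
rewrite !big_ord_recl !big_ord0 /= skernel_diag !addr0 !mul1r !mulN1r.
have -> : edot (s - t) l = edot s l - edot t l.
  rewrite /edot -sumrB; apply: eq_bigr => j _; rewrite !mxE; ring.
rewrite cosB; have := cos2Dsin2 (edot s l); have := cos2Dsin2 (edot t l).
by move: (cos _) (sin _) (cos _) (sin _) => a b a' b'; rewrite !expr2; nra.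
Qed.
(** Frequencies with rho(l) <= R0 contribute at most a constant times |tau|^2, and |tau| is at most
    a constant times rho(tau) on the cube. The others contribute at most a constant times sum_k q^k
    F(rho > 2^(-k-1) / r), of order r^2 sum_k (4q)^k with 4q < 1. *)
Lemma qform_upper_bound : exists2 c : R, 0 <= c & forall s t : 'rV[R]_N,
  cube 0 T s -> cube 0 T t ->
  qform X (fun i : 'I_2 => if i == 0 then 1 else - 1)
    (fun i : 'I_2 => if i == 0 then s else t) <= c * rho H s t ^+ 2.
Proof.
have [e e1 eH] := exponent.
set q := layer_ratio e; have q4 : q < 4^-1 by exact: layer_ratio_lt.
have q0 : 0 <= q by rewrite /q sqr_ge0.
pose M2 := 1 + \sum_j (R0 `^ (H j)^-1) ^+ 2.
have M20 : 0 <= M2 by rewrite addr_ge0// sumr_ge0// => j _; rewrite sqr_ge0.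
pose L := \int[F]_l levy l.
have iL := levy_integrable XF.
have L0 : 0 <= L by apply: Rintegral_ge0 => l _; rewrite divr_ge0 ?addr_ge0 ?sqr_ge0.
pose c1 := N%:R * (1 + 2 * T) ^+ 2 * M2 * L.
pose c2 := (4 + N%:R ^+ 2) * (4 * C / (1 - 4 * q)).
have N20 : 0 <= 4 + N%:R ^+ 2 :> R by rewrite addr_ge0// sqr_ge0.
have q41 : 0 < 1 - 4 * q by rewrite subr_gt0 -ltr_pdivlMl// mulr1.
have D0 : 0 <= 1 + 2 * T by rewrite addr_ge0// mulr_ge0.
have c10 : 0 <= c1 by rewrite !mulr_ge0// sqr_ge0.
have c20 : 0 <= c2 by rewrite mulr_ge0// divr_ge0 ?mulr_ge0// ltW.
exists (c1 + c2); first exact: addr_ge0.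
move=> s t sT tT; set tau := s - t.
have rE : rho H s t = rho H 0 tau.
  by apply: eq_bigr => j _; rewrite !mxE sub0r normrN.
rewrite -lee_fin qform_increment rE; set r := rho H 0 tau.
have tauT j : `|tau 0 j| <= 1 + 2 * T.
  by have := sT j; have := tT j; rewrite !mxE !subr0 !ler_norml; lra.
have et := enorm_le_rho tauT; rewrite -/r in et.
have r0 : 0 <= r by apply: sumr_ge0 => j _; exact: powR_ge0.
have [rz|rn0] := eqVneq r 0.
  have k0 (l : 'rV[R]_N) : skernel tau tau l = 0.
    have e0 : enorm tau ^+ 2 = 0.
      by apply/eqP; rewrite eq_le sqr_ge0 andbT (le_trans et)// rz expr0n mulr0.
    have := edot_sqr_le tau l; rewrite e0 mulr0 mul0r skernel_diag => h1.
    apply/eqP; rewrite eq_le; apply/andP; split; last by rewrite mulr_ge0// subr_ge0 cos_le1.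
    by have := one_minus_cos_le (edot tau l); lra.
  by under eq_integral do rewrite k0; rewrite integral0 lee_fin rz expr0n mulr0.
have rgt0 : 0 < r by rewrite lt_neqAle eq_sym rn0.
(* Enough layers for 2^(-K-1) to lie below r rho(l) whenever rho(l) > R0. *)
have [K KR] : exists K, 2^-1 ^+ K.+1 < r * R0.
  exists (Num.trunc r^-1); apply: (@lt_le_trans _ _ r); last by rewrite ler_peMr.
  rewrite exprVn -[ltRHS]invrK ltf_pV2 ?posrE ?invr_gt0// ?exprn_gt0//.
  apply: lt_trans (truncnS_gt _) _.
  by rewrite -natrX ltr_nat; exact: ltn_expl.
(* The maximum with R0 keeps the level in the range of the tail bound. *)
pose E k : set (borelRV R N) := [set l | Num.max R0 (2^-1 ^+ k.+1 / r) < rho H 0 l].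
have mE k : measurable (E k).
  rewrite -[X in measurable X]setTI.
  have := measurable_rho H measurableT (@measurable_itv R `]Num.max R0 (2^-1 ^+ k.+1 / r), +oo[).
  by congr measurable; apply/seteqP; split => l /=; rewrite in_itv /= andbT.
pose G l := N%:R * enorm tau ^+ 2 * M2 * levy l +
  (4 + N%:R ^+ 2) * \sum_(k < K.+1) q ^+ k * \1_(E k) l.
have levy0 l : 0 <= levy l by rewrite divr_ge0 ?addr_ge0 ?sqr_ge0.
have sum0 l : 0 <= \sum_(k < K.+1) q ^+ k * \1_(E k) l :> R.
  by apply: sumr_ge0 => k _; rewrite mulr_ge0 ?exprn_ge0.
have A0 : 0 <= N%:R * enorm tau ^+ 2 * M2.
  by apply: mulr_ge0 => //; apply: mulr_ge0 => //; exact: sqr_ge0.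
have G1 l : 0 <= N%:R * enorm tau ^+ 2 * M2 * levy l by exact: mulr_ge0.
have kG (l : 'rV[R]_N) : skernel tau tau l <= G l.
  have [lR|lR] := leP (rho H 0 l) R0.
    apply: (@le_trans _ _ (N%:R * enorm tau ^+ 2 * M2 * levy l)); last first.
      by rewrite /G lerDl mulr_ge0.
    rewrite skernel_diag; apply: (@le_trans _ _ (edot tau l ^+ 2)).
      by have := one_minus_cos_le (edot tau l); lra.
    apply: (le_trans (edot_sqr_le _ _)).
    by rewrite -[leRHS]mulrA ler_wpM2l ?enorm_low// mulr_ge0// sqr_ge0.
  have xK : 2^-1 ^+ K.+1 < r * rho H 0 l by apply: (lt_trans KR); rewrite ltr_pM2l.
  have x0 : 0 < r * rho H 0 l by apply: lt_trans xK; rewrite exprn_gt0.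
  apply: (le_trans (skernel_layer e1 eH x0)); rewrite /G ler_wpDl//.
  rewrite ler_wpM2l//; apply: (le_trans (layer_sum_ge e1 x0 xK)).
  apply: ler_sum => k _; rewrite ler_wpM2l ?exprn_ge0// indicE ler_nat.
  case: ltP => //= kx; rewrite mem_set// /E /= gt_max lR /=.
  by rewrite ltr_pdivrMr// mulrC.
have mlevy := measurable_int _ iL.
have mlevyR : measurable_fun setT (levy : borelRV R N -> R) by exact/measurable_EFinP.
have msum : measurable_fun setT (fun l : borelRV R N => \sum_(k < K.+1) q ^+ k * \1_(E k) l : R).
  by apply: measurable_sum => k; apply: measurable_funM => //; exact: measurable_indic.
have mk : measurable_fun setT (skernel tau tau : borelRV R N -> R).
  by apply: measurable_continuous_rV; exact: continuous_skernel.
apply: (@le_trans _ _ (\int[F]_l (G l)%:E)%E).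
  apply: ge0_le_integral => //.
  - by move=> l _; rewrite lee_fin skernel_diag mulr_ge0// subr_ge0 cos_le1.
  - exact/measurable_EFinP.
  - by apply/measurable_EFinP; apply: measurable_funD; exact: measurable_funM.
  - by move=> l _; rewrite lee_fin.
rewrite /G; under eq_integral do rewrite EFinD.
rewrite ge0_integralD//; first last.
- by apply/measurable_EFinP; exact: measurable_funM.
- by move=> l _; rewrite lee_fin mulr_ge0.
- by apply/measurable_EFinP; exact: measurable_funM.
- by move=> l _; rewrite lee_fin.
rewrite mulrDl EFinD; apply: leeD.
  under eq_integral do rewrite EFinM.
  rewrite ge0_integralZl//; last by move=> l _; rewrite lee_fin.
  have -> : (\int[F]_x (levy x)%:E = L%:E)%E.
    by rewrite /L /Rintegral fineK//; exact: (integrable_fin_num measurableT iL).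
  rewrite -EFinM lee_fin /c1; have : 0 <= N%:R * M2 * L by rewrite !mulr_ge0.
  move: et; move: (enorm tau ^+ 2) (rho H 0 tau ^+ 2) => a b; rewrite -/r => ab h.
  have := ler_wpM2l h ab; lra.
under eq_integral do rewrite EFinM.
rewrite ge0_integralZl//; last 2 first.
- exact/measurable_EFinP.
- by move=> l _; rewrite lee_fin.
rewrite /c2 -mulrA EFinM; apply: lee_wpmul2l; first by rewrite lee_fin.
under eq_integral do rewrite -sumEFin.
rewrite ge0_integral_sum//; last 2 first.
- by move=> k; apply/measurable_EFinP; apply: measurable_funM => //; exact: measurable_indic.
- by move=> k l _; rewrite lee_fin mulr_ge0 ?exprn_ge0.
apply: (@le_trans _ _ (\sum_(k < K.+1) (4 * C * r ^+ 2 * (4 * q) ^+ k)%:E)%E).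
  apply: lee_sum => k _; under eq_integral do rewrite EFinM.
  rewrite ge0_integralZl//; last 2 first.
  - by apply/measurable_EFinP; exact: measurable_indic.
  - by rewrite lee_fin exprn_ge0.
  rewrite integral_indic// setIT.
  have S0 : R0 <= Num.max R0 (2^-1 ^+ k.+1 / r) by rewrite le_max lexx.
  apply: (@le_trans _ _ ((q ^+ k)%:E * (C * (Num.max R0 (2^-1 ^+ k.+1 / r) ^+ 2)^-1)%:E)%E).
    by apply: lee_wpmul2l; [rewrite lee_fin exprn_ge0|exact: tail_le].
  rewrite -EFinM lee_fin [(4 * q) ^+ k]exprMn; set m := Num.max _ _ in S0 *.
  have m0 : 0 < m by apply: lt_le_trans S0; exact: lt_le_trans R0_ge1.
  have h1 : (m ^+ 2)^-1 <= 4 * r ^+ 2 * 4 ^+ k.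
    have hm : 2^-1 ^+ k.+1 / r <= m by rewrite le_max lexx orbT.
    rewrite -[leRHS]invrK lef_pV2 ?posrE ?invr_gt0 ?exprn_gt0 ?mulr_gt0 ?exprn_gt0//.
    apply: (@le_trans _ _ ((2^-1 ^+ k.+1 / r) ^+ 2)); last first.
      by rewrite ler_sqr ?nnegrE ?(ltW m0)// divr_ge0 ?exprn_ge0.
    rewrite [leRHS]exprMn -exprM mulnC exprM.
    rewrite (_ : (2^-1 : R) ^+ 2 = 4^-1); last by rewrite exprVn -natrX.
    rewrite [_ ^+ k.+1]exprS !exprVn !invfM; move: (4 ^- k) => z.
    by rewrite le_eqVlt; apply/orP; left; apply/eqP; ring.
  have := ler_wpM2l (mulr_ge0 (exprn_ge0 k q0) C_ge0) h1; rewrite -mulrA; lra.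
rewrite sumEFin lee_fin -mulr_sumr.
have : \sum_(k < K.+1) (4 * q) ^+ k <= (1 - 4 * q)^-1.
  rewrite -[leRHS]mul1r ler_pdivlMr//.
  have := subrX1 (4 * q) K.+1; rewrite -[_ - 1 as X in _ = X * _]opprB.
  have := exprn_ge0 K.+1 (mulr_ge0 (ler0n R 4) q0); lra.
move=> h; have := ler_wpM2l (mulr_ge0 (mulr_ge0 (ler0n R 4) C_ge0) (sqr_ge0 r)) h.
by rewrite [leRHS]mulrAC.
Qed.

End increment_upper_bound.

(** * The characteristic function of the normal law *)

Section normal_characteristic_function.
Context {R : realType}.
Variables (m s : R).
Hypothesis s_gt0 : 0 < s.
Local Notation mu := (@lebesgue_measure R).
Let g := normal_pdf m s.
(** A Gaussian profile of twice the standard deviation: up to a constant it dominates the density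
    times a quadratic polynomial, and so serves as integrable majorant. *)
Let D := normal_fun m (2 * s).

Let sn0 : s != 0. Proof. by rewrite gt_eqF. Qed.
Let s2n0 : 2 * s != 0. Proof. by rewrite mulf_neq0. Qed.
Let g_ge0 x : 0 <= g x. Proof. exact: normal_pdf_ge0. Qed.
Let g_cont : continuous g. Proof. exact: continuous_normal_pdf. Qed.
Let g_meas : measurable_fun setT g. Proof. exact: measurable_normal_pdf. Qed.

Let D_int : mu.-integrable setT (EFin \o D).
Proof.
have -> : EFin \o D = (fun x => ((normal_peak (2 * s))^-1)%:E * (normal_pdf m (2 * s) x)%:E)%E.
  apply/funext => x; rewrite /= normal_pdfE// -EFinM mulrA mulVf ?mul1r//.
  by rewrite gt_eqF// normal_peak_gt0.
by apply: integrableZl => //; exact: integrable_normal_pdf.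
Qed.

Let C := normal_peak s * (1 + 8 * s ^+ 2 / 3).

Let D_ge0 x : 0 <= D x. Proof. exact: expR_ge0. Qed.

Let g_bound x : (1 + (x - m) ^+ 2) * g x <= C * D x.
Proof.
rewrite /g normal_pdfE// /C mulrCA -mulrA ler_wpM2l ?normal_peak_ge0//.
rewrite /D /normal_fun.
set y2 := (x - m) ^+ 2; have y20 : 0 <= y2 by exact: sqr_ge0.
have s20 : 0 < s ^+ 2 by rewrite exprn_gt0.
(* The gap between the two Gaussian exponents; e^w >= 1 + w absorbs the quadratic factor. *)
set w := 3 * y2 / (8 * s ^+ 2).
have -> : - y2 / ((2 * s) ^+ 2 *+ 2) = w + (- y2 / (s ^+ 2 *+ 2)).
  by rewrite /w -[_ ^+ 2 *+ 2 in LHS]mulr_natr -[_ ^+ 2 *+ 2]mulr_natr; field.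
rewrite expRD mulrA ler_wpM2r ?expR_ge0//.
have w0 : 0 <= w by apply: divr_ge0; [exact: mulr_ge0|apply: mulr_ge0 => //; exact: ltW].
apply: le_trans (_ : (1 + 8 * s ^+ 2 / 3) * (1 + w) <= _); last first.
  by rewrite ler_wpM2l ?expR_ge1Dx// addr_ge0// divr_ge0// mulr_ge0// ltW.
have -> : (1 + 8 * s ^+ 2 / 3) * (1 + w) = 1 + w + 8 * s ^+ 2 / 3 + y2.
  by rewrite /w; field.
have : 0 <= 8 * s ^+ 2 / 3 by rewrite divr_ge0// mulr_ge0// ltW.
lra.
Qed.

Let C_ge0 : 0 <= C.
Proof. by rewrite mulr_ge0 ?normal_peak_ge0// addr_ge0// divr_ge0// mulr_ge0// sqr_ge0. Qed.

Let growth_bound (a b x : R) (p : R) : `|p| <= a + b * `|x - m| -> 0 <= a -> 0 <= b ->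
  `|p * g x| <= (a + b) * C * D x.
Proof.
move=> pab a0 b0; rewrite normrM (ger0_norm (g_ge0 x)).
apply: le_trans (_ : (a + b) * (1 + (x - m) ^+ 2) * g x <= _); last first.
  by rewrite -mulrA -[leRHS]mulrA ler_wpM2l ?addr_ge0.
rewrite ler_wpM2r//; apply: (le_trans pab); rewrite -real_normK ?num_real//.
move: (`|x - m|) (normr_ge0 (x - m)) => y y0; have := sqr_ge0 (y - 1); nra.
Qed.

Let integrable_growth (p : R -> R) (a b : R) : measurable_fun setT p ->
  (forall x, `|p x| <= a + b * `|x - m|) -> 0 <= a -> 0 <= b ->
  mu.-integrable setT (EFin \o (fun x => p x * g x)).
Proof.
move=> mp pab a0 b0.
have Di : mu.-integrable setT (fun x => ((a + b) * C)%:E * (EFin \o D) x)%E.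
  exact: (integrableZl measurableT _ D_int).
apply: le_integrable Di => //.
- by apply/measurable_EFinP; exact: measurable_funM.
- move=> x _; rewrite /= lee_fin (le_trans _ (ler_norm _))//.
  exact: growth_bound.
Qed.

Let derive_g (x : R) : is_derive x 1 g (- (x - m) / s ^+ 2 * g x).
Proof.
rewrite /g normal_pdfE// /normal_fun; apply: is_derive_eq.
rewrite /GRing.scale /= -[s ^+ 2 *+ 2]mulr_natr; field.
exact: sn0.
Qed.

Lemma is_derive_sin_affine (c beta x : R) :
  is_derive x 1 (fun x : R => sin (c * (x - m) + beta)) (c * cos (c * (x - m) + beta)).
Proof. by apply: is_derive_eq; rewrite /GRing.scale /=; ring. Qed.

Lemma is_derive_cos_scale (c beta t : R) :
  is_derive t 1 (fun t : R => cos (t * c + beta)) (- c * sin (t * c + beta)).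
Proof. by apply: is_derive_eq; rewrite /GRing.scale /=; ring. Qed.

Let g_le n : g (m + n.+1%:R) <= C / n.+1%:R /\ g (m - n.+1%:R) <= C / n.+1%:R.
Proof.
have n1 : 1 <= n.+1%:R :> R by rewrite ler1n.
have key y : `|y - m| = n.+1%:R -> g y <= C / n.+1%:R.
  move=> yn; rewrite ler_pdivlMr ?ltr0n//.
  have D1 : D y <= 1.
    rewrite /D /normal_fun -[leRHS]expR0 ler_expR mulNr oppr_le0 divr_ge0 ?sqr_ge0//.
    by rewrite mulrn_wge0// sqr_ge0.
  have := g_bound y; rewrite -real_normK ?num_real// yn => h1.
  have h2 : C * D y <= C by rewrite ler_piMr.
  apply: le_trans h2; apply: le_trans h1; rewrite mulrC ler_wpM2r//; nra.
split; apply: key; first by rewrite addrC addKr ger0_norm.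
by rewrite addrC addKr normrN ger0_norm.
Qed.

(* Integration by parts against the normal density, whose logarithmic
   derivative is [- (x - m) / s ^+ 2]. *)
Lemma normal_integration_by_parts (h h' : R -> R) (A : R) :
  (forall x : R, is_derive x 1 h (h' x)) -> continuous h' ->
  (forall x, `|h x| <= A) -> (forall x, `|h' x| <= A) ->
  \int[mu]_x (h' x * g x) = \int[mu]_x (h x * (x - m) / s ^+ 2 * g x).
Proof.
move=> dh ch' hA h'A.
have A0 : 0 <= A by exact: le_trans (hA 0).
have ch : continuous h.
  by move=> x; apply: differentiable_continuous; apply/derivable1_diffP; have [] := dh x.
have s20 : 0 < s ^+ 2 by rewrite exprn_gt0.
have i1 : mu.-integrable setT (EFin \o (fun x => h' x * g x)).
  apply: (@integrable_growth h' A 0) => //; first exact: continuous_measurable_fun.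
  by move=> x; rewrite mul0r addr0.
have cmul : continuous (fun x => h x * (x - m) / s ^+ 2).
  move=> x; apply: cvgM; last exact: cvg_cst.
  by apply: cvgM; [exact: ch|apply: cvgB; [exact: cvg_id|exact: cvg_cst]].
have i2 : mu.-integrable setT (EFin \o (fun x => h x * (x - m) / s ^+ 2 * g x)).
  apply: (@integrable_growth _ 0 (A / s ^+ 2)) => //; first exact: continuous_measurable_fun.
    move=> x; rewrite add0r !normrM [`|_^-1|]gtr0_norm ?invr_gt0//.
    by rewrite mulrAC ler_wpM2r// ler_wpM2r// invr_ge0 ltW.
  by rewrite divr_ge0// ltW.
pose k x := h' x * g x - h x * (x - m) / s ^+ 2 * g x.
have ik : mu.-integrable setT (EFin \o k).
  exact: (integrableB measurableT i1 i2).
(* k is the derivative of h g, so over growing intervals its integral is a difference of boundary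
   values, which tends to 0. *)
suff /eqP : \int[mu]_x k x = 0.
  by rewrite /k RintegralB// subr_eq0 => /eqP.
pose I n := `[m - n.+1%:R, m + n.+1%:R]%classic.
have ck : continuous k.
  move=> x; apply: cvgB; first by apply: cvgM; [exact: ch'|exact: g_cont].
  by apply: cvgM; [exact: cmul|exact: g_cont].
pose F x := h x * g x.
have dF (x : R) : is_derive x 1 F (k x).
  rewrite /F; have d1 := dh x; have d2 := derive_g x.
  apply: is_derive_eq; rewrite /k /GRing.scale /=; ring.
have cF : continuous F by move=> x; apply: cvgM; [exact: ch|exact: g_cont].
have FTC n : (\int[mu]_(x in I n) (k x)%:E =
    (F (m + n.+1%:R) - F (m - n.+1%:R))%:E)%E.
  rewrite EFinB; apply: continuous_FTC2.
  - by rewrite ltrD2l gtrN// ltr0n.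
  - exact: continuous_subspaceT.
  - split; first by move=> x _; have [] := dF x.
      by apply: cvg_at_right_filter; exact: cF.
    by apply: cvg_at_left_filter; exact: cF.
  - by move=> x _; rewrite derive1E; apply: derive_val.
have lim0 : (\int[mu]_(x in I n) (k x)%:E)%E @[n --> \oo] --> (0 : \bar R)%E.
  under eq_fun do rewrite FTC.
  apply: cvg_EFin; first exact: nearW.
  apply: norm_cvg0.
  apply: (@squeeze_cvgr _ _ _ _ (cst 0) (fun n => 2 * A * C * n.+1%:R^-1)).
  - near=> n; rewrite normr_ge0 /= /F.
    have [h1 h2] := g_le n.
    apply: le_trans (ler_normB _ _) _; rewrite !normrM ![`|g _|]ger0_norm//.
    have h3 := ler_pM (normr_ge0 _) (g_ge0 _) (hA (m + n.+1%:R)) h1.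
    have h4 := ler_pM (normr_ge0 _) (g_ge0 _) (hA (m - n.+1%:R)) h2.
    apply: (le_trans (lerD h3 h4)).
    by rewrite le_eqVlt; apply/orP; left; apply/eqP; ring.
  - exact: cvg_cst.
  - rewrite -[X in _ --> X](mulr0 (2 * A * C)); apply: cvgM; first exact: cvg_cst.
    exact: cvg_harmonic.
have lim1 : (\int[mu]_(x in I n) (k x)%:E)%E @[n --> \oo] --> (\int[mu]_x (k x)%:E)%E.
  under eq_fun do rewrite integral_mkcond.
  have mI n : measurable (I n) by exact: measurable_itv.
  have [//|//|//|||_ _] := @dominated_convergence _ _ _ mu setT measurableT
    (fun n => (EFin \o k) \_ (I n)) (EFin \o k) (abse \o (EFin \o k)).
  - move=> n; apply/(measurable_restrictT _ (mI n)).
    by apply: measurable_funTS; case/integrableP: ik.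
  - by case/integrableP: ik.
  - apply: aeW => x _; apply: cvg_near_cst; near=> n.
    rewrite patchE ifT// inE /I /= in_itv /=.
    have : `|x - m| <= n.+1%:R.
      apply: (@le_trans _ _ n%:R); last by rewrite ler_nat.
      by near: n; exact: nbhs_infty_ger.
    by rewrite ler_norml; lra.
  - exact: integrable_abse.
  - by apply: aeW => x n _; rewrite patchE; case: ifP => _ //=; rewrite lee_fin normr0.
  - exact.
have := cvg_unique _ lim1 lim0 => /(_ (@ereal_hausdorff R)).
by rewrite /Rintegral => ->.
Unshelve. all: by end_near. Qed.

(** Differentiation under the integral and integration by parts give f' = - s^2 t f, so f e^(s^2 t^2
    / 2) is constant. The phase beta treats sine and cosine together. *)
Lemma normal_cos_integral (beta t : R) :
  \int[mu]_x (cos (t * (x - m) + beta) * g x) = cos beta * expR (- (s ^+ 2 * t ^+ 2 / 2)).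
Proof.
pose f t := \int[mu]_x (cos (t * (x - m) + beta) * g x).
have caff c : continuous (fun x : R => c * (x - m) + beta).
  move=> x; apply: cvgD; last exact: cvg_cst.
  by apply: cvgM; [exact: cvg_cst|apply: cvgB; [exact: cvg_id|exact: cvg_cst]].
have ccos c : continuous (fun x : R => cos (c * (x - m) + beta)).
  by move=> x; apply: continuous_comp; [exact: caff|exact: continuous_cos].
have csin c : continuous (fun x : R => sin (c * (x - m) + beta)).
  by move=> x; apply: continuous_comp; [exact: caff|exact: continuous_sin].
have ci c : mu.-integrable setT (EFin \o (fun x => cos (c * (x - m) + beta) * g x)).
  apply: (@integrable_growth _ 1 0) => //; first exact: continuous_measurable_fun.
  by move=> x; rewrite mul0r addr0 cos_max.
have si c : mu.-integrable setT (EFin \o (fun x => (x - m) * sin (c * (x - m) + beta) * g x)).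
  apply: (@integrable_growth _ 0 1) => //.
    apply: continuous_measurable_fun => x; apply: cvgM; last exact: csin.
    by apply: cvgB; [exact: cvg_id|exact: cvg_cst].
  by move=> x; rewrite add0r mul1r normrM ler_piMr// sin_max.
have parts c : \int[mu]_x ((x - m) * sin (c * (x - m) + beta) * g x) = s ^+ 2 * c * f c.
  have := @normal_integration_by_parts (fun x => sin (c * (x - m) + beta))
    (fun x => c * cos (c * (x - m) + beta)) (1 + `|c|)
    (is_derive_sin_affine c beta).
  have -> : \int[mu]_x (c * cos (c * (x - m) + beta) * g x) = c * f c.
    rewrite /f -(RintegralZl _ measurableT (ci c)).
    by apply: eq_Rintegral => x _; rewrite mulrA.
  have -> : \int[mu]_x (sin (c * (x - m) + beta) * (x - m) / s ^+ 2 * g x) =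
     (s ^+ 2)^-1 * \int[mu]_x ((x - m) * sin (c * (x - m) + beta) * g x).
    rewrite -(RintegralZl _ measurableT (si c)).
    by apply: eq_Rintegral => x _; ring.
  move=> h; rewrite -mulrA h ?mulVKf ?gt_eqF ?exprn_gt0//.
  - by move=> x; apply: cvgM; [exact: cvg_cst|exact: ccos].
  - by move=> x; rewrite (le_trans (sin_max _))// lerDl.
  - by move=> x; rewrite normrM (@le_trans _ _ `|c|)// ?lerDr// ler_piMr// cos_max.
have d1E c x : partial1of2 (fun t x => cos (t * (x - m) + beta) * g x) c x =
    - ((x - m) * sin (c * (x - m) + beta) * g x).
  rewrite partial1of2E; have d1 := is_derive_cos_scale (x - m) beta c.
  have -> : (fun t : R => cos (t * (x - m) + beta) * g x) =
    (fun t : R => cos (t * (x - m) + beta)) * cst (g x) by [].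
  rewrite (@derive_val _ _ _ _ _ _ _ (is_deriveM d1 (is_derive_cst (g x) c 1))).
  by rewrite /GRing.scale /=; ring.
have fd (c : R) : is_derive c 1 f (- s ^+ 2 * c * f c).
  have cI : `]c - 1, c + 1[%classic c by rewrite /= in_itv /=; lra.
  have dcos (t0 x : R) : derivable (fun t : R => cos (t * (x - m) + beta) * g x) t0 1.
    have d1 := is_derive_cos_scale (x - m) beta t0.
    by have [] := is_deriveM d1 (is_derive_cst (g x) t0 1).
  pose bnd x : R := `|x - m| * g x.
  have ibnd : mu.-integrable setT (EFin \o bnd).
    apply: (@integrable_growth _ 0 1) => //; last by move=> x; rewrite normr_id add0r mul1r.
    by apply: measurableT_comp => //; exact: measurable_funB.
  have bnd0 x : 0 <= bnd x by rewrite mulr_ge0.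
  have bndub (t0 x : R) : `]c - 1, c + 1[%classic t0 -> setT x ->
      `|partial1of2 (fun t x => cos (t * (x - m) + beta) * g x) t0 x| <= bnd x.
    move=> _ _; rewrite d1E normrN !normrM (ger0_norm (g_ge0 x)) ler_wpM2r//.
    by rewrite ler_piMr// sin_max.
  apply: DeriveDef.
    exact: (derivable_under_integral measurableT cI (fun t0 _ => ci t0)
      (fun t0 x _ _ => dcos t0 x) bnd0 ibnd bndub).
  rewrite -derive1E (differentiation_under_integral measurableT cI (fun t0 _ => ci t0)
      (fun t0 x _ _ => dcos t0 x) bnd0 ibnd bndub).
  under eq_Rintegral do rewrite d1E -mulN1r.
  by rewrite (RintegralZl _ measurableT (si c)) parts; ring.
pose G c := f c * expR (s ^+ 2 * c ^+ 2 / 2).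
have dG (c : R) : is_derive c 1 G 0.
  by rewrite /G; have d1 := fd c; apply: is_derive_eq; rewrite /GRing.scale /=; field.
have := is_derive_0_is_cst t 0 dG; rewrite /G expr0n mulr0 mul0r expR0 mulr1 => GE.
have f0 : f 0 = cos beta.
  rewrite /f; under eq_Rintegral do rewrite mul0r add0r.
  rewrite (RintegralZl _ measurableT (integrable_normal_pdf m s)).
  by rewrite /Rintegral integral_normal_pdf mulr1.
rewrite -/(f t) -f0 -GE expRN mulfK// gt_eqF// expR_gt0 //.
Qed.

End normal_characteristic_function.

(** * Moments of Gaussian variables from their characteristic function *)

Section normal_expectation.
Context {R : realType}.
Local Notation mu := (@lebesgue_measure R).

Lemma integral_normal_prob (m s : R) (f : R -> \bar R) : s != 0 ->
  measurable_fun setT f -> (\int[normal_prob m s]_x `|f x| < +oo)%E ->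
  (\int[normal_prob m s]_x f x = \int[mu]_x (f x * (normal_pdf m s x)%:E))%E.
Proof.
move=> s0 mf finf; have dom := @normal_prob_dominates R m s.
rewrite -(Radon_Nikodym_change_of_variables dom)//=; last first.
  by apply/integrableP; split.
apply: ae_eq_integral => //.
- exact: emeasurable_funM.
- by apply: emeasurable_funM => //=; apply/measurable_EFinP; exact: measurable_normal_pdf.
- apply: ae_eqe_mul2l => /=.
  rewrite Radon_NikodymE//=.
  case: cid => /= h [h1 h2 h3].
  apply: integral_ae_eq => //=.
  + by apply/measurableT_comp => //; exact: measurable_normal_pdf.
  + by move=> E E01 mE; rewrite -h3.
Qed.

Context d (Omega : measurableType d) (P : probability Omega R).

Lemma bounded_integrable (f : Omega -> R) (M : R) : measurable_fun setT f ->
  (forall w, `|f w| <= M) -> P.-integrable setT (EFin \o f).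
Proof.
move=> mf fM; apply: (le_integrable measurableT _ _ (finite_measure_integrable_cst P M measurableT)).
  exact/measurable_EFinP.
by move=> w _; rewrite /= lee_fin (le_trans (fM w))// ler_norm.
Qed.

Lemma gaussian_law_cos (m s : R) (Y : Omega -> R) (beta t : R) :
  measurable_fun setT Y -> 0 <= s ->
  (forall B : set R, measurable B -> P (Y @^-1` B) = gaussian_law m s B) ->
  \int[P]_w cos (t * (Y w - m) + beta) = cos beta * expR (- (s ^+ 2 * t ^+ 2 / 2)).
Proof.
move=> mY s0 law; set phi := fun x => cos (t * (x - m) + beta).
have cphi : continuous phi.
  move=> x; apply: continuous_comp; last exact: continuous_cos.
  apply: cvgD; last exact: cvg_cst.
  by apply: cvgM; [exact: cvg_cst|apply: cvgB; [exact: cvg_id|exact: cvg_cst]].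
have mphi : measurable_fun setT phi by exact: continuous_measurable_fun.
have mphiE : measurable_fun setT (EFin \o phi) by exact/measurable_EFinP.
pose Ym : {mfun Omega >-> measurableTypeR R} :=   @mfun_Sub _ _ Omega (measurableTypeR R) Y (mem_set mY).
have lawY (B : set R) : measurable B -> distribution P Ym B = gaussian_law m s B by exact: law.
have -> : \int[P]_w phi (Y w) = fine (\int[distribution P Ym]_x (phi x)%:E)%E.
  rewrite integral_distribution//.
  apply: (@bounded_integrable _ 1); first exact: measurableT_comp.
  by move=> w; rewrite cos_max.
have [s0'|sn0] := eqVneq s 0.
  rewrite (eq_measure_integral (@dirac _ (measurableTypeR R) m R)).
    by rewrite integral_dirac// diracT mul1e /= /phi s0' subrr mulr0 add0r expr0n !mul0r oppr0 expR0 mulr1.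
  by move=> A mA _; apply: etrans (lawY A mA) _; rewrite /gaussian_law s0' eqxx.
have sgt0 : 0 < s by rewrite lt_neqAle eq_sym sn0.
rewrite (eq_measure_integral (normal_prob m s)); last first.
  by move=> A mA _; apply: etrans (lawY A mA) _; rewrite /gaussian_law (negbTE sn0).
rewrite integral_normal_prob//; last first.
  apply: (@le_lt_trans _ _ (\int[normal_prob m s]_x 1%:E)%E); last first.
    by rewrite integral_cst// mul1e /= /normal_prob integral_normal_pdf ltry.
  apply: ge0_le_integral => //.
    exact: measurableT_comp.
  by move=> x _; rewrite lee_fin cos_max.
by rewrite -(normal_cos_integral m sgt0).
Qed.

Lemma cvg_Rintegral_dominated (f : nat -> Omega -> R) (g h : Omega -> R) :
  (forall n, measurable_fun setT (f n)) -> measurable_fun setT g ->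
  (forall w, f n w @[n --> \oo] --> g w) ->
  P.-integrable setT (EFin \o h) -> (forall n w, `|f n w| <= h w) ->
  P.-integrable setT (EFin \o g) /\
  \int[P]_w f n w @[n --> \oo] --> \int[P]_w g w.
Proof.
move=> mf mg fg ih fh.
have [|||//||ig _ cvfg] := @dominated_convergence _ _ _ P setT measurableT
  (fun n => EFin \o f n) (EFin \o g) (EFin \o h).
- by move=> n; exact/measurable_EFinP.
- exact/measurable_EFinP.
- by apply: aeW => w _; apply: cvg_EFin; [exact: nearW|exact: fg].
- by apply: aeW => w n _; rewrite /= lee_fin.
split=> //; apply: fine_cvg; rewrite /Rintegral fineK//.
exact: (integrable_fin_num measurableT ig).
Qed.

Lemma cvg_slope (f : R -> R) (a : R) (u : nat -> R) :
  is_derive (0 : R) 1 f a -> f 0 = 0 -> (forall n, u n != 0) ->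
  u n @[n --> \oo] --> 0 -> f (u n) / u n @[n --> \oo] --> a.
Proof.
move=> [df <-] f0 u0 cu.
have h : (fun h => h^-1 *: (f (h *: 1 + 0) - f 0)) @ 0^' --> 'D_1 f 0.
  have := df; rewrite /derivable => /cvg_ex[l hl].
  by rewrite /derive (cvg_lim _ hl).
have cu' : u @ \oo --> 0^'.
  move=> A A0; have : \forall n \near \oo, u n != 0 -> A (u n) := cu _ A0.
  by apply: filterS => n; apply.
have := cvg_comp _ _ cu' h.
apply: cvg_trans; apply: near_eq_cvg; apply: nearW => n /=.
by rewrite f0 subr0 addr0 /GRing.scale /= mulr1 mulrC.
Qed.

(** With d = 1/(n+1), sin (y d) / d and 2 (1 - cos (y d)) / d^2 are bounded substitutes for y and
    y^2, dominated by |y| and y^2. Their integrals come from the characteristic function. *)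
Let dl n : R := n.+1%:R^-1.

Lemma cvg_sin_scaled (y : R) : sin (y * dl n) / dl n @[n --> \oo] --> y.
Proof.
apply: (cvg_slope (f := fun h => sin (y * h))).
- by apply: is_derive_eq; rewrite /GRing.scale /= mulr0 cos0; ring.
- by rewrite mulr0 sin0.
- by move=> n; rewrite invr_neq0.
- exact: cvg_harmonic.
Qed.

Lemma cvg_cos_scaled (y : R) : 2 * (1 - cos (y * dl n)) / dl n ^+ 2 @[n --> \oo] --> y ^+ 2.
Proof.
have h : (2 * sin (y / 2 * dl n) / dl n) @[n --> \oo] --> 2 * (y / 2).
  under eq_fun do rewrite -mulrA.
  by apply: cvgM; [exact: cvg_cst|exact: cvg_sin_scaled].
rewrite -{2}[y](@divfK _ 2)// [_ * 2]mulrC expr2.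
apply: (cvg_trans _ (cvgM h h)); apply: near_eq_cvg; apply: nearW => n /=.
rewrite one_minus_cos (_ : y * dl n / 2 = y / 2 * dl n); last by rewrite mulrAC.
by rewrite expr2 invfM; ring.
Qed.

Lemma cvg_exp_scaled (c : R) : 2 * (1 - expR (- (c * dl n ^+ 2 / 2))) / dl n ^+ 2 @[n --> \oo] --> c.
Proof.
have := @cvg_slope (fun h => 2 * (1 - expR (- (c * h / 2)))) c (fun n => dl n ^+ 2).
apply.
- by apply: is_derive_eq; rewrite /GRing.scale /= mulr0 mul0r oppr0 expR0; field.
- by rewrite mulr0 mul0r oppr0 expR0 subrr mulr0.
- by move=> n; rewrite expf_neq0// invr_neq0.
- rewrite -[X in _ --> X](mulr0 (0 : R)); under eq_fun do rewrite expr2.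
  by apply: cvgM; exact: cvg_harmonic.
Qed.
End normal_expectation.

Section square_integrable.
Context {R : realType} d (Omega : measurableType d) (P : probability Omega R).
Implicit Types Y Z : Omega -> R.
Local Notation dl n := (n.+1%:R^-1 : R).

Lemma sin_scaled_le (y : R) n : `|sin (y * dl n) / dl n| <= `|y|.
Proof.
rewrite -ler_sqr ?nnegrE// !real_normK ?num_real// expr_div_n ler_pdivrMr ?exprn_gt0//.
by rewrite -exprMn; exact: sin_sqr_le.
Qed.

Lemma cos_scaled_ge0 (y : R) n : 0 <= 2 * (1 - cos (y * dl n)) / dl n ^+ 2.
Proof. by rewrite divr_ge0 ?sqr_ge0// mulr_ge0// subr_ge0 cos_le1. Qed.

Lemma cos_scaled_le (y : R) n : 2 * (1 - cos (y * dl n)) / dl n ^+ 2 <= y ^+ 2.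
Proof.
rewrite ler_pdivrMr ?exprn_gt0// -exprMn.
by move: (y * dl n) => z; have := one_minus_cos_le z; lra.
Qed.

Lemma Rintegral_cst_probability (c : R) : \int[P]_w c = c.
Proof.
have h : (c%:E * P setT = c%:E)%E by rewrite probability_setT mule1.
by rewrite /Rintegral integral_cst//; exact: (congr1 fine h).
Qed.

Lemma integrable_sqr_mul Y Z : measurable_fun setT Y -> measurable_fun setT Z ->
  P.-integrable setT (EFin \o (fun w => Y w ^+ 2)) ->
  P.-integrable setT (EFin \o (fun w => Z w ^+ 2)) ->
  P.-integrable setT (EFin \o (fun w => Y w * Z w)).
Proof.
move=> mY mZ iY iZ; apply: (le_integrable measurableT _ _ (integrableD measurableT iY iZ)).
  by apply/measurable_EFinP; exact: measurable_funM.
move=> w _; rewrite /= lee_fin [leRHS]ger0_norm ?addr_ge0 ?sqr_ge0//.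
have := sqr_ge0 (Y w - Z w); have := sqr_ge0 (Y w + Z w).
have := sqr_ge0 (Y w); have := sqr_ge0 (Z w).
by move: (Y w) (Z w) => y z; rewrite ler_norml => ? ? ? ?; apply/andP; split; nra.
Qed.

Lemma integrable_sqr Y : measurable_fun setT Y ->
  P.-integrable setT (EFin \o (fun w => Y w ^+ 2)) -> P.-integrable setT (EFin \o Y).
Proof.
move=> mY iY; have i1 := finite_measure_integrable_cst P (1 : R) (@measurableT _ Omega).
have := @integrable_sqr_mul Y (cst 1) mY (measurable_cst _) iY.
have -> : (fun w => Y w * cst 1 w) = Y by apply/funext => w; rewrite mulr1.
by apply; under eq_fun do rewrite expr1n.
Qed.

Lemma measurable_cos_affine Y (a b : R) : measurable_fun setT Y ->
  measurable_fun setT (fun w => cos (a * Y w + b)).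
Proof.
move=> mY; apply: measurableT_comp; first by apply: continuous_measurable_fun; exact: continuous_cos.
by apply: measurable_funD => //; exact: measurable_funM.
Qed.

Lemma integrable_cos_affine Y (a b : R) : measurable_fun setT Y ->
  P.-integrable setT (EFin \o (fun w => cos (a * Y w + b))).
Proof.
move=> mY; apply: (@bounded_integrable _ _ _ _ _ 1); first exact: measurable_cos_affine.
by move=> w; rewrite cos_max.
Qed.

(** Fatou on the substitutes for the square gives integrability; dominated convergence then
    identifies the second moment, and the mean through the sine substitutes, whose integrals
    vanish. *)
Lemma gaussian_law_moments (m s : R) Y : measurable_fun setT Y -> 0 <= s ->
  (forall B : set R, measurable B -> P (Y @^-1` B) = gaussian_law m s B) ->
  [/\ P.-integrable setT (EFin \o (fun w => (Y w - m) ^+ 2)),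
      \int[P]_w (Y w - m) ^+ 2 = s ^+ 2 & \int[P]_w Y w = m].
Proof.
move=> mY s0 law.
have mYm : measurable_fun setT (fun w => Y w - m) by exact: measurable_funB.
have PT : \int[P]_w (1 : R) = 1.
  exact: Rintegral_cst_probability.
pose q n w := 2 * (1 - cos ((Y w - m) * dl n)) / dl n ^+ 2.
have qE n w : q n w = 2 / dl n ^+ 2 * (cst 1 w - cos (dl n * (Y w - m) + 0)).
  by rewrite /q addr0 [dl n * _]mulrC mulrAC.
have mq n : measurable_fun setT (q n).
  rewrite /q; apply: measurable_funM => //; apply: measurable_funM => //.
  apply: measurable_funB => //.
  have := @measurable_cos_affine (fun w => Y w - m) (dl n) 0 mYm.
  by under eq_fun do rewrite addr0 mulrC.
have Eq n : (\int[P]_w (q n w)%:E = (2 * (1 - expR (- (s ^+ 2 * dl n ^+ 2 / 2))) / dl n ^+ 2)%:E)%E.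
  have i1 : P.-integrable setT (EFin \o cst (1 : R)) by exact: finite_measure_integrable_cst.
  have i2 : P.-integrable setT (EFin \o (fun w => cos (dl n * (Y w - m) + 0))).
    exact: integrable_cos_affine.
  have iB : P.-integrable setT (EFin \o (fun w => cst 1 w - cos (dl n * (Y w - m) + 0))).
    exact: (integrableB measurableT i1 i2).
  rewrite -[LHS]fineK; last first.
    apply: (integrable_fin_num measurableT); apply: (@bounded_integrable _ _ _ _ _ (4 / dl n ^+ 2)) => // w.
    rewrite ger0_norm ?cos_scaled_ge0//; rewrite ler_wpM2r ?invr_ge0 ?sqr_ge0//.
    by have := cos_geN1 ((Y w - m) * dl n); lra.
  congr EFin; transitivity (\int[P]_w (2 / dl n ^+ 2 * (cst 1 w - cos (dl n * (Y w - m) + 0)))).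
    by apply: eq_Rintegral => w _; rewrite -qE.
  rewrite (RintegralZl _ measurableT iB) (RintegralB measurableT i1 i2) PT.
  by rewrite (gaussian_law_cos 0 (dl n) mY s0 law) cos0 mul1r mulrAC.
have i2 : P.-integrable setT (EFin \o (fun w => (Y w - m) ^+ 2)).
  apply/integrableP; split; first by apply/measurable_EFinP; exact: measurable_funX.
  apply: (@le_lt_trans _ _ (s ^+ 2)%:E); last exact: ltry.
  under eq_integral => w _ do rewrite /= ger0_norm ?sqr_ge0//.
  have := @fatou _ _ _ P setT measurableT (fun n => EFin \o q n) (fun n => (measurable_EFinP _ _).2 (mq n))
    (fun n w _ => cos_scaled_ge0 (Y w - m) n).
  have cq w : (EFin \o q n) w @[n --> \oo] --> ((Y w - m) ^+ 2)%:E.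
    by apply: cvg_EFin; [exact: nearW|exact: cvg_cos_scaled].
  under eq_integral => w _.
    rewrite is_cvg_limn_einfE; last by apply/cvg_ex; exists ((Y w - m) ^+ 2)%:E; exact: cq.
    rewrite (cvg_lim _ (cq w))//; over.
  move=> h; apply: (le_trans h).
  have cs : (\int[P]_w (EFin \o q n) w)%E @[n --> \oo] --> (s ^+ 2)%:E.
    under eq_fun do rewrite /= Eq.
    by apply: cvg_EFin; [exact: nearW|exact: cvg_exp_scaled].
  rewrite is_cvg_limn_einfE; last by apply/cvg_ex; exists (s ^+ 2)%:E.
  by rewrite (cvg_lim _ cs).
have iYm : P.-integrable setT (EFin \o (fun w => Y w - m)) by exact: integrable_sqr.
split => //.
- have qb n w : `|q n w| <= (Y w - m) ^+ 2.
    by rewrite ger0_norm ?cos_scaled_ge0// cos_scaled_le.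
  have [_ c1] := cvg_Rintegral_dominated mq (measurable_funX 2 mYm)
    (fun w => @cvg_cos_scaled _ (Y w - m)) i2 qb.
  have c3 : \int[P]_w q n w @[n --> \oo] --> s ^+ 2.
    by under eq_fun do rewrite /Rintegral Eq /=; exact: cvg_exp_scaled.
  by rewrite -(cvg_lim _ c1)// (cvg_lim _ c3).
pose r n w := sin ((Y w - m) * dl n) / dl n.
have mr n : measurable_fun setT (r n).
  apply: measurable_funM => //; apply: measurableT_comp.
    by apply: continuous_measurable_fun; exact: continuous_sin.
  exact: measurable_funM.
have [_ c2] := cvg_Rintegral_dominated mr mYm (fun w => @cvg_sin_scaled _ (Y w - m))
  (integrable_abse iYm) (fun n w => sin_scaled_le (Y w - m) n).
have r0 n : \int[P]_w r n w = 0.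
  transitivity (\int[P]_w ((dl n)^-1 * cos (dl n * (Y w - m) + - (pi / 2)))).
    by apply: eq_Rintegral => w _; rewrite /r cosBpihalf [_ * dl n]mulrC [LHS]mulrC.
  have ic : P.-integrable setT (EFin \o (fun w => cos (dl n * (Y w - m) + - (pi / 2)))).
    exact: integrable_cos_affine.
  rewrite (RintegralZl _ measurableT ic).
  by rewrite (gaussian_law_cos (- (pi / 2)) (dl n) mY s0 law) cosN cos_pihalf mul0r mulr0.
have Em : \int[P]_w (Y w - m) = 0.
  by rewrite -(cvg_lim _ c2)//; under eq_fun do rewrite r0; exact: lim_cst.
have im : P.-integrable setT (EFin \o cst m) by exact: finite_measure_integrable_cst.
have E w : Y w = (Y w - m) + cst m w by rewrite subrK.
rewrite (_ : \int[P]_w Y w = \int[P]_w ((Y w - m) + cst m w)); last by apply: eq_Rintegral => w _; rewrite -E.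
rewrite (RintegralD measurableT iYm im) Em add0r.
exact: Rintegral_cst_probability.
Qed.

Lemma centered_gaussian_cos Y : measurable_fun setT Y -> is_gaussian P Y ->
  \int[P]_w Y w = 0 ->
  P.-integrable setT (EFin \o (fun w => Y w ^+ 2)) /\
  forall beta, \int[P]_w cos (Y w + beta) = cos beta * expR (- (\int[P]_w (Y w ^+ 2) / 2)).
Proof.
move=> mY [m [s [s0 law]]] EY; have [i2 E2 E1] := gaussian_law_moments mY s0 law.
have m0 : m = 0 by rewrite -E1 EY.
rewrite {}m0 in i2 E2 law.
have E : (fun w => (Y w - 0) ^+ 2) = (fun w => Y w ^+ 2).
  by apply/funext => w; rewrite subr0.
rewrite {}E in i2 E2; split=> // beta; rewrite E2.
have := gaussian_law_cos beta 1 mY s0 law; rewrite expr1n mulr1 => <-.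
by apply: eq_Rintegral => w _; rewrite mul1r subr0.
Qed.

End square_integrable.

(** * The sign function as a limit of polynomials *)

Section sign_iteration.
Context {R : realType}.
Implicit Types y : R.

(** On [-1, 1] this map attracts to 1 or -1 and repels from 0, so its iterates converge to the
    sign. *)
Definition sgn_step y : R := (3 * y - y ^+ 3) / 2.

Lemma sgn_step_ge0 y : 0 <= y <= 1 -> y <= sgn_step y <= 1.
Proof.
move=> /andP[y0 y1]; have h : y ^+ 2 <= 1 by rewrite expr_le1.
by rewrite /sgn_step; apply/andP; split; nra.
Qed.

Lemma sgn_stepN y : sgn_step (- y) = - sgn_step y.
Proof. by rewrite /sgn_step; ring. Qed.

Lemma iter_sgn_stepN n y : iter n sgn_step (- y) = - iter n sgn_step y.
Proof. by elim: n => //= n ->; rewrite sgn_stepN. Qed.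

Lemma iter_sgn_step_ge0 n y : 0 <= y <= 1 -> y <= iter n sgn_step y <= 1.
Proof.
move=> y01; elim: n => [|n /andP[h1 h2]] /=; first by case/andP: y01 => _ ->; rewrite lexx.
have y0 : 0 <= iter n sgn_step y by apply: le_trans h1; case/andP: y01.
have /andP[h3 ->] := @sgn_step_ge0 (iter n sgn_step y) ltac:(by rewrite y0 h2).
by rewrite (le_trans h1 h3).
Qed.

Lemma iter_sgn_step_bound n y : `|y| <= 1 -> `|iter n sgn_step y| <= 1.
Proof.
wlog y0 : y / 0 <= y => [hw|].
  have [y0|/ltW y0] := leP 0 y; first exact: hw.
  by have := hw (- y); rewrite oppr_ge0 iter_sgn_stepN !normrN; exact.
rewrite ger0_norm// => y1; have /andP[h1 h2] := @iter_sgn_step_ge0 n y ltac:(by rewrite y0).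
by rewrite ger0_norm// (le_trans y0).
Qed.

Lemma cvg_iter_sgn_step y : `|y| <= 1 -> iter n sgn_step y @[n --> \oo] --> Num.sg y.
Proof.
wlog y0 : y / 0 < y => [hw|y1].
  move=> yb; have [y0|y0|y0] := ltgtP y 0; last first.
  - rewrite y0 sgr0; apply: cvg_near_cst; apply: nearW => n.
    by elim: n => //= n ->; rewrite /sgn_step; ring.
  - exact: hw.
  - have := hw (- y); rewrite oppr_gt0 normrN sgrN => /(_ y0 yb) c.
    have -> : (fun n => iter n sgn_step y) = (fun n => - iter n sgn_step (- y)).
      by apply/funext => n; rewrite iter_sgn_stepN opprK.
    by rewrite -[Num.sg y]opprK; exact: cvgN.
rewrite gtr0_norm// in y1; rewrite gtr0_sg//.
have y01 : 0 <= y <= 1 by rewrite ltW.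
have key n : 1 - (1 - y / 2) ^+ n <= iter n sgn_step y.
  elim: n => [|n IH]; first by rewrite expr0 subrr ltW.
  have /andP[h1 h2] := iter_sgn_step_ge0 n y01.
  rewrite exprS iterS; move: (iter n sgn_step y) h1 h2 IH => z h1 h2.
  move: (_ ^+ n) => q IH; rewrite /sgn_step.
  (* In this form the distance to 1 shrinks at least by the factor 1 - y / 2. *)
  have -> : (3 * z - z ^+ 3) / 2 = 1 - (1 - z) * (1 - (z + z ^+ 2) / 2) by field.
  have h3 : 1 - (z + z ^+ 2) / 2 <= 1 - y / 2 by have := sqr_ge0 z; lra.
  have h4 : 0 <= 1 - z by lra.
  have h5 : 0 <= 1 - y / 2 by lra.
  rewrite lerD2l lerN2 mulrC; apply: (@le_trans _ _ ((1 - y / 2) * (1 - z))).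
    by rewrite ler_wpM2r.
  by rewrite ler_wpM2l//; lra.
apply: (@squeeze_cvgr _ _ _ _ (fun n => 1 - (1 - y / 2) ^+ n) (cst 1)).
- by apply: nearW => n; rewrite key /=; have /andP[_ ->] := iter_sgn_step_ge0 n y01.
- rewrite -[X in _ --> X]subr0; apply: cvgB; first exact: cvg_cst.
  by apply: cvg_expr; rewrite ger0_norm; lra.
- exact: cvg_cst.
Qed.

Lemma cvg_sgn_sin_scaled y : Num.sg (sin (y * n.+1%:R^-1)) @[n --> \oo] --> Num.sg y.
Proof.
apply: cvg_near_cst.
wlog y0 : y / 0 < y => [hw|].
  have [y0|y0|->] := ltgtP y 0; [|exact: hw|].
  - have := hw (- y); rewrite oppr_gt0 => /(_ y0); apply: filterS => n.
    by rewrite mulNr sinN !sgrN => /eqP; rewrite eqr_opp => /eqP.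
  - by apply: nearW => n; rewrite mul0r sin0.
near=> n; rewrite [RHS]gtr0_sg// gtr0_sg// sin_gt0_pi// mulr_gt0//=.
rewrite ltr_pdivrMr//; apply: (@lt_le_trans _ _ n%:R).
  by near: n; exact: nbhs_infty_gtr.
apply: (@le_trans _ _ n.+1%:R); first by rewrite ler_nat.
by rewrite ler_peMl//; apply: ltW; have := @pi_gt14_5 R; lra.
Unshelve. all: by end_near. Qed.

End sign_iteration.

(** * From orthogonality to cosines to the generated sigma-algebra *)

Section trigonometric_multipliers.
Context {R : realType} d (Omega : measurableType d) (P : probability Omega R).
Context {n : nat} (X : 'I_n -> Omega -> R).
Hypothesis mX : forall k, measurable_fun setT (X k).
Implicit Types V W g : Omega -> R.

Definition trig (c : 'I_n -> R) (beta : R) : Omega -> R :=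
  fun w => cos (\sum_k c k * X k w + beta).

Definition trig_orthogonal V := P.-integrable setT (EFin \o V) /\
  forall c beta, \int[P]_w (V w * trig c beta w) = 0.

(** Multipliers form an algebra closed under bounded pointwise limits, which is how indicators of
    the generated sigma-algebra are reached. Orthogonality of V 1_A to the cosine with c = 0 and
    beta = 0 then says that V integrates to zero over A. *)
Definition trig_multiplier g := [/\ measurable_fun setT g,
  exists M, forall w, `|g w| <= M &
  forall V, trig_orthogonal V -> trig_orthogonal (fun w => V w * g w)].

Lemma measurable_trig c beta : measurable_fun setT (trig c beta).
Proof.
apply: measurableT_comp; first by apply: continuous_measurable_fun; exact: continuous_cos.
apply: measurable_funD => //; apply: measurable_sum => k.
exact: measurable_funM.
Qed.

Lemma integrable_mul_bounded V g (M : R) : P.-integrable setT (EFin \o V) ->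
  measurable_fun setT g -> (forall w, `|g w| <= M) ->
  P.-integrable setT (EFin \o (fun w => V w * g w)).
Proof.
move=> iV mg gM; have mV : measurable_fun setT V.
  by apply/measurable_EFinP; case/integrableP: iV.
apply: (le_integrable measurableT _ _ (integrableZl measurableT M (integrable_abse iV))).
  by apply/measurable_EFinP; exact: measurable_funM.
move=> w _; rewrite /= lee_fin normrM mulrC.
apply: le_trans (ler_norm _); rewrite ler_wpM2r//.
Qed.

Lemma integrable_mul_trig V c beta : P.-integrable setT (EFin \o V) ->
  P.-integrable setT (EFin \o (fun w => V w * trig c beta w)).
Proof.
move=> iV; apply: (@integrable_mul_bounded _ _ 1) => //; first exact: measurable_trig.
by move=> w; rewrite cos_max.
Qed.

Lemma trig_orthogonal_lin a b V W : trig_orthogonal V -> trig_orthogonal W ->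
  trig_orthogonal (fun w => a * V w + b * W w).
Proof.
move=> [iV oV] [iW oW].
have iZ (e : R) (U : Omega -> R) : P.-integrable setT (EFin \o U) ->
    P.-integrable setT (EFin \o (fun w => e * U w)).
  by move=> iU; exact: (integrableZl measurableT e iU).
split=> [|c beta]; first exact: (integrableD measurableT (iZ a V iV) (iZ b W iW)).
have iVt := integrable_mul_trig c beta iV; have iWt := integrable_mul_trig c beta iW.
transitivity (\int[P]_w (a * (V w * trig c beta w) + b * (W w * trig c beta w))).
  by apply: eq_Rintegral => w _; ring.
rewrite (RintegralD measurableT (iZ a _ iVt) (iZ b _ iWt)).
by rewrite (RintegralZl _ measurableT iVt) (RintegralZl _ measurableT iWt) oV oW !mulr0 addr0.
Qed.

Lemma trig_multiplier_cst a : trig_multiplier (cst a).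
Proof.
split=> //; first by exists `|a|.
move=> V oV; have := trig_orthogonal_lin a 0 oV oV.
by congr trig_orthogonal; apply/funext => w; rewrite mul0r addr0 mulrC.
Qed.

Lemma trig_multiplier_lin a b g1 g2 : trig_multiplier g1 -> trig_multiplier g2 ->
  trig_multiplier (fun w => a * g1 w + b * g2 w).
Proof.
move=> [m1 [M1 b1] h1] [m2 [M2 b2] h2]; split.
- by apply: measurable_funD; exact: measurable_funM.
- exists (`|a| * M1 + `|b| * M2) => w; apply: (le_trans (ler_normD _ _)).
  by rewrite !normrM lerD// ler_wpM2l.
- move=> V oV; have := trig_orthogonal_lin a b (h1 V oV) (h2 V oV).
  by congr trig_orthogonal; apply/funext => w; ring.
Qed.

Lemma trig_multiplier_mul g1 g2 : trig_multiplier g1 -> trig_multiplier g2 ->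
  trig_multiplier (fun w => g1 w * g2 w).
Proof.
move=> [m1 [M1 b1] h1] [m2 [M2 b2] h2]; split.
- exact: measurable_funM.
- exists (M1 * M2) => w; rewrite normrM ler_pM//.
- move=> V oV; have := h2 _ (h1 V oV).
  by congr trig_orthogonal; apply/funext => w; ring.
Qed.

Lemma trig_multiplier_lim (gs : nat -> Omega -> R) g (M : R) :
  (forall i, trig_multiplier (gs i)) -> (forall i w, `|gs i w| <= M) ->
  (forall w, gs i w @[i --> \oo] --> g w) -> trig_multiplier g.
Proof.
move=> hgs gsM cgs.
have mgs i : measurable_fun setT (gs i) by case: (hgs i).
have mg : measurable_fun setT g.
  by apply: (measurable_fun_cvg mgs) => w _; exact: cgs.
have gM w : `|g w| <= M.
  have c1 : `|gs i w| @[i --> \oo] --> `|g w| by apply: cvg_norm; exact: cgs.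
  rewrite -(cvg_lim _ c1)//; apply: limr_le; first by apply/cvg_ex; exists `|g w|.
  by apply: nearW => i; exact: gsM.
split=> //; first by exists M.
move=> V oV; have [iV _] := oV; have iVg := integrable_mul_bounded iV mg gM.
have mV : measurable_fun setT V by apply/measurable_EFinP; case/integrableP: iV.
split=> // c beta.
have mt := measurable_trig c beta.
have hb i w : `|V w * gs i w * trig c beta w| <= M * `|V w|.
  rewrite !normrM [M * _]mulrC -mulrA ler_wpM2l// -[leRHS]mulr1.
  by rewrite ler_pM// cos_max.
have [_ h] := @cvg_Rintegral_dominated _ _ _ P (fun i w => V w * gs i w * trig c beta w)
  (fun w => V w * g w * trig c beta w) (fun w => M * `|V w|)
  (fun i => measurable_funM (measurable_funM mV (mgs i)) mt)
  (measurable_funM (measurable_funM mV mg) mt)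
  (fun w => cvgM (cvgM (cvg_cst (V w)) (cgs w)) (cvg_cst (trig c beta w)))
  (integrableZl measurableT M (integrable_abse iV)) hb.
rewrite -(cvg_lim _ h)//.
rewrite [X in lim X](_ : _ = (cst 0) @ \oo) ?lim_cst//.
congr (_ @ \oo); apply/funext => i; have [_ _ hV] := hgs i.
by have [_ ->] := hV V oV.
Qed.

(** A product of two cosines is half the sum of the cosines with frequencies c + c' and c - c'. *)
Lemma trig_multiplier_trig c beta : trig_multiplier (trig c beta).
Proof.
split; [exact: measurable_trig|by exists 1 => w; rewrite cos_max|].
move=> V [iV oV]; split=> [|c' beta']; first exact: integrable_mul_trig.
have i1 := integrable_mul_trig (fun k => c k + c' k) (beta + beta') iV.
have i2 := integrable_mul_trig (fun k => c k - c' k) (beta - beta') iV.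
transitivity (2^-1 * \int[P]_w (V w * trig (fun k => c k + c' k) (beta + beta') w +
    V w * trig (fun k => c k - c' k) (beta - beta') w)); last first.
  by rewrite (RintegralD measurableT i1 i2) !oV addr0 mulr0.
rewrite -(RintegralZl _ measurableT (integrableD measurableT i1 i2)).
apply: eq_Rintegral => w _; rewrite /trig.
under [X in cos (X + (beta + _))]eq_bigr do rewrite mulrDl.
under [X in cos (X + (beta - _))]eq_bigr do rewrite mulrBl.
rewrite big_split /= sumrB; move: (\sum_k _ * _) (\sum_k _ * _) => A B.
rewrite addrACA [B - A + _]addrACA -opprD.
by move: (B + beta) (A + beta') => a b; rewrite cosD cosB; field.
Qed.
Lemma trig_multiplier_eq g1 g2 : trig_multiplier g1 -> g1 =1 g2 -> trig_multiplier g2.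
Proof. by move=> h /funext <-. Qed.

Lemma trig_multiplier_sin (k : 'I_n) (t b : R) :
  trig_multiplier (fun w => sin (t * (X k w - b))).
Proof.
apply: (trig_multiplier_eq (trig_multiplier_trig (fun j => (j == k)%:R * t) (- (t * b) - pi / 2))).
move=> w; rewrite /trig (bigD1 k)//= eqxx mul1r big1 ?addr0; last first.
  by move=> j /negbTE ->; rewrite !mul0r.
by rewrite addrA cosBpihalf mulrBr.
Qed.

Lemma trig_multiplier_iter i g : trig_multiplier g ->
  trig_multiplier (fun w => iter i sgn_step (g w)).
Proof.
move=> hg; elim: i => //= i; set u := fun w => iter i sgn_step (g w) => hu.
have hu2 := trig_multiplier_mul hu (trig_multiplier_mul hu hu).
apply: (trig_multiplier_eq (trig_multiplier_lin (3 / 2) (- (1 / 2)) hu hu2)) => w.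
by rewrite /sgn_step -/(u w); field.
Qed.

(** A sine of t (X - b) is a cosine with shifted phase. Iterating [sgn_step] on it gives the sign of
    the sine, and t tending to 0 gives the sign of X - b. *)
Lemma trig_multiplier_sg (k : 'I_n) (b : R) :
  trig_multiplier (fun w => Num.sg (X k w - b)).
Proof.
have sg1 (x : R) : `|Num.sg x| <= 1 by rewrite normr_sg lern1 leq_b1.
apply: (@trig_multiplier_lim
  (fun i w => Num.sg (sin ((X k w - b) * i.+1%:R^-1))) _ 1) => //; last first.
  by move=> w; exact: cvg_sgn_sin_scaled.
move=> i; apply: (@trig_multiplier_lim
  (fun j w => iter j sgn_step (sin (i.+1%:R^-1 * (X k w - b)))) _ 1).
- by move=> j; apply: trig_multiplier_iter; exact: trig_multiplier_sin.
- by move=> j w; rewrite iter_sgn_step_bound// sin_max.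
- by move=> w; rewrite mulrC; apply: cvg_iter_sgn_step; exact: sin_max.
Qed.

Lemma trig_multiplier_ray (k : 'I_n) (b : R) :
  trig_multiplier (\1_(X k @^-1` `]b, +oo[%classic)).
Proof.
have h := trig_multiplier_sg k b.
apply: (trig_multiplier_eq (trig_multiplier_lin (1 / 2) (1 / 2) h (trig_multiplier_mul h h))).
move=> w; have E : (w \in X k @^-1` `]b, +oo[%classic) = (0 < X k w - b).
  apply/idP/idP => [/set_mem|h0]; last apply/mem_set; rewrite /= in_itv /= andbT -subr_gt0 //.
by rewrite indicE E; case: sgrP => _ /=; field.
Qed.

(** The complement of a countable union has as indicator the limit of the finite products of
    complementary indicators. *)
Lemma trig_multiplier_sigma_algebra :
  sigma_algebra setT [set A : set Omega | trig_multiplier (\1_A)].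
Proof.
have hC A : trig_multiplier (\1_A) -> trig_multiplier (\1_(~` A)).
  move=> hA; apply: (trig_multiplier_eq (trig_multiplier_lin 1 (- 1) (trig_multiplier_cst 1) hA)).
  by move=> w; rewrite !indicE in_setC; case: (w \in A); rewrite /=; ring.
split.
- apply: (trig_multiplier_eq (trig_multiplier_cst 0)) => w.
  by rewrite indicE in_set0.
- by move=> A hA; rewrite /= setTD; exact: hC.
move=> A hA; rewrite /= -[\bigcup_k A k]setCK setC_bigcup; apply: (hC _).
pose g i w := \prod_(j < i) (\1_(~` A j) w : R).
apply: (@trig_multiplier_lim g _ 1).
- move=> i; elim: i => [|i IH].
    by apply: (trig_multiplier_eq (trig_multiplier_cst 1)) => w; rewrite /g big_ord0.
  apply: (trig_multiplier_eq (trig_multiplier_mul IH (hC _ (hA i)))) => w.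
  by rewrite /g big_ord_recr.
- move=> i w; rewrite /g normr_prod; apply: prodr_ile1 => j _ //.
  by rewrite normr_ge0 indicE /= normr_nat lern1 leq_b1.
- move=> w; rewrite indicE; have [h|h] := boolP (w \in \bigcap_i ~` A i).
    apply: cvg_near_cst; apply: nearW => i; rewrite /g big1// => j _.
    by rewrite indicE mem_set//; move/set_mem: h; apply.
  have [j Aj] : exists j, A j w.
    apply: contrapT => /forallNP hn; move/negP: h; apply; apply/mem_set => j _.
    exact: hn.
  apply: cvg_near_cst; near=> i; rewrite /g.
  have ji : (j < i)%N by near: i; exact: nbhs_infty_gt.
  by rewrite (bigD1 (Ordinal ji))//= indicE memNset ?mul0r//=; apply.
Unshelve. all: by end_near. Qed.

Lemma trig_multiplier_indic A : g_sigma_preimage X A -> trig_multiplier (\1_A).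
Proof.
apply: (smallest_sub trig_multiplier_sigma_algebra) => B.
suff : forall k, preimage_set_system setT (X k) measurable `<=`
    [set A : set Omega | trig_multiplier (\1_A)].
  move=> hk; elim/big_ind: _ => //; first by move=> C1 C2 h1 h2 [].
  by move=> k _; exact: hk.
move=> k _ [C mC <-]; rewrite setTI /=.
have [s0 sC sU] := trig_multiplier_sigma_algebra.
have : sigma_algebra setT [set C : set R | trig_multiplier (\1_(X k @^-1` C))].
  split=> /=; first by rewrite preimage_set0.
  - by move=> D hD; rewrite setTD preimage_setC -setTD; exact: sC.
  - by move=> D hD; rewrite preimage_bigcup; exact: sU.
move=> /smallest_sub hs; have mC' : (@ocitv R).-sigma.-measurable C by exact: mC.
rewrite RGenOInfty.measurableE in mC'.
by apply: hs mC' => D [b ->]; exact: trig_multiplier_ray.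
Qed.

Lemma trig_orthogonal_integral0 V A : trig_orthogonal V -> g_sigma_preimage X A ->
  measurable A -> (\int[P]_(w in A) (V w)%:E = 0)%E.
Proof.
move=> oV hA mA; have [_ _ h] := trig_multiplier_indic hA.
have [iVA /(_ (fun=> 0) 0) hz] := h V oV.
rewrite integral_mkcond.
rewrite -[LHS]fineK; last first.
  apply: (integrable_fin_num measurableT).
  apply/(integrable_mkcond _ mA); apply: (integrableS measurableT mA) => //.
  by case: oV.
congr EFin; rewrite -[RHS]hz; congr fine; apply: eq_integral => w _.
rewrite patchE /trig big1 ?addr0 ?cos0 ?mulr1; last by move=> k _; rewrite mul0r.
by rewrite indicE; case: (w \in A); rewrite ?mulr1 ?mulr0.
Qed.

End trigonometric_multipliers.

Section gaussian_trig_orthogonal.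
Context {R : realType} d (Omega : measurableType d) (P : probability Omega R).
Context {n : nat} (X : 'I_n -> Omega -> R) (W : Omega -> R) (s2 : R) (v : ('I_n -> R) -> R).
Hypothesis mX : forall k, measurable_fun setT (X k).
Hypothesis mW : measurable_fun setT W.
Hypothesis iW2 : P.-integrable setT (EFin \o (fun w => W w ^+ 2)).
Hypothesis cosWX : forall a c beta,
  \int[P]_w cos (a * W w + (\sum_k c k * X k w + beta)) =
  cos beta * expR (- (a ^+ 2 * s2 + v c) / 2).
Local Notation dl i := (i.+1%:R^-1 : R).

Let iW : P.-integrable setT (EFin \o W). Proof. exact: integrable_sqr. Qed.

Let icos a c beta : P.-integrable setT
  (EFin \o (fun w => cos (a * W w + (\sum_k c k * X k w + beta)))).
Proof.
apply: (@bounded_integrable _ _ _ _ _ 1); last by move=> w; rewrite cos_max.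
apply: measurableT_comp; first by apply: continuous_measurable_fun; exact: continuous_cos.
apply: measurable_funD; first exact: measurable_funM.
apply: measurable_funD => //; apply: measurable_sum => k; exact: measurable_funM.
Qed.

Lemma gaussian_trig_orthogonal : trig_orthogonal P X W.
Proof.
split=> // c beta; have mt := measurable_trig mX c beta.
have mr i : measurable_fun setT (fun w => sin (W w * dl i) / dl i * trig X c beta w).
  apply: measurable_funM => //; apply: measurable_funM => //; apply: measurableT_comp.
    by apply: continuous_measurable_fun; exact: continuous_sin.
  exact: measurable_funM.
have rb i w : `|sin (W w * dl i) / dl i * trig X c beta w| <= `|W w|.
  by rewrite normrM -[leRHS]mulr1 ler_pM// ?sin_scaled_le// cos_max.
have [_ h] := cvg_Rintegral_dominated mr (measurable_funM mW mt)
  (fun w => cvgM (@cvg_sin_scaled _ (W w)) (cvg_cst (trig X c beta w)))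
  (integrable_abse iW) rb.
rewrite -(cvg_lim _ h)// [X in lim X](_ : _ = cst 0 @ \oo) ?lim_cst//.
congr (_ @ \oo); apply/funext => i.
pose b := beta - pi / 2.
(* The integrand is a difference of cosines with W-frequencies d and -d, and [cosWX] depends on the
   square of that frequency only. *)
transitivity (\int[P]_w ((dl i)^-1 / 2 * (cos (dl i * W w + (\sum_k c k * X k w + b)) -
    cos (- dl i * W w + (\sum_k c k * X k w + b))))).
  apply: eq_Rintegral => w _; rewrite /trig /b [W w * _]mulrC [in RHS]mulNr !addrA !cosBpihalf.
  rewrite -!addrA [- _ + _]addrC; move: (dl i * W w) (_ + beta) => x y.
  by rewrite addrC sinD sinB; field; rewrite gt_eqF.
rewrite (RintegralZl _ measurableT (integrableB measurableT (icos _ _ _) (icos _ _ _))).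
by rewrite (RintegralB measurableT (icos _ _ _) (icos _ _ _)) !cosWX sqrrN subrr mulr0.
Qed.

Lemma gaussian_sqr_trig_orthogonal : trig_orthogonal P X (fun w => W w ^+ 2 - s2).
Proof.
have is2 : P.-integrable setT (EFin \o cst s2) by exact: finite_measure_integrable_cst.
split=> [|c beta]; first exact: (integrableB measurableT iW2 is2).
have mt := measurable_trig mX c beta.
have tE : trig X c beta = fun w => cos (0 * W w + (\sum_k c k * X k w + beta)).
  by apply/funext => w; rewrite mul0r add0r.
have Et : \int[P]_w trig X c beta w = cos beta * expR (- v c / 2).
  by rewrite tE cosWX expr0n mul0r add0r.
have it : P.-integrable setT (EFin \o trig X c beta) by rewrite tE; exact: icos.
have iWt := integrable_mul_trig mX c beta iW2.
suff E : \int[P]_w (W w ^+ 2 * trig X c beta w) = s2 * \int[P]_w trig X c beta w.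
  transitivity (\int[P]_w (W w ^+ 2 * trig X c beta w - s2 * trig X c beta w)).
    by apply: eq_Rintegral => w _; rewrite mulrBl.
  rewrite (RintegralB measurableT iWt (integrableZl measurableT s2 it)).
  by rewrite (RintegralZl _ measurableT it) E subrr.
pose q i w := 2 * (1 - cos (W w * dl i)) / dl i ^+ 2 * trig X c beta w.
have mr i : measurable_fun setT (q i).
  apply: measurable_funM => //; apply: measurable_funM => //; apply: measurable_funM => //.
  apply: measurable_funB => //; apply: measurableT_comp.
    by apply: continuous_measurable_fun; exact: continuous_cos.
  exact: measurable_funM.
have rb i w : `|q i w| <= W w ^+ 2.
  rewrite normrM ger0_norm ?cos_scaled_ge0// -[leRHS]mulr1.
  by rewrite ler_pM// ?cos_scaled_ge0 ?cos_scaled_le// cos_max.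
have [_ h] := cvg_Rintegral_dominated mr (measurable_funM (measurable_funX 2 mW) mt)
  (fun w => cvgM (@cvg_cos_scaled _ (W w)) (cvg_cst (trig X c beta w))) iW2 rb.
have h' : \int[P]_w q i w @[i --> \oo] --> s2 * \int[P]_w trig X c beta w.
  rewrite Et; have h2 := cvgM (@cvg_exp_scaled _ s2) (cvg_cst (cos beta * expR (- v c / 2))).
  suff E : (fun i => \int[P]_w q i w) = (fun i =>
    2 * (1 - expR (- (s2 * dl i ^+ 2 / 2))) / dl i ^+ 2 * (cos beta * expR (- v c / 2))).
    by rewrite E; exact: h2.
  apply/funext => i; transitivity (\int[P]_w ((dl i)^-2 * (2 * trig X c beta w -
     (cos (dl i * W w + (\sum_k c k * X k w + beta)) +
      cos (- dl i * W w + (\sum_k c k * X k w + beta)))))).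
    apply: eq_Rintegral => w _; rewrite /q /trig [W w * _]mulrC [in RHS]mulNr.
    move: (dl i * W w) (_ + beta) => x y.
    by rewrite [- x + y]addrC cosB cosD; ring.
  have i2 := integrableZl measurableT 2 it.
  have i3 := integrableD measurableT (icos (dl i) c beta) (icos (- dl i) c beta).
  rewrite (RintegralZl _ measurableT (integrableB measurableT i2 i3)).
  rewrite (RintegralB measurableT i2 i3) (RintegralZl _ measurableT it).
  rewrite (RintegralD measurableT (icos _ _ _) (icos _ _ _)) !cosWX sqrrN Et /=.
  have eE x : expR (- (x + v c) / 2) = expR (- (x / 2)) * expR (- v c / 2).
    by rewrite -expRD; congr expR; ring.
  by rewrite eE [dl i ^+ 2 * s2]mulrC; ring.
by rewrite -(cvg_lim _ h)// (cvg_lim _ h').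
Qed.

Lemma gaussian_independent_integral A : g_sigma_preimage X A -> measurable A ->
  (\int[P]_(w in A) (W w)%:E = 0)%E /\
  (\int[P]_(w in A) (W w ^+ 2)%:E = s2%:E * P A)%E.
Proof.
move=> GA mA; split; first exact: (trig_orthogonal_integral0 mX gaussian_trig_orthogonal).
have := trig_orthogonal_integral0 mX gaussian_sqr_trig_orthogonal GA mA.
have i1 : P.-integrable A (EFin \o (fun w => W w ^+ 2)) by apply: (integrableS measurableT mA _ iW2).
have i2 : P.-integrable A (EFin \o cst s2) by exact: finite_measure_integrable_cst.
under eq_integral do rewrite EFinB.
rewrite (integralB mA i1 i2) [X in (_ - X)%E](_ : _ = s2%:E * P A)%E; last first.
  exact: (integral_cst P mA (s2%:E)).
have : (\int[P]_(x in A) (W x ^+ 2)%:E)%E \is a fin_num by exact: (integrable_fin_num mA).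
have : (s2%:E * P A)%E \is a fin_num by rewrite fin_numM// fin_num_measure.
rewrite /=; case: (s2%:E * P A)%E => // y _; case: (\int[P]_(x in A) _)%E => // x _.
by rewrite -EFinB => -[] /eqP; rewrite subr_eq0 => /eqP ->.
Qed.

End gaussian_trig_orthogonal.

(** * Versions of conditional expectations and variances *)

Section conditional_expectation.
Context {R : realType} d (Omega : measurableType d) (P : probability Omega R).
Context (U : set (set Omega)).
Hypothesis mU : <<s U >> `<=` measurable.
Local Notation G := <<s U >>.
Implicit Types Y Z : Omega -> R.

Let measG Z : (forall B : set R, measurable B -> G (Z @^-1` B)) <->
  @measurable_fun _ _ (g_sigma_algebraType U) R setT Z.
Proof.
split=> [h _ B mB|h B mB]; first by rewrite setTI; exact: h.
by have := h measurableT B mB; rewrite setTI.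
Qed.

(** The sets where the difference is positive, respectively negative, belong to the sigma-algebra;
    the difference integrates to zero over each and so vanishes there almost everywhere. *)
Lemma cond_expectation_unique Y Z1 Z2 : is_cond_expectation P G Y Z1 ->
  is_cond_expectation P G Y Z2 -> {ae P, forall w, Z1 w = Z2 w}.
Proof.
move=> [/measG m1 i1 E1] [/measG m2 i2 E2].
pose D w := Z1 w - Z2 w.
have mD : @measurable_fun _ _ (g_sigma_algebraType U) R setT D by exact: measurable_funB.
have iD : P.-integrable setT (EFin \o D) by exact: (integrableB measurableT i1 i2).
have D0 A : G A -> (\int[P]_(w in A) (D w)%:E = 0)%E.
  move=> GA; have mA := mU GA.
  have i1A : P.-integrable A (EFin \o Z1) by exact: (integrableS measurableT mA _ i1).
  have i2A : P.-integrable A (EFin \o Z2) by exact: (integrableS measurableT mA _ i2).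
  under eq_integral do rewrite /D EFinB.
  rewrite (integralB mA i1A i2A) /= E1// E2// subee//.
  by rewrite -E2//; exact: (integrable_fin_num mA).
have GD := (measG D).2 mD.
have Gp : G (D @^-1` `]0, +oo[%classic) by exact: GD.
have Gn : G (D @^-1` `]-oo, 0[%classic) by exact: GD.
have ae1 A : G A -> (forall w, A w -> 0 <= D w) -> ae_eq P A (EFin \o D) (cst 0%E).
  move=> GA A0; have mA := mU GA.
  apply/(ae_eq_integral_abs _ mA).
    by apply: measurable_funTS; case/integrableP: iD.
  rewrite -[RHS](D0 _ GA); apply: eq_integral => w /set_mem Aw /=.
  by rewrite ger0_norm// A0.
have ae2 A : G A -> (forall w, A w -> D w <= 0) -> ae_eq P A (EFin \o D) (cst 0%E).
  move=> GA A0; have mA := mU GA.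
  apply/(ae_eq_integral_abs _ mA).
    by apply: measurable_funTS; case/integrableP: iD.
  have iDA : P.-integrable A (EFin \o D) by exact: (integrableS measurableT mA _ iD).
  rewrite -[RHS]oppe0 -[in RHS](D0 _ GA) -(integralN _)//; last first.
    by apply: integrable_add_def.
  by apply: eq_integral => w /set_mem Aw /=; rewrite ler0_norm// A0.
have h1 := ae1 _ Gp _; have h2 := ae2 _ Gn _.
have {}h1 : ae_eq P (D @^-1` `]0, +oo[%classic) (EFin \o D) (cst 0%E).
  by apply: h1 => w; rewrite /= in_itv /= andbT => /ltW.
have {}h2 : ae_eq P (D @^-1` `]-oo, 0[%classic) (EFin \o D) (cst 0%E).
  by apply: h2 => w; rewrite /= in_itv /= => /ltW.
apply: filterS2 h1 h2 => w h1 h2; apply/eqP; rewrite -subr_eq0 -/(D w).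
have [Dn|Dp|//] := ltgtP (D w) 0.
- by have := h2; rewrite /= in_itv /= Dn => /(_ isT) -[E]; move: Dn; rewrite E ltxx.
- by have := h1; rewrite /= in_itv /= Dp => /(_ isT) -[E]; move: Dp; rewrite E ltxx.
Qed.

Lemma cond_expectationP Y Z : is_cond_expectation P G Y Z ->
  is_cond_expectation P G Y (cond_expectation P G Y).
Proof. by move=> h; apply: (@getPex _ (is_cond_expectation P G Y)); exists Z. Qed.

(** Z is a version of the conditional expectation, so the epsilon-chosen version agrees with it
    almost surely and the squared residuals have the same integrals; the constant [s2] is then a
    version of the conditional variance. *)
Lemma cond_variance_cst Y Z (s2 : R) : measurable_fun setT Y ->
  P.-integrable setT (EFin \o Z) ->
  (forall B : set R, measurable B -> G (Z @^-1` B)) ->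
  (forall A, G A -> (\int[P]_(w in A) (Y w)%:E = \int[P]_(w in A) (Z w)%:E)%E) ->
  (forall A, G A -> (\int[P]_(w in A) ((Y w - Z w) ^+ 2)%:E = s2%:E * P A)%E) ->
  {ae P, forall w, cond_variance P G Y w = s2}.
Proof.
move=> mY iZ GZ EZ EW.
have hZ : is_cond_expectation P G Y Z by split => // A GA; rewrite EZ.
have hE := cond_expectationP hZ.
have aeE := cond_expectation_unique hE hZ.
set Ecd := cond_expectation P G Y in hE aeE *.
have mE : measurable_fun setT Ecd by case: hE => _ /integrableP[/measurable_EFinP].
have mZ : measurable_fun setT Z by case/integrableP: iZ => /measurable_EFinP.
have hV : is_cond_expectation P G (fun w => (Y w - Ecd w) ^+ 2) (cst s2).
  split.
  - exact: (measG _).2.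
  - exact: finite_measure_integrable_cst.
  - move=> A GA; have mA := mU GA.
    transitivity (\int[P]_(w in A) ((Y w - Z w) ^+ 2)%:E)%E.
      by rewrite EW//; exact: (integral_cst P mA s2%:E).
    apply: ae_eq_integral => //.
    + by apply/measurable_EFinP; apply: measurable_funTS; apply: measurable_funX; exact: measurable_funB.
    + by apply/measurable_EFinP; apply: measurable_funTS; apply: measurable_funX; exact: measurable_funB.
    + by apply: filterS aeE => w /= -> _.
exact: (cond_expectation_unique (cond_expectationP hV) hV).
Qed.

End conditional_expectation.

(** * Linear prediction in a Gaussian field *)

Section gaussian_field.
Context {R : realType} d (Omega : measurableType d) (P : probability Omega R).
Context {N : nat} (X : 'rV[R]_N -> {RV P >-> R}).
Hypothesis gX : gaussian_field X.
Hypothesis cX : centered_field X.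
Implicit Types t u : 'rV[R]_N.

Lemma RintegralE_expectation t : \int[P]_w X t w = 0.
Proof. by have := cX t; rewrite unlock /Rintegral => ->. Qed.

Let mXt t : measurable_fun setT (X t). Proof. exact: measurable_funPT. Qed.

Lemma field_sqr_integrable t : P.-integrable setT (EFin \o (fun w => X t w ^+ 2)).
Proof.
have := gX (fun _ : 'I_1 => t) (fun=> 1).
have -> : (fun w => \sum_(i < 1) 1 * X t w) = X t :> (Omega -> R).
  by apply/funext => w; rewrite big_ord1 mul1r.
move=> g; have [] := centered_gaussian_cos (mXt t) g => //.
exact: RintegralE_expectation.
Qed.

Lemma field_integrable t : P.-integrable setT (EFin \o X t).
Proof. exact: integrable_sqr (mXt t) (field_sqr_integrable t). Qed.

Lemma field_mul_integrable t u : P.-integrable setT (EFin \o (fun w => X t w * X u w)).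
Proof. by apply: integrable_sqr_mul => //; exact: field_sqr_integrable. Qed.

Lemma covariance_functionE t u : covariance_function X t u = \int[P]_w (X t w * X u w).
Proof. by rewrite /covariance_function unlock. Qed.

Section lincomb.
Context {n : nat} (t : 'I_n -> 'rV[R]_N) (a : 'I_n -> R).
Let Y w := \sum_i a i * X (t i) w.

Lemma measurable_field_lincomb : measurable_fun setT Y.
Proof. by apply: measurable_sum => i; exact: measurable_funM. Qed.

Lemma field_lincomb_qform : (\int[P]_w (Y w ^+ 2)%:E = (qform X a t)%:E)%E.
Proof.
rewrite (integral_sqr_lincomb (fun i j => field_mul_integrable (t i) (t j)) a).
congr EFin; apply: eq_bigr => i _; apply: eq_bigr => j _.
by rewrite covariance_functionE.
Qed.

Lemma field_lincomb_centered : \int[P]_w Y w = 0.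
Proof.
rewrite /Rintegral (integral_lincomb a (fun i => field_integrable (t i))) /=.
by apply: big1 => i _; rewrite RintegralE_expectation mulr0.
Qed.

Lemma field_lincomb_cos : P.-integrable setT (EFin \o (fun w => Y w ^+ 2)) /\
  forall beta, \int[P]_w cos (Y w + beta) = cos beta * expR (- (qform X a t / 2)).
Proof.
have [h1 h2] := centered_gaussian_cos measurable_field_lincomb (gX t a) field_lincomb_centered.
split=> // beta; rewrite h2; congr (_ * expR (- (_ / 2))).
by rewrite /Rintegral field_lincomb_qform.
Qed.

End lincomb.

Lemma qform_ge0 n (t : 'I_n -> 'rV[R]_N) a : 0 <= qform X a t.
Proof.
rewrite -lee_fin -field_lincomb_qform; apply: integral_ge0 => w _.
by rewrite lee_fin sqr_ge0.
Qed.

(** A combination of zero variance vanishes almost surely, hence is uncorrelated with every X(u). *)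
Lemma field_null_lincomb n (t : 'I_n -> 'rV[R]_N) (z : 'I_n -> R) u : qform X z t = 0 ->
  \sum_k z k * covariance_function X u (t k) = 0.
Proof.
move=> q0; pose Z w := \sum_k z k * X (t k) w.
have mZ : measurable_fun setT Z by exact: measurable_field_lincomb.
have Z0 : ae_eq P setT (EFin \o (fun w => Z w ^+ 2)) (cst 0%E).
  apply/(ae_eq_integral_abs _ measurableT).
    by apply/measurable_EFinP; exact: measurable_funX.
  transitivity (\int[P]_w (Z w ^+ 2)%:E)%E; last by rewrite field_lincomb_qform q0.
  by apply: eq_integral => w _; rewrite /= ger0_norm ?sqr_ge0.
transitivity (\int[P]_w (X u w * Z w)).
  rewrite /Rintegral.
  transitivity (fine (\int[P]_w (\sum_k z k * (X u w * X (t k) w))%:E)%E).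
    rewrite (integral_lincomb z (fun k => field_mul_integrable u (t k))) /=.
    by apply: eq_bigr => k _; rewrite covariance_functionE.
  congr fine; apply: eq_integral => w _; congr EFin.
  by rewrite mulr_sumr; apply: eq_bigr => k _; rewrite mulrCA.
rewrite /Rintegral (ae_eq_integral (cst 0%E)) ?integral0//.
  by apply/measurable_EFinP; exact: measurable_funM.
apply: filterS Z0 => w /= /(_ Logic.I) -[/eqP]; rewrite sqrf_eq0 => /eqP -> _.
by rewrite mulr0.
Qed.

(** The covariance matrix may be singular. The system is still solvable: each vector of the kernel
    gives a combination of zero variance, to which the right-hand side is orthogonal by
    [field_null_lincomb]. *)
Lemma field_normal_equations n (t : 'I_n -> 'rV[R]_N) u : exists a : 'I_n -> R,
  forall k, covariance_function X u (t k) = \sum_j a j * covariance_function X (t j) (t k).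
Proof.
pose K : 'M[R]_n := \matrix_(i, j) covariance_function X (t i) (t j).
pose b : 'rV[R]_n := \row_k covariance_function X u (t k).
have /submxP[a ba] : (b <= K)%MS.
  rewrite submxE; apply/eqP/rowP => l; rewrite !mxE.
  pose z k := cokermx K k l.
  have Kz i : \sum_j covariance_function X (t i) (t j) * z j = 0.
    have := congr1 (fun M : 'M[R]_n => M i l) (mulmx_coker K).
    by rewrite !mxE => E; rewrite -[RHS]E; apply: eq_bigr => j _; rewrite mxE.
  have := @field_null_lincomb n t z u.
  rewrite /qform big1 => [/(_ erefl) E|i _].
    by rewrite -[RHS]E; apply: eq_bigr => k _; rewrite mxE mulrC.
  transitivity (z i * \sum_j covariance_function X (t i) (t j) * z j); last by rewrite Kz mulr0.
  by rewrite mulr_sumr; apply: eq_bigr => j _; ring.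
exists (fun j => a 0 j) => k.
have := congr1 (fun M : 'rV[R]_n => M 0 k) ba; rewrite !mxE => ->.
by apply: eq_bigr => j _; rewrite mxE.
Qed.

End gaussian_field.

Definition ford_cons (T : Type) n (x : T) (f : 'I_n -> T) (i : 'I_n.+1) : T :=
  oapp f x (unlift ord0 i).

Lemma ford_cons0 (T : Type) n (x : T) (f : 'I_n -> T) : ford_cons x f ord0 = x.
Proof. by rewrite /ford_cons unlift_none. Qed.

Lemma ford_consS (T : Type) n (x : T) (f : 'I_n -> T) k :
  ford_cons x f (lift ord0 k) = f k.
Proof. by rewrite /ford_cons liftK. Qed.

Section gaussian_conditional_variance.
Context {R : realType} d (Omega : measurableType d) (P : probability Omega R).
Context {N : nat} (X : 'rV[R]_N -> {RV P >-> R}).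
Hypothesis gX : gaussian_field X.
Hypothesis cX : centered_field X.

Lemma sum_ford_cons n (x : R) (u : 'rV[R]_N) (f : 'I_n -> R) (t : 'I_n -> 'rV[R]_N) w :
  \sum_i ford_cons x f i * X (ford_cons u t i) w = x * X u w + \sum_k f k * X (t k) w.
Proof.
rewrite big_ord_recl !ford_cons0; congr (_ + _).
by apply: eq_bigr => k _; rewrite !ford_consS.
Qed.

Lemma qform_ford_cons n (x : R) (u : 'rV[R]_N) (f : 'I_n -> R) (t : 'I_n -> 'rV[R]_N) :
  qform X (ford_cons x f) (ford_cons u t) = x ^+ 2 * covariance_function X u u +
    2 * x * (\sum_k f k * covariance_function X u (t k)) + qform X f t.
Proof.
have cS s s' : covariance_function X s s' = covariance_function X s' s.
  rewrite /covariance_function; congr fine; rewrite unlock; apply: eq_integral => w _.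
  by rewrite mulrC.
rewrite /qform big_ord_recl big_ord_recl !ford_cons0 -expr2.
under eq_bigr do rewrite !ford_consS.
under [in X in _ + X]eq_bigr => i _.
  rewrite big_ord_recl !ford_consS !ford_cons0.
  under eq_bigr do rewrite !ford_consS.
  over.
rewrite big_split /= addrA; congr (_ + _); rewrite -addrA; congr (_ + _).
rewrite -big_split mulr_sumr /=.
by apply: eq_bigr => k _; rewrite [covariance_function X (t k) u]cS; ring.
Qed.

(** With a from the normal equations, W = X(u) - sum_k a_k X(t_k) is uncorrelated with every X(t_k).
    The variance of e W + sum_k c_k X(t_k) therefore splits, which is the factorisation [cosWX]; the
    projection is then the conditional mean, and the residual variance the conditional variance. *)
Lemma cond_variance_given_ae n (u : 'rV[R]_N) (t : 'I_n -> 'rV[R]_N) :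
  exists a : 'I_n -> R, {ae P, forall w, cond_variance_given X u t w =
    qform X (ford_cons 1 (fun k => - a k)) (ford_cons u t)}.
Proof.
have [a aE] := field_normal_equations gX cX t u; exists a.
pose W w := X u w - \sum_k a k * X (t k) w.
pose p := ford_cons u t; set b := ford_cons 1 _.
have WE w : W w = \sum_i b i * X (p i) w.
  rewrite sum_ford_cons mul1r; congr (_ + _); rewrite -sumrN.
  by apply: eq_bigr => k _; rewrite mulNr.
have mX k : measurable_fun setT (X (t k)) by exact: measurable_funPT.
have mW : measurable_fun setT W.
  by apply: measurable_funB; [exact: measurable_funPT|exact: measurable_field_lincomb].
have iW2 : P.-integrable setT (EFin \o (fun w => W w ^+ 2)).
  under eq_fun do rewrite WE.
  by have [] := field_lincomb_cos gX cX p b.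
have cosWX (e : R) c beta : \int[P]_w cos (e * W w + (\sum_k c k * X (t k) w + beta)) =
    cos beta * expR (- (e ^+ 2 * qform X b p + qform X c t) / 2).
  have [_ h] := field_lincomb_cos gX cX p (ford_cons e (fun k => c k - e * a k)).
  transitivity (\int[P]_w cos (\sum_i ford_cons e (fun k => c k - e * a k) i * X (p i) w + beta)).
    apply: eq_Rintegral => w _; congr cos; rewrite sum_ford_cons /W mulrBr mulr_sumr addrA.
    congr (_ + _); rewrite -[LHS]addrA; congr (_ + _); rewrite addrC -sumrB.
    by apply: eq_bigr => k _; ring.
  rewrite h mulNr !qform_ford_cons; congr (_ * expR (- (_ / 2))).
  set cu := fun k => covariance_function X u (t k).
  have q1 (y z : 'I_n -> R) : \sum_i \sum_j y i * z j * covariance_function X (t i) (t j) =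
      \sum_j z j * \sum_i y i * covariance_function X (t i) (t j).
    rewrite exchange_big /=; apply: eq_bigr => j _; rewrite mulr_sumr.
    by apply: eq_bigr => i _; ring.
  have q2 (z : 'I_n -> R) : \sum_i \sum_j a i * z j * covariance_function X (t i) (t j) =
      \sum_j z j * cu j.
    by rewrite q1; apply: eq_bigr => j _; rewrite -aE.
  have q3 (z : 'I_n -> R) : \sum_i \sum_j z i * a j * covariance_function X (t i) (t j) =
      \sum_j z j * cu j.
    rewrite -q2 exchange_big /=; apply: eq_bigr => j _; apply: eq_bigr => i _.
    rewrite [a j * z i]mulrC; congr (_ * _).
    by rewrite !covariance_functionE; apply: eq_Rintegral => w _; rewrite mulrC.
  (* By the normal equations every term of the expansion that involves a reduces to a pairing with
     [cu]. *)
  have qD (e' : R) : qform X (fun k => c k - e' * a k) t = qform X c t -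
      2 * e' * (\sum_k c k * cu k) + e' ^+ 2 * \sum_k a k * cu k.
    transitivity (\sum_i \sum_j c i * c j * covariance_function X (t i) (t j)
      + (- e') * (\sum_i \sum_j a i * c j * covariance_function X (t i) (t j))
      + (- e') * (\sum_i \sum_j c i * a j * covariance_function X (t i) (t j))
      + e' ^+ 2 * \sum_i \sum_j a i * a j * covariance_function X (t i) (t j)).
      rewrite !mulr_sumr -!big_split /=; apply: eq_bigr => i _.
      rewrite !mulr_sumr -!big_split /=; apply: eq_bigr => j _; ring.
    by rewrite !q2 q3 -/(qform X c t); ring.
  have qa : qform X (fun k => - a k) t = \sum_k a k * cu k.
    rewrite -q2; apply: eq_bigr => i _; apply: eq_bigr => j _; ring.
  rewrite qD qa.
  have -> : \sum_k (c k - e * a k) * cu k = \sum_k c k * cu k - e * \sum_k a k * cu k.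
    by rewrite mulr_sumr -sumrB; apply: eq_bigr => k _; ring.
  have -> : \sum_k - a k * cu k = - \sum_k a k * cu k.
    by rewrite -sumrN; apply: eq_bigr => k _; rewrite mulNr.
  rewrite -/cu; ring.
pose U := \big[setU/set0]_(k < n) preimage_set_system setT (X (t k)) (@measurable _ R).
have UE : g_sigma_preimage (fun k => X (t k) : Omega -> R) = <<s U >> by [].
have Um : <<s U >> `<=` measurable.
  apply: smallest_sub; first exact: sigma_algebra_measurable.
  rewrite /U; elim/big_ind : _ => //; first by move=> C1 C2 h1 h2; rewrite subUset.
  move=> k _ _ [C mC <-]; rewrite setTI -[X in measurable X]setTI; exact: mX.
have hA A (GA : <<s U >> A) := gaussian_independent_integral mX mW iW2 cosWX GA (Um A GA).
rewrite /cond_variance_given UE.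
pose Z w := \sum_k a k * X (t k) w.
have iZ : P.-integrable setT (EFin \o Z).
  by apply: integrable_lincomb => k; exact: field_integrable.
have iX := field_integrable gX cX u.
have EW w : W w = X u w - Z w by [].
apply: (@cond_variance_cst _ _ _ P U Um _ Z) => //.
- have mk k : @measurable_fun _ _ (g_sigma_algebraType U) R setT (X (t k)).
    move=> _ B mB; rewrite setTI; apply: sub_sigma_algebra; rewrite /U.
    rewrite (bigD1 k)//=; left; exists B => //; by rewrite setTI.
  have mZ : @measurable_fun _ _ (g_sigma_algebraType U) R setT Z.
    by apply: measurable_sum => k; exact: measurable_funM.
  by move=> B mB; rewrite -[_ @^-1` _]setTI; exact: mZ.
- move=> A GA; have mA := Um A GA; have [h _] := hA A GA.
  have iXA : P.-integrable A (EFin \o X u) by exact: (integrableS measurableT mA _ iX).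
  have iZA : P.-integrable A (EFin \o Z) by exact: (integrableS measurableT mA _ iZ).
  move: h; under eq_integral do rewrite EW EFinB; rewrite (integralB mA iXA iZA) /=.
  have : (\int[P]_(x in A) (X u x)%:E)%E \is a fin_num by exact: (integrable_fin_num mA iXA).
  have : (\int[P]_(x in A) (Z x)%:E)%E \is a fin_num by exact: (integrable_fin_num mA iZA).
  case: (\int[P]_(x in A) (Z x)%:E)%E => // z _; case: (\int[P]_(x in A) _)%E => // x _.
  by rewrite -EFinB => -[] /eqP; rewrite subr_eq0 => /eqP ->.
- by move=> A GA; have [_ <-] := hA A GA.
Qed.

End gaussian_conditional_variance.

(** * Bounds extracted from the limits, and assembly of the two conditions *)

Lemma limf_einf_enorm_gt0 (R : realType) (N : nat) (f : 'rV[R]_N -> \bar R) :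
  (0 < limf_einf f enorm_infty)%E ->
  exists c M : R, 0 < c /\ forall l, M < enorm l -> (c%:E <= f l)%E.
Proof.
rewrite limf_einfE => /ereal_sup_gt[_ [V [M _ MV] <-]] V0.
have [c c0 cV] : exists2 c : R, 0 < c & (c%:E <= ereal_inf (f @` V))%E.
  move: V0; case: (ereal_inf (f @` V)) => [r r0|_|//].
  - by exists r.
  - by exists 1 => //; rewrite leey.
exists c, M; split=> // l Ml; apply: (le_trans cV); apply: ereal_inf_lbound.
by exists l => //; exact: MV.
Qed.

Lemma limf_esup_enorm_fin (R : realType) (N : nat) (f : 'rV[R]_N -> \bar R) :
  (limf_esup f enorm_infty < +oo)%E ->
  exists c M : R, 0 <= c /\ forall l, M < enorm l -> (f l <= c%:E)%E.
Proof.
rewrite limf_esupE => /ereal_inf_lt[_ [V [M _ MV] <-]] V0.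
have [c c0 cV] : exists2 c : R, 0 <= c & (ereal_sup (f @` V) <= c%:E)%E.
  move: V0; case: (ereal_sup (f @` V)) => [r _|//|_].
  - by exists `|r| => //; rewrite lee_fin ler_norm.
  - by exists 0 => //; rewrite leNye.
exists c, M; split=> // l Ml; apply: le_trans cV; apply: ereal_sup_ubound.
by exists l => //; exact: MV.
Qed.

Theorem theorem2p4 (R : realType) (N : nat) (hN : (1 <= N)%N)
  (H : 'I_N -> R) (hH : forall j, 0 < H j < 1)
  (d : measure_display) (Omega : measurableType d) (P : probability Omega R)
  (X0 : 'rV[R]_N -> {RV P >-> R})
  (F : {measure set (borelRV R N) -> \bar R})
  (X0_gaussian : gaussian_field X0)
  (X0_centered : centered_field X0)
  (X0_stationary : stationary_increments X0)
  (X0_origin : {ae P, forall w, X0 0 w = 0})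
  (X0_cov : continuous_covariance X0)
  (X0_spectral : spectral_measure X0 F)
  (h : R) (h_gt0 : 0 < h)
  (liminf_gt0 : (0 < limf_einf
     (fun l : 'rV[R]_N => (rho H 0 l `^ (homdim H + 2))%R%:E * F (cube l h))
     enorm_infty)%E)
  (limsup_fin : (limf_esup
     (fun l : 'rV[R]_N => (rho H 0 l `^ (homdim H + 2))%R%:E * F (cube l h))
     enorm_infty < +oo)%E)
  (T : R) (T_gt0 : 0 < T) (ThN : T * h * N%:R < ln 2) :
  (exists c1 : R, 1 <= c1 /\
     forall s t : 'rV[R]_N, cube 0 T s -> cube 0 T t ->
       ((c1^-1 * rho H s t ^+ 2)%R%:E <=
          'E_P[fun w => ((X0 s w - X0 t w) ^+ 2)%R])%E /\
       ('E_P[fun w => ((X0 s w - X0 t w) ^+ 2)%R] <=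
          (c1 * rho H s t ^+ 2)%R%:E)%E)
  /\
  (exists c2 : R, 0 < c2 /\
     forall (n : nat) (u : 'rV[R]_N) (t : 'I_n -> 'rV[R]_N), (1 <= n)%N ->
       cube 0 T u -> (forall k, cube 0 T (t k)) ->
       {ae P, forall w,
         c2 * \big[Num.min/rho H u 0 ^+ 2]_(k < n) rho H u (t k) ^+ 2
           <= cond_variance_given X0 u t w}).

Proof.
have [cF [MF [cF0 F_ge]]] := limf_einf_enorm_gt0 liminf_gt0.
have [CF [MF' [CF0 F_le]]] := limf_esup_enorm_fin limsup_fin.
have [c c0 lower] := qform_lower_bound X0_spectral X0_cov hN hH h_gt0 T_gt0 ThN cF0 F_ge.
have [C' [S0 [C'0 S01 tail]]] := tail_measure_bound hH h_gt0 CF0 F_le.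
have [C C0 upper] := qform_upper_bound X0_spectral hH (ltW T_gt0) C'0 S01 tail.
have incr s t : ('E_P[fun w => ((X0 s w - X0 t w) ^+ 2)%R] =
    (qform X0 (fun i : 'I_2 => if i == 0 then 1 else - 1)
      (fun i : 'I_2 => if i == 0 then s else t))%:E)%E.
  rewrite -(field_lincomb_qform X0_gaussian X0_centered) unlock.
  apply: eq_integral => w _; congr (_ ^+ 2)%:E.
  by rewrite !big_ord_recl big_ord0 /= addr0 mul1r mulN1r.
split.
  pose c1 := 1 + c^-1 + C.
  have ci0 : 0 < c^-1 by rewrite invr_gt0.
  have c11 : 1 <= c1 by rewrite /c1; lra.
  exists c1; split => // s t sT tT; rewrite incr !lee_fin; split.
    apply: (@le_trans _ _ (c * rho H s t ^+ 2)).
      rewrite ler_wpM2r ?sqr_ge0// -[leRHS]invrK lef_pV2 ?posrE//; last by lra.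
      by rewrite /c1; lra.
    (* The two-point case with coefficients 1 and -1 and r = rho(s, t). *)
    apply: lower => //; first by rewrite !big_ord_recl big_ord0 /= addr0 subrr.
    - by move=> i; case: ifP.
    - exact: rho_ge0.
  apply: (le_trans (upper s t sT tT)); rewrite ler_wpM2r ?sqr_ge0// /c1; lra.
exists c; split => // n u t n1 uT tT.
have [a aE] := cond_variance_given_ae X0_gaussian X0_centered u t.
apply: filterS aE => w ->.
set m := \big[Num.min/_]_(k < n) _.
have m0 : 0 <= m.
  by rewrite /m; elim/big_ind: _ => [|x y x0 y0|k _]; rewrite ?sqr_ge0// le_min x0.
(* The origin is inserted with coefficient sum_k a_k - 1, which makes the total zero. As X0(0) = 0
   almost surely, the variance is unchanged. *)
pose b := ford_cons (1 : R) (ford_cons (\sum_k a k - 1) (fun k => - a k)).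
pose p := ford_cons u (ford_cons 0 t).
have qE : qform X0 (ford_cons 1 (fun k => - a k)) (ford_cons u t) = qform X0 b p.
  apply: EFin_inj; rewrite -!(field_lincomb_qform X0_gaussian X0_centered).
  apply: ae_eq_integral => //.
  - apply/measurable_EFinP; apply: measurable_funX; exact: measurable_field_lincomb.
  - apply/measurable_EFinP; apply: measurable_funX; exact: measurable_field_lincomb.
  - apply: filterS X0_origin => w' w0 _; congr (_ ^+ 2)%:E.
    by rewrite !sum_ford_cons w0 mulr0 add0r.
(* The separation is r = sqrt m: the entries of the minimum bound the distances to the t_k, its
   default value the distance to the origin. *)
rewrite qE -(sqr_sqrtr m0); apply: lower.
- by rewrite /b ford_cons0.
- rewrite /b big_ord_recl ford_cons0; under eq_bigr do rewrite ford_consS.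
  rewrite big_ord_recl ford_cons0; under [X in _ + (_ + X)]eq_bigr do rewrite ford_consS.
  by rewrite sumrN; ring.
- move=> i; rewrite /p; case: (unliftP ord0 i) => [j ->|->]; rewrite ?ford_cons0 ?ford_consS//.
  case: (unliftP ord0 j) => [k ->|->]; rewrite ?ford_cons0 ?ford_consS//.
  by move=> j'; rewrite !mxE subrr normr0 ltW.
- exact: sqrtr_ge0.
- move=> k; rewrite /p ford_cons0 ford_consS -[leRHS]ger0_norm ?rho_ge0// -sqrtr_sqr ler_wsqrtr//.
  case: (unliftP ord0 k) => [k' ->|->]; rewrite ?ford_cons0 ?ford_consS.
    exact: bigmin_le_cond.
  exact: bigmin_le_id.
Qed.
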